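(* Let $k$ be a real valued field of residual exponential characteristic $p$ and let $\mathcal{A}$ be a spectral normed $k$-algebra. Assume that either $p=1$ or the completion $\widehat{k}$ is perfectoid. Then $\mathcal{A}$ is geometrically spectral over $k$.
   Context: All rings are commutative and all seminorms are non-archimedean (and submultiplicative on rings). A real valued field is a field with a non-archimedean multiplicative norm with values in $\mathbb{R}_{\ge 0}$; an extension of real valued fields $l/k$ is a field extension in which the valuation of $l$ extends that of $k$. The residual exponential characteristic $p$ of $k$ is the characteristic of the residue field if that is positive, and $p=1$ otherwise. A seminormed ring is spectral (power-multiplicative) if $|a^n|=|a|^n$ for all $a$ and $n\ge 0$. A seminormed $k$-algebra $\mathcal{A}$ is geometrically spectral if for every extension of real valued fields $l/k$ the algebra $\mathcal{A}\otimes_k l$ with the tensor product seminorm $\|x\|=\inf_{x=\sum a_i\otimes b_i}\max_i\|a_i\|\,\|b_i\|$ is spectral. A real valued field $F$ with $F^\circ=\{|x|\le 1\}$ and $F^{\circ\circ}=\{|x|<1\}$ is perfectoid if it is non-discretely valued, complete, of positive residual characteristic $p$, and the Frobenius is surjective on $F^\circ/\pi F^\circ$ for some (and then any) nonzero $\pi\in F^{\circ\circ}$ with $|p|\le|\pi|$. *)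

(* Defs.v *)
From HB Require Import structures.
From mathcomp Require Import all_boot all_order all_algebra.
From mathcomp Require Import generic_quotient ring_quotient.
From mathcomp Require Import all_classical all_reals all_analysis.

Set Implicit Arguments.
Unset Strict Implicit.
Unset Printing Implicit Defensive.

Import Order.TTheory GRing.Theory Num.Theory.
Import numFieldNormedType.Exports.

Local Open Scope quotient_scope.
Local Open Scope classical_set_scope.
Local Open Scope ring_scope.

(* The library's [normedModType] only covers modules over numeric fields normed
   by their absolute value, so non-archimedean norms are set up from scratch. *)

HB.mixin Record Field_isRealValued (R : realType) K of GRing.Field K := {
  vnorm : K -> R;
  vnorm_ge0 : forall x, 0 <= vnorm x;
  vnorm_eq0 : forall x, (vnorm x == 0) = (x == 0);
  vnorm1 : vnorm 1 = 1;
  vnormM : {morph vnorm : x y / x * y};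
  vnormD : forall x y, vnorm (x + y) <= Num.max (vnorm x) (vnorm y)
}.

(* The trivial norm (1 on all nonzero elements) is allowed. *)
#[short(type="realValuedFieldType")]
HB.structure Definition RealValuedField (R : realType) :=
  {K of GRing.Field K & Field_isRealValued R K}.

(* An extension of real valued fields is a ring morphism (automatically
   injective, the source being a field) satisfying this predicate. *)
Definition isometric (R : realType) (k l : realValuedFieldType R)
  (i : k -> l) : Prop := forall x, vnorm (i x) = vnorm x.

Section ValuationRing.
Variables (R : realType) (K : realValuedFieldType R).
Implicit Types x y : K.

Lemma vnorm0 : vnorm (0 : K) = 0.
Proof. by apply/eqP; rewrite vnorm_eq0. Qed.

Lemma vnormN x : vnorm (- x) = vnorm x.
Proof.
have h : vnorm (-1 : K) = 1.
  apply/eqP; rewrite -sqrp_eq1 ?vnorm_ge0// expr2 -vnormM.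
  by rewrite mulrNN mulr1 vnorm1.
by rewrite -mulN1r vnormM h mul1r.
Qed.

Definition vring_pred : {pred K} := [pred x | vnorm x <= 1].

Lemma vring_subring_closed : subring_closed vring_pred.
Proof.
split=> [|x y|x y]; rewrite !inE ?vnorm1// => xle yle.
- by rewrite (le_trans (vnormD _ _))// ge_max xle vnormN.
- by rewrite vnormM mulr_ile1 ?vnorm_ge0.
Qed.
HB.instance Definition _ :=
  GRing.isSubringClosed.Build K vring_pred vring_subring_closed.

Definition vring := {x : K | x \in vring_pred}.
HB.instance Definition _ := SubChoice.on vring.
HB.instance Definition _ := [SubChoice_isSubComNzRing of vring by <:].

Definition vmaxideal : {pred vring} := [pred x : vring | vnorm (val x) < 1].

Lemma vmaxideal_closed : idealr_closed vmaxideal.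
Proof.
split=> [||a x y]; rewrite !inE.
- by rewrite raddf0 vnorm0 ltr01.
- by rewrite rmorph1 vnorm1 ltxx.
move=> xlt ylt; rewrite rmorphD rmorphM (le_lt_trans (vnormD _ _))//.
rewrite gt_max ylt andbT vnormM (le_lt_trans _ xlt)//.
by rewrite ler_piMl ?vnorm_ge0//; exact: (valP a).
Qed.
HB.instance Definition _ := isIdealr.Build vring vmaxideal vmaxideal_closed.

(* Only the ring structure of this quotient is declared: that is all the notion
   of characteristic requires. *)
Definition residue_field := {ideal_quot vmaxideal}.
HB.instance Definition _ := GRing.ComNzRing.on residue_field.

End ValuationRing.

Arguments vring {R} K.
Arguments vmaxideal {R} K.
Arguments residue_field {R} K.

Definition residual_exp_char (R : realType) (K : realValuedFieldType R)
    (p : nat) : Prop :=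
  p \in [pchar residue_field K] \/
  ([pchar residue_field K] =i pred0 /\ p = 1%N).

Section Perfectoid.
Variables (R : realType) (K : realValuedFieldType R).

Definition value_group : set R := [set vnorm x | x in [set x : K | x != 0]].

(* The value group is discrete as a subspace of the reals (since it consists of
   positive numbers, the ambient space may be taken to be R rather than R_{>0}).
   A trivially valued field is discretely valued. *)
Definition discretely_valued : Prop := value_group `<=` isolated value_group.

Definition vcauchy (u : nat -> K) : Prop :=
  forall e : R, 0 < e -> exists n : nat, forall m m' : nat,
    (n <= m)%N -> (n <= m')%N -> vnorm (u m - u m') < e.

Definition vcvg (u : nat -> K) (x : K) : Prop :=
  forall e : R, 0 < e -> exists n : nat, forall m : nat,
    (n <= m)%N -> vnorm (u m - x) < e.

Definition vcomplete : Prop := forall u, vcauchy u -> exists x, vcvg u x.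

Definition perfectoid : Prop := exists p : nat,
  [/\ p \in [pchar residue_field K],
      vcomplete,
      ~ discretely_valued &
      exists pi : vring K,
        [/\ pi != 0, pi \in vmaxideal K, vnorm (p%:R : K) <= vnorm (val pi) &
            (* x is congruent to y ^+ p modulo the ideal generated by pi *)
            forall x : vring K, exists y z : vring K, x = y ^+ p + pi * z]].

End Perfectoid.

Definition is_completion (R : realType) (k K : realValuedFieldType R)
    (j : {rmorphism k -> K}) : Prop :=
  [/\ isometric j, vcomplete K &
      forall (y : K) (e : R), 0 < e -> exists x : k, vnorm (y - j x) < e].

(* Completions exist and are unique up to unique isometric isomorphism, so it
   does not matter which one is meant. *)
Definition completion_perfectoid (R : realType) (k : realValuedFieldType R) :=
  exists (K : realValuedFieldType R) (j : {rmorphism k -> K}),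
    is_completion j /\ perfectoid K.

Section Seminorms.
Variable R : realType.

Record ring_seminorm (A : pzRingType) (N : A -> R) : Prop := RingSeminorm {
  seminorm_ge0 : forall x, 0 <= N x;
  seminorm0 : N 0 = 0;
  seminormB : forall x y, N (x - y) <= Num.max (N x) (N y);
  seminormM : forall x y, N (x * y) <= N x * N y
}.

(* The case n = 0 forces N 1 = 1. *)
Definition spectral (A : pzRingType) (N : A -> R) : Prop :=
  forall (a : A) (n : nat), N (a ^+ n) = N a ^+ n.

(* Applying the inequality to c and c^-1 turns it into an equality. *)
Record alg_seminorm (k : realValuedFieldType R) (A : comAlgType k)
    (N : A -> R) : Prop := AlgSeminorm {
  alg_seminorm_ring : ring_seminorm N;
  alg_seminormZ : forall (c : k) (x : A), N (c *: x) <= vnorm c * N x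
}.

Record alg_norm (k : realValuedFieldType R) (A : comAlgType k)
    (N : A -> R) : Prop := AlgNorm {
  alg_norm_seminorm : alg_seminorm N;
  alg_norm_eq0 : forall x, N x = 0 -> x = 0
}.

End Seminorms.

(* A ⊗_k l, for l a k-algebra via i, as the quotient of the commutative monoid
   of formal sums of pairs (a, b), encoded as lists, by the congruence generated
   by commutativity and the bilinearity relations. *)
Section TensorProduct.
Variables (k l : fieldType) (A : comAlgType k) (i : {rmorphism k -> l}).
Local Notation formal := (seq (A * l)).
Implicit Types s t : formal.

Inductive tens_rel : formal -> formal -> Prop :=
| tens_refl s : tens_rel s s
| tens_sym s t : tens_rel s t -> tens_rel t s
| tens_trans s t u : tens_rel s t -> tens_rel t u -> tens_rel s u
| tens_cat s s' t t' :
    tens_rel s s' -> tens_rel t t' -> tens_rel (s ++ t) (s' ++ t')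
| tens_catC s t : tens_rel (s ++ t) (t ++ s)
| tens_addl a a' b : tens_rel [:: (a + a', b)] [:: (a, b); (a', b)]
| tens_addr a b b' : tens_rel [:: (a, b + b')] [:: (a, b); (a, b')]
| tens_scale c a b : tens_rel [:: (c *: a, b)] [:: (a, i c * b)]
| tens_zero b : tens_rel [:: (0, b)] [::].

Definition tens_relb s t : bool := `[< tens_rel s t >].

Lemma tens_relb_equiv : equiv_class_of tens_relb.
Proof.
split=> [s|s t|t s u].
- exact/asboolP/tens_refl.
- by apply/asboolP/asboolP; exact: tens_sym.
- by move=> /asboolP st /asboolP tu; apply/asboolP/(tens_trans st tu).
Qed.
Canonical tens_equiv := EquivRelPack tens_relb_equiv.
Canonical tens_encModRel := defaultEncModRel tens_relb.

Definition tensor := {eq_quot tens_relb}.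
HB.instance Definition _ : EqQuotient formal tens_relb tensor :=
  EqQuotient.on tensor.
HB.instance Definition _ := Choice.on tensor.

Lemma tensP s t : reflect (tens_rel s t) (\pi_tensor s == \pi_tensor t).
Proof. by rewrite piE; exact: asboolP. Qed.

Definition formal_mul1 (x y : A * l) : A * l := (x.1 * y.1, x.2 * y.2).
Definition formal_opp s : formal := [seq (- x.1, x.2) | x <- s].
Definition formal_mul s t : formal := [seq formal_mul1 x y | x <- s, y <- t].

Lemma perm_tens s t : perm_eq s t -> tens_rel s t.
Proof.
elim: s t => [|x s IH] t.
  by rewrite perm_sym => /perm_nilP ->; exact: tens_refl.
move=> h; have : x \in t by rewrite -(perm_mem h) mem_head.
move=> /path.splitPr tE; case: tE h => t1 t2 h.
have st : perm_eq s (t1 ++ t2).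
  by rewrite -(perm_cons x) (perm_trans h)// -cat1s perm_catCA.
apply: (@tens_trans _ ([:: x] ++ (t1 ++ t2))).
  by apply: (@tens_cat [:: x] [:: x]); [exact: tens_refl|exact: IH].
rewrite catA -[x :: t2]/([:: x] ++ t2) [X in tens_rel _ X]catA.
by apply: tens_cat; [exact: tens_catC|exact: tens_refl].
Qed.

Lemma formal_opp_rel s t :
  tens_rel s t -> tens_rel (formal_opp s) (formal_opp t).
Proof.
rewrite /formal_opp; elim=> {s t} [s|s t _ h|s t u _ h _ h'
    |s s' t t' _ h _ h'|s t|a a' b|a b b'|c a b|b] /=.
- exact: tens_refl.
- exact: tens_sym.
- exact: tens_trans h h'.
- by rewrite !map_cat; exact: tens_cat.
- by rewrite !map_cat; exact: tens_catC.
- by rewrite opprD; exact: tens_addl.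
- exact: tens_addr.
- by rewrite -scalerN; exact: tens_scale.
- by rewrite oppr0; exact: tens_zero.
Qed.

Lemma formal_mul1_rel x s t : tens_rel s t ->
  tens_rel [seq formal_mul1 x y | y <- s] [seq formal_mul1 x y | y <- t].
Proof.
rewrite /formal_mul1; elim=> {s t} [s|s t _ h|s t u _ h _ h'
    |s s' t t' _ h _ h'|s t|a a' b|a b b'|c a b|b] /=.
- exact: tens_refl.
- exact: tens_sym.
- exact: tens_trans h h'.
- by rewrite !map_cat; exact: tens_cat.
- by rewrite !map_cat; exact: tens_catC.
- by rewrite mulrDr; exact: tens_addl.
- by rewrite mulrDr; exact: tens_addr.
- by rewrite -scalerAr mulrCA; exact: tens_scale.
- by rewrite mulr0; exact: tens_zero.
Qed.

Lemma formal_mulC s t : tens_rel (formal_mul s t) (formal_mul t s).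
Proof.
apply: perm_tens; rewrite /formal_mul; elim: s => [|x s IH].
  by rewrite allpairs0r.
rewrite allpairs_cons perm_sym perm_allpairs_consr perm_sym.
apply: perm_cat IH; rewrite (@eq_map _ _ _ (formal_mul1^~ x))// => y.
by congr (_, _); exact: mulrC.
Qed.

Lemma formal_mul_rel s s' t t' : tens_rel s s' -> tens_rel t t' ->
  tens_rel (formal_mul s t) (formal_mul s' t').
Proof.
have mulr_rel u v v' : tens_rel v v' ->
    tens_rel (formal_mul u v) (formal_mul u v').
  move=> vv'; elim: u => [|x u IH]; first exact: tens_refl.
  by rewrite /formal_mul !allpairs_cons; apply: tens_cat IH; exact: formal_mul1_rel.
move=> ss' tt'; apply: (tens_trans (mulr_rel _ _ _ tt')).
apply: (tens_trans (formal_mulC _ _)); apply: tens_trans (formal_mulC _ _).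
exact: mulr_rel.
Qed.

Lemma formal_addN s : tens_rel (formal_opp s ++ s) [::].
Proof.
elim: s => [|[a b] s IH]; first exact: tens_refl.
apply: (@tens_trans _ ([:: (- a, b); (a, b)] ++ (formal_opp s ++ s))).
  apply: perm_tens; rewrite /= perm_cons -cat_rcons -[(a, b) :: _]cat1s.
  by rewrite -cats1 -catA perm_catCA.
apply: (@tens_trans _ ([::] ++ [::])); last exact: tens_refl.
apply: tens_cat IH; apply: tens_trans (tens_zero b).
by rewrite -(addNr a); exact/tens_sym/tens_addl.
Qed.

Definition tens_of (s : formal) : tensor := \pi_tensor s.
Definition tens_add (x y : tensor) : tensor := tens_of (repr x ++ repr y).
Definition tens_opp (x : tensor) : tensor := tens_of (formal_opp (repr x)).
Definition tens_mul (x y : tensor) : tensor :=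
  tens_of (formal_mul (repr x) (repr y)).

Definition tens (a : A) (b : l) : tensor := tens_of [:: (a, b)].

Lemma tens_ofE s t : tens_of s = tens_of t <-> tens_rel s t.
Proof. by split=> [/eqP/tensP|/tensP/eqP]. Qed.

Lemma tens_repr s : tens_rel (repr (tens_of s)) s.
Proof. by apply/tens_ofE; rewrite /tens_of reprK. Qed.

Lemma tens_of_ind (P : tensor -> Prop) :
  (forall s, P (tens_of s)) -> forall x, P x.
Proof. by move=> h x; rewrite -(reprK x); exact: h. Qed.

Lemma tens_addE s t : tens_add (tens_of s) (tens_of t) = tens_of (s ++ t).
Proof. by apply/tens_ofE/tens_cat; exact: tens_repr. Qed.

Lemma tens_oppE s : tens_opp (tens_of s) = tens_of (formal_opp s).
Proof. exact/tens_ofE/formal_opp_rel/tens_repr. Qed.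

Lemma tens_mulE s t :
  tens_mul (tens_of s) (tens_of t) = tens_of (formal_mul s t).
Proof. by apply/tens_ofE/formal_mul_rel; exact: tens_repr. Qed.

Lemma tens_addA : associative tens_add.
Proof.
elim/tens_of_ind=> s; elim/tens_of_ind=> t; elim/tens_of_ind=> u.
by rewrite !tens_addE catA.
Qed.

Lemma tens_addC : commutative tens_add.
Proof.
elim/tens_of_ind=> s; elim/tens_of_ind=> t.
by rewrite !tens_addE; exact/tens_ofE/tens_catC.
Qed.

Lemma tens_add0 : left_id (tens_of [::]) tens_add.
Proof. by elim/tens_of_ind=> s; rewrite tens_addE. Qed.

Lemma tens_addN : left_inverse (tens_of [::]) tens_opp tens_add.
Proof.
elim/tens_of_ind=> s.
by rewrite tens_oppE tens_addE; exact/tens_ofE/formal_addN.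
Qed.

HB.instance Definition _ :=
  GRing.isZmodule.Build tensor tens_addA tens_addC tens_add0 tens_addN.

Lemma tens_mulC : commutative tens_mul.
Proof.
elim/tens_of_ind=> s; elim/tens_of_ind=> t.
by rewrite !tens_mulE; exact/tens_ofE/formal_mulC.
Qed.

Lemma tens_mul1 : left_id (tens 1 1) tens_mul.
Proof.
elim/tens_of_ind=> s; rewrite tens_mulE /formal_mul allpairs1l map_id_in//.
by case=> a b _; rewrite /formal_mul1 /= !mul1r.
Qed.

Lemma tens_mulDl : left_distributive tens_mul +%R.
Proof.
elim/tens_of_ind=> s; elim/tens_of_ind=> t; elim/tens_of_ind=> u.
rewrite -[_ + _]/(tens_add _ _) -[RHS]/(tens_add _ _).
by rewrite !(tens_addE, tens_mulE) /formal_mul allpairs_cat.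
Qed.

Lemma tens_mulA : associative tens_mul.
Proof.
elim/tens_of_ind=> s; elim/tens_of_ind=> t; elim/tens_of_ind=> u.
rewrite !tens_mulE; congr tens_of; elim: s => // x s IH.
transitivity ([seq formal_mul1 x y | y <- formal_mul t u] ++
              formal_mul s (formal_mul t u)) => //.
rewrite {}IH [in RHS]/formal_mul allpairs_cons allpairs_cat; congr cat.
rewrite /formal_mul map_allpairs allpairs_mapl.
by apply: eq_allpairs => y z; rewrite /formal_mul1 /= !mulrA.
Qed.

HB.instance Definition _ := GRing.Zmodule_isComPzRing.Build tensor
  tens_mulA tens_mulC tens_mul1 tens_mulDl.

Lemma tens_of_sum s : tens_of s = \sum_(x <- s) tens x.1 x.2.
Proof.
elim: s => [|[a b] s IH]; first by rewrite big_nil.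
by rewrite big_cons -IH -[RHS]/(tens_add _ _) tens_addE.
Qed.

Lemma tensDl a a' b : tens (a + a') b = tens a b + tens a' b.
Proof. by rewrite -[RHS]/(tens_add _ _) tens_addE; exact/tens_ofE/tens_addl. Qed.

Lemma tensDr a b b' : tens a (b + b') = tens a b + tens a b'.
Proof. by rewrite -[RHS]/(tens_add _ _) tens_addE; exact/tens_ofE/tens_addr. Qed.

Lemma tensZ c a b : tens (c *: a) b = tens a (i c * b).
Proof. exact/tens_ofE/tens_scale. Qed.

Lemma tensM a a' b b' : tens a b * tens a' b' = tens (a * a') (b * b').
Proof. by rewrite -[LHS]/(tens_mul _ _) tens_mulE. Qed.

(* The universal property; uniqueness of h follows from [tens_of_sum]. *)
Lemma tens_lift (V : zmodType) (f : A -> l -> V) :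
    (forall a a' b, f (a + a') b = f a b + f a' b) ->
    (forall a b b', f a (b + b') = f a b + f a b') ->
    (forall c a b, f (c *: a) b = f a (i c * b)) ->
  exists2 h : tensor -> V, {morph h : x y / x + y} &
    forall a b, h (tens a b) = f a b.
Proof.
move=> fDl fDr fZ; pose g s := \sum_(x <- s) f x.1 x.2.
have g_rel s t : tens_rel s t -> g s = g t.
  rewrite /g; elim=> {s t} [s|s t _ h|s t u _ h _ h'
      |s s' t t' _ h _ h'|s t|a a' b|a b b'|c a b|b] //=.
  - by rewrite h.
  - by rewrite !big_cat /= h h'.
  - by rewrite !big_cat /= addrC.
  - by rewrite !big_cons !big_nil /= !addr0 fDl.
  - by rewrite !big_cons !big_nil /= !addr0 fDr.
  - by rewrite !big_seq1 /= fZ.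
  - rewrite big_seq1 big_nil /=; apply: (addrI (f 0 b)).
    by rewrite -fDl !addr0.
have gE s : g (repr (tens_of s)) = g s by apply/g_rel/tens_repr.
exists (g \o repr) => [x y|a b] /=; last by rewrite gE /g big_seq1.
by rewrite -[x + y]/(tens_add x y) /tens_add gE /g big_cat.
Qed.

End TensorProduct.

Section GeometricallySpectral.
Variables (R : realType) (k : realValuedFieldType R) (A : comAlgType k).

Definition tensor_seminorm (l : realValuedFieldType R) (i : {rmorphism k -> l})
    (N : A -> R) (x : tensor A i) : R :=
  inf [set \big[Num.max/0]_(p <- s) (N p.1 * vnorm p.2) | s in
        [set s : seq (A * l) | x = \sum_(p <- s) tens i p.1 p.2]].

Definition geometrically_spectral (N : A -> R) : Prop :=
  forall (l : realValuedFieldType R) (i : {rmorphism k -> l}),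
    isometric i -> spectral (@tensor_seminorm l i N).

End GeometricallySpectral.

(* Main.v *)
(* Write T for the tensor product of A with a valued extension L of k. Any
   D-linear functional on L, for D a subfield, extends to T, and the ultrametric
   Hahn-Banach theorem, which needs no completeness when only finitely many
   values have to be controlled, shows that the norm of an element of T may be
   computed inside the tensor product of A with any subfield containing its
   coordinates.

   If the completion of k is perfectoid, then every element of k is close to a
   p-th power. Hence if (e_j) is an almost orthogonal family in L over k, so is
   (e_j ^ p), and the norm of (sum a_j e_j) ^ p = sum a_j ^ p e_j ^ p + O(p) is
   almost max N(a_j) ^ p |e_j| ^ p.

   In residue characteristic zero we may assume L complete. By Zorn's lemma there
   is a maximal subfield D of L over which the norm is power-multiplicative; D is
   closed. If c is algebraic over D of degree d, the functional t = Tr / d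
   satisfies N(t(y)) <= s as soon as the powers of y grow at most like s ^ m,
   because the Gauss norm of the characteristic polynomial is
   power-multiplicative; peeling off summands with t then bounds the norm of y by
   s. So D is relatively algebraically closed in L. If b is not in D, Newton's
   method shows that for every polynomial f over D there is c in D for which |f(b)|
   is the Gauss norm of f on the disc of center c and radius |b - c|, and Gauss
   norms are power-multiplicative. So D = L. *)
Require Import Defs.
From HB Require Import structures.
From mathcomp Require Import all_boot all_order all_algebra.
From mathcomp Require Import generic_quotient ring_quotient.
From mathcomp Require Import all_classical all_reals all_analysis.
From mathcomp Require Import ring lra zify.

Set Implicit Arguments.
Unset Strict Implicit.
Unset Printing Implicit Defensive.

Import Order.TTheory GRing.Theory Num.Theory.
Import numFieldNormedType.Exports.
Local Open Scope classical_set_scope.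
Local Open Scope ring_scope.

(** * Linear algebra over a subfield *)

(** Power-multiplicativity is compared over many fields between k and L. They are kept as subsets D
    of one L, and A ⊗ D as a subset of one ring T with one norm, so nothing has to be transported
    between tensor products and unions of chains cause no difficulty. Neither the infimum that
    defines the norm nor the distance from a vector to a subspace need be attained, so orthogonality
    holds only up to a factor al < 1. In the perfectoid case the relative error th of p-th roots is
    fixed while al may be taken close to 1, so that th < al ^ p. The error terms are then strictly
    smaller than the main ones, and an ultrametric sum has the norm of its strictly largest part. In
    residue characteristic zero every positive integer has norm 1. Hence the division by d in Tr / d
    costs nothing, and differentiation preserves the norms of all coefficients but the constant one,
    which lets the search for a center pass from f' to f. Completeness gives Newton's method its
    limit and makes coordinates over D bounded. *)

Section SubfieldLinearAlgebra.
Variable L : fieldType.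
Implicit Types (D W : set L) (g : L -> L).

Record subfield D : Prop := Subfield {
  subfield1 : D 1;
  subfieldB : forall x y, D x -> D y -> D (x - y);
  subfieldM : forall x y, D x -> D y -> D (x * y);
  subfieldV : forall x, D x -> D x^-1
}.

Record lsubspace D W : Prop := Subspace {
  subspace0 : W 0;
  subspaceD : forall x y, W x -> W y -> W (x + y);
  subspaceZ : forall d x, D d -> W x -> W (d * x)
}.

(** The codomain is L, with values constrained to D, because D is a set; [functional_range] recovers
    a map to k when D is the image of k. *)
Record functional D g : Prop := Functional {
  functionalD : {morph g : x y / x + y};
  functionalZ : forall d x, D d -> g (d * x) = d * g x;
  functional_val : forall x, D (g x)
}.

Section Subfield.
Variables (D : set L) (Dsub : subfield D).

Lemma subfield0 : D 0.
Proof. by rewrite -(subrr 1); apply: (subfieldB Dsub); exact: subfield1. Qed.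

Lemma subfieldN x : D x -> D (- x).
Proof. by move=> Dx; rewrite -sub0r; apply: (subfieldB Dsub) => //; exact: subfield0. Qed.

Lemma subfieldD x y : D x -> D y -> D (x + y).
Proof. by move=> Dx Dy; rewrite -(opprK y); apply: (subfieldB Dsub) => //; exact: subfieldN. Qed.

Lemma subfield_sum (I : Type) (r : seq I) (P : pred I) (F : I -> L) :
  (forall i, P i -> D (F i)) -> D (\sum_(i <- r | P i) F i).
Proof. by move=> DF; apply: (big_ind D) => //; [exact: subfield0|exact: subfieldD]. Qed.

Lemma subfieldX x n : D x -> D (x ^+ n).
Proof.
move=> Dx; elim: n => [|n IH]; first by rewrite expr0; exact: subfield1 Dsub.
by rewrite exprS; exact: (subfieldM Dsub).
Qed.

Lemma subfield_nat n : D n%:R.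
Proof.
elim: n => [|n IH]; first exact: subfield0.
by rewrite mulrS; apply: subfieldD => //; exact: subfield1 Dsub.
Qed.

Lemma subspace_self : lsubspace D D.
Proof. by split; [exact: subfield0|exact: subfieldD|exact: subfieldM Dsub]. Qed.

End Subfield.

Section Functional.
Variables (D : set L) (Dsub : subfield D).

Lemma subspaceB W x y : lsubspace D W -> W x -> W y -> W (x - y).
Proof.
move=> Wsub Wx Wy; apply: (subspaceD Wsub) => //; rewrite -mulN1r.
by apply: (subspaceZ Wsub) => //; exact/(subfieldN Dsub)/(subfield1 Dsub).
Qed.

Definition adjoin_vector W v : set L := [set x | exists d, D d /\ W (x - d * v)].

Lemma sub_adjoin_vector W v : W `<=` adjoin_vector W v.
Proof.
by move=> x Wx; exists 0; split; [exact: subfield0|rewrite mul0r subr0].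
Qed.

Lemma mem_adjoin_vector W v : lsubspace D W -> adjoin_vector W v v.
Proof.
move=> Wsub; exists 1; split; first exact: subfield1.
by rewrite mul1r subrr; exact: subspace0 Wsub.
Qed.

Lemma subspace_adjoin W v : lsubspace D W -> lsubspace D (adjoin_vector W v).
Proof.
move=> Wsub; split=> [|y z [d [Dd Vd]] [e [De Ve]]|e y De [d [Dd Vd]]].
- exact/sub_adjoin_vector/(subspace0 Wsub).
- exists (d + e); split; first exact: subfieldD.
  by rewrite mulrDl opprD addrACA; exact: subspaceD Wsub _ _ _ _.
- exists (e * d); split; first exact: (subfieldM Dsub).
  by rewrite -mulrA -mulrBr; exact: subspaceZ Wsub _ _ _ _.
Qed.

Lemma functional0 g : functional D g -> g 0 = 0.
Proof. by move=> fg; apply: (addrI (g 0)); rewrite -(functionalD fg) !addr0. Qed.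

Lemma functionalN g x : functional D g -> g (- x) = - g x.
Proof.
move=> fg; apply: (addrI (g x)).
by rewrite -(functionalD fg) !subrr (functional0 fg).
Qed.

Lemma functional1 g d : functional D g -> g 1 = 1 -> D d -> g d = d.
Proof. by move=> fg g1 Dd; rewrite -[in LHS](mulr1 d) (functionalZ fg)// g1 mulr1. Qed.


(* A maximal subspace avoiding v is a hyperplane. *)
Lemma separating_functional W v : lsubspace D W -> ~ W v ->
  exists g, [/\ functional D g, forall w, W w -> g w = 0 & g v = 1].
Proof.
move=> Wsub Wv.
(* Joining W to U makes the empty chain, whose union is empty, satisfy P as well. *)
pose P (U : set L) := lsubspace D (U `|` W) /\ ~ (U `|` W) v.
have [F FP Ftot|U [[Usub Uv] Umax]] := @Zorn_bigcup L P.
  have up x y : ((\bigcup_(X in F) X) `|` W) x -> ((\bigcup_(X in F) X) `|` W) y ->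
      exists X, [/\ P X, (X `|` W) x, (X `|` W) y &
                     X `|` W `<=` (\bigcup_(X in F) X) `|` W].
    have sub X : F X -> X `|` W `<=` (\bigcup_(X in F) X) `|` W.
      by move=> FX z [Xz|]; [left; exists X|right].
    move=> [[X FX Xx]|Wx] [[Y FY Yy]|Wy].
    - have [XY|YX] := Ftot _ _ FX FY.
        exists Y; split; [exact: FP|by left; exact: XY|by left|exact: sub].
      exists X; split; [exact: FP|by left|by left; exact: YX|exact: sub].
    - exists X; split; [exact: FP|by left|by right|exact: sub].
    - exists Y; split; [exact: FP|by right|by left|exact: sub].
    - by exists W; split; rewrite /P ?setUid//; right.
  split.
    split=> [|x y Ux Uy|d x Dd Ux].
    - by right; exact: subspace0 Wsub.
    - by have [X [[Xs _] Xx Xy]] := up _ _ Ux Uy; apply; exact: subspaceD Xs _ _ _ _.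
    - by have [X [[Xs _] Xx _]] := up _ _ Ux Ux; apply; exact: subspaceZ Xs _ _ Dd _.
  by move=> Uv; have [X [[_ +] + _ _]] := up _ _ Uv Uv.
pose V := U `|` W; rewrite -/V in Usub Uv.
have decomp x : exists d, D d /\ V (x - d * v).
  have [Vx|Vx] := pselect (V x); first exact: sub_adjoin_vector.
  (* Either v lies in V + D x, and the relation is solved for x, or V + D x is a larger subspace
     that avoids v. *)
  have [[d [Dd Vd]]|xv] := pselect (adjoin_vector V x v).
    have d0 : d != 0.
      by apply/eqP => d0; apply: Uv; move: Vd; rewrite d0 mul0r subr0.
    exists d^-1; split; first exact: subfieldV.
    have -> : x - d^-1 * v = - d^-1 * (v - d * x) by field.
    by apply: (subspaceZ Usub) => //; exact/(subfieldN Dsub)/(subfieldV Dsub).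
  exfalso; apply: (Umax (adjoin_vector V x)); first split.
  - by move=> y Uy; apply: sub_adjoin_vector; left.
  - by move=> xU; apply: Vx; left; apply: xU; exact: mem_adjoin_vector.
  rewrite /P (_ : _ `|` W = adjoin_vector V x).
    by split => //; exact: subspace_adjoin.
  by apply/seteqP; split=> [y [//|Wy]|y Uy]; [apply: sub_adjoin_vector; right|left].
have [g gP] := choice decomp.
have g_uniq x d : D d -> V (x - d * v) -> g x = d.
  move=> Dd Vd; apply: contrapT => /eqP; rewrite -subr_eq0 => gd; apply: Uv.
  have -> : v = (g x - d)^-1 * ((x - d * v) - (x - g x * v)) by field.
  apply: (subspaceZ Usub); last by apply: subspaceB => //; exact: (gP x).2.
  exact/(subfieldV Dsub)/(subfieldB Dsub)/Dd/(gP x).1.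
exists g; split; last 2 first.
- by move=> w Ww; apply: g_uniq; [exact: subfield0|rewrite mul0r subr0; right].
- by apply: g_uniq; [exact: subfield1|rewrite mul1r subrr; exact: subspace0 Usub].
split=> [x y|d x Dd|x]; last exact: (gP x).1.
- apply: g_uniq; first exact: subfieldD (gP x).1 (gP y).1.
  by rewrite mulrDl opprD addrACA; apply: (subspaceD Usub); [exact: (gP x).2|exact: (gP y).2].
- apply: g_uniq; first exact: subfieldM Dd (gP x).1.
  by rewrite -mulrA -mulrBr; apply: (subspaceZ Usub) => //; exact: (gP x).2.
Qed.

End Functional.
End SubfieldLinearAlgebra.

(** * Non-archimedean norms *)

Section ValuedField.
Variables (R : realType) (L : realValuedFieldType R).
Implicit Types (x y v w : L) (D W : set L).

Lemma vnormD_le x y t : vnorm x <= t -> vnorm y <= t -> vnorm (x + y) <= t.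
Proof. by move=> xt yt; rewrite (le_trans (vnormD _ _))// ge_max xt. Qed.

Lemma vnormD_lt x y t : vnorm x < t -> vnorm y < t -> vnorm (x + y) < t.
Proof. by move=> xt yt; rewrite (le_lt_trans (vnormD _ _))// gt_max xt. Qed.

Lemma vnormB_le x y t : vnorm x <= t -> vnorm y <= t -> vnorm (x - y) <= t.
Proof. by move=> xt yt; apply: vnormD_le; rewrite ?vnormN. Qed.

Lemma vnormB_lt x y t : vnorm x < t -> vnorm y < t -> vnorm (x - y) < t.
Proof. by move=> xt yt; apply: vnormD_lt; rewrite ?vnormN. Qed.

Lemma vnorm_distC x y : vnorm (x - y) = vnorm (y - x).
Proof. by rewrite -vnormN opprB. Qed.

Lemma vnorm_gt0 x : (0 < vnorm x) = (x != 0).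
Proof. by rewrite lt_def vnorm_eq0 vnorm_ge0 andbT. Qed.

Lemma vnormX x n : vnorm (x ^+ n) = vnorm x ^+ n.
Proof. by elim: n => [|n IH]; rewrite ?expr0 ?vnorm1// !exprS vnormM IH. Qed.

Lemma vnormV x : vnorm x^-1 = (vnorm x)^-1.
Proof.
have [->|x0] := eqVneq x 0; first by rewrite invr0 vnorm0 invr0.
have vx : vnorm x != 0 by rewrite vnorm_eq0.
by apply: (mulfI vx); rewrite -vnormM !mulfV// vnorm1.
Qed.

Lemma vnorm_sum_le (I : Type) (r : seq I) (P : pred I) (F : I -> L) t :
  0 <= t -> (forall i, P i -> vnorm (F i) <= t) ->
  vnorm (\sum_(i <- r | P i) F i) <= t.
Proof.
move=> t0 Ft; apply: (big_ind (fun x => vnorm x <= t)) => //.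
- by rewrite vnorm0.
- by move=> x y; exact: vnormD_le.
Qed.

Lemma vnorm_nat_le1 n : vnorm (n%:R : L) <= 1.
Proof.
by elim: n => [|n IH]; rewrite ?vnorm0// mulrS; apply: vnormD_le; rewrite ?vnorm1.
Qed.

(* Hahn-Banach without completeness: since only finitely many values have to be
   controlled, a new vector d may be sent where the vector u of the old space
   closest to it, among those occurring in the conditions, is sent. *)
Lemma bounded_extension D W f0 C (vs : seq L) :
  subfield D -> lsubspace D W -> functional D f0 -> 0 <= C ->
  (forall w, W w -> vnorm (f0 w) <= C * vnorm w) ->
  exists f, [/\ functional D f, forall w, W w -> f w = f0 w &
    forall v, v \in vs -> vnorm (f v) <= C * vnorm v].
Proof.
move=> Dsub Wsub f0fun C0 f0C.
(* The list is quantified because adjoining d calls on the old space for other vectors than those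
   given: their translates, in which d is replaced by u. *)
pose Q W' := forall us : seq L, (forall u, u \in us -> W' u) ->
  exists f, [/\ functional D f, forall w, W w -> f w = f0 w &
    forall v, v \in us -> vnorm (f v) <= C * vnorm v].
have step W' d : lsubspace D W' -> W `<=` W' -> Q W' -> Q (adjoin_vector D W' d).
  move=> W'sub WW' QW'; have [W'd|W'd] := pselect (W' d).
    move=> us usW; apply: QW' => u /usW[e [De W'u]].
    rewrite -(subrK (e * d) u); apply: (subspaceD W'sub) => //.
    exact: subspaceZ W'sub _ _ De _.
  move=> us usW; have [g [gfun g0 g1]] := separating_functional Dsub W'sub W'd.
  have W'g u : u \in us -> W' (u - g u * d).
    move=> /usW[e [De W'u]]; suff -> : g u = e by [].
    rewrite -(subrK (e * d) u) (functionalD gfun) (g0 _ W'u) add0r.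
    by rewrite (functionalZ gfun)// g1 mulr1.
  have [u [W'u uP]] : exists u, W' u /\
      forall v, v \in us -> vnorm (g v) * vnorm (d - u) <= vnorm v.
    elim: us W'g {usW} => [|v us IH] W'g.
      by exists 0; split => //; exact: subspace0 W'sub.
    have [u' u'us|u [W'u uP]] := IH; first by apply: W'g; rewrite inE u'us orbT.
    have [gv0|gv0] := eqVneq (g v) 0.
      exists u; split => // v'; rewrite inE => /orP[/eqP->|]; last exact: uP.
      by rewrite gv0 vnorm0 mul0r vnorm_ge0.
    have W'v := W'g v (mem_head _ _).
    (* This is d - v / g v, a point of W' at distance vnorm v / vnorm (g v) from d; the condition
       for v asks that u be at least as close. *)
    pose u' := - (g v)^-1 * (v - g v * d).
    have W'u' : W' u'.
      apply: (subspaceZ W'sub) => //.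
      exact/(subfieldN Dsub)/(subfieldV Dsub)/(functional_val gfun _).
    have u'v : vnorm (g v) * vnorm (d - u') = vnorm v.
      by rewrite -vnormM; congr vnorm; rewrite /u'; field.
    have [du|du] := leP (vnorm (d - u)) (vnorm (d - u')).
      exists u; split => // v'; rewrite inE => /orP[/eqP->|]; last exact: uP.
      by rewrite -u'v ler_wpM2l ?vnorm_ge0.
    exists u'; split => // v'; rewrite inE => /orP[/eqP->|v'us].
      by rewrite u'v.
    rewrite (le_trans _ (uP _ v'us))// ler_wpM2l ?vnorm_ge0//; exact: ltW.
  have [v /mapP[v' v'us ->]|f' [f'fun f'W f'C]] := QW' [seq v - g v * d + g v * u | v <- us].
    apply: (subspaceD W'sub); first exact: W'g.
    by apply: (subspaceZ W'sub) => //; exact: functional_val gfun _.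
  (* This is f' after the map x - g x * d + g x * u, which fixes W' and sends d to u; by the choice
     of u it raises the norm of no v in [us]. *)
  exists (fun x => f' x + g x * (f' u - f' d)); split.
  - split=> [x y|e x De|x].
    + by rewrite (functionalD f'fun) (functionalD gfun) mulrDl addrACA.
    + by rewrite (functionalZ f'fun _ De) (functionalZ gfun _ De); ring.
    + apply: (subfieldD Dsub); first exact: functional_val f'fun _.
      apply: (subfieldM Dsub); first exact: functional_val gfun _.
      by apply: (subfieldB Dsub); exact: functional_val f'fun _.
  - by move=> w Ww; rewrite f'W// g0 ?mul0r ?addr0//; exact: WW'.
  - move=> v vus; have -> : f' v + g v * (f' u - f' d) = f' (v - g v * d + g v * u).
      rewrite !(functionalD f'fun) (functionalN _ f'fun).
      rewrite !(functionalZ f'fun _ (functional_val gfun _)).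
      by ring.
    rewrite (le_trans (f'C _ _)) ?(map_f (fun v => v - g v * d + g v * u))//.
    rewrite ler_wpM2l//.
    have -> : v - g v * d + g v * u = v - g v * (d - u) by ring.
    by rewrite vnormB_le// vnormM uP.
have [W' [_ _ vsW' QW']] : exists W', [/\ lsubspace D W', W `<=` W',
    forall v, v \in vs -> W' v & Q W'].
  elim: vs => [|v vs [W' [W'sub WW' vsW' QW']]].
    exists W; split => // us usW; exists f0; split => // v vus.
    exact/f0C/usW.
  exists (adjoin_vector D W' v); split.
  - exact: subspace_adjoin.
  - by apply: subset_trans WW' _; exact: sub_adjoin_vector.
  - move=> x; rewrite inE => /orP[/eqP->|/vsW' W'x].
      exact: mem_adjoin_vector.
    exact: sub_adjoin_vector.
  - exact: step.
exact: QW'.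
Qed.

End ValuedField.

(** * Seminorms *)

Section RealLemmas.
Variable R : realType.

(** The tensor seminorm is an infimum that need not be attained, so a bound by a product is obtained
    from all pairs of larger numbers. *)
Lemma le_mul_gt (a b c : R) : 0 <= a -> 0 <= b ->
  (forall s t, a < s -> b < t -> c <= s * t) -> c <= a * b.
Proof.
move=> a0 b0 cst; rewrite leNgt; apply/negP => abc.
(* Since e <= 1, the product of a + e and b + e exceeds a * b by at most e * (a + b + 1), which is
   less than c - a * b. *)
pose e := (c - a * b) / (2 * (a + b + 1 + c)).
have c0 : 0 < c by rewrite (le_lt_trans _ abc)// mulr_ge0.
have d0 : 0 < 2 * (a + b + 1 + c) by lra.
have ed : e * (2 * (a + b + 1 + c)) = c - a * b by rewrite /e divfK// gt_eqF.
have e0 : 0 < e by rewrite divr_gt0// subr_gt0.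
have e1 : e <= 1 by nra.
have := cst (a + e) (b + e); rewrite !ltrDl => /(_ e0 e0); nra.
Qed.

(** Bernoulli's inequality for 1 - d, where n * d < 1 - rho. *)
Lemma exists_power_gt (rho : R) n : rho < 1 ->
  exists al, [/\ 0 < al, al < 1 & rho < al ^+ n].
Proof.
move=> rho1; pose d := Num.min (1 / 2) ((1 - rho) / (2 * n.+1%:R)).
have n0 : 0 < n.+1%:R :> R by [].
have d0 : 0 < d by rewrite lt_min !divr_gt0// ?subr_gt0// mulr_gt0.
have d1 : d <= 1 / 2 by rewrite ge_min lexx.
have dn : d * (2 * n.+1%:R) <= 1 - rho.
  by rewrite -ler_pdivlMr ?mulr_gt0// ge_min lexx orbT.
exists (1 - d); split; [lra|lra|].
have bern m : 1 - m%:R * d <= (1 - d) ^+ m.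
  elim: m => [|m IH]; first by rewrite mul0r subr0 expr0.
  rewrite exprS -natr1; have : 0 <= m%:R :> R by [].
  have := ler_wpM2l (_ : 0 <= 1 - d) IH; rewrite subr_ge0; nra.
apply: lt_le_trans (bern n); rewrite -natr1 in dn.
have : 0 <= n%:R :> R by []. nra.
Qed.

Lemma bigmax_seq_lt (T : eqType) (s : seq T) (F : T -> R) t : 0 < t ->
  \big[Num.max/0]_(p <- s) F p < t <-> forall p, p \in s -> F p < t.
Proof.
move=> t0; elim: s => [|x s IH]; first by rewrite big_nil; split.
rewrite big_cons gt_max; split=> [/andP[xt /IH st] p|st].
  by rewrite inE => /orP[/eqP->|/st].
apply/andP; split; first exact/st/mem_head.
by apply/IH => p ps; apply: st; rewrite inE ps orbT.
Qed.

Lemma bigmax_seq_le (T : eqType) (s : seq T) (F : T -> R) t : 0 <= t ->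
  \big[Num.max/0]_(p <- s) F p <= t <-> forall p, p \in s -> F p <= t.
Proof.
move=> t0; elim: s => [|x s IH]; first by rewrite big_nil; split.
rewrite big_cons ge_max; split=> [/andP[xt /IH st] p|st].
  by rewrite inE => /orP[/eqP->|/st].
apply/andP; split; first exact/st/mem_head.
by apply/IH => p ps; apply: st; rewrite inE ps orbT.
Qed.

Lemma bigmax_seq_ge0 (T : eqType) (s : seq T) (F : T -> R) :
  0 <= \big[Num.max/0]_(p <- s) F p.
Proof.
by elim: s => [|x s IH]; rewrite ?big_nil// big_cons le_max IH orbT.
Qed.

End RealLemmas.

Section Seminorm.
Variables (R : realType) (B : pzRingType) (N : B -> R) (Nsemi : ring_seminorm N).

Lemma seminormN x : N (- x) = N x.
Proof.
have le y : N (- y) <= N y.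
  rewrite -sub0r (le_trans (seminormB Nsemi _ _))// (seminorm0 Nsemi).
  by rewrite ge_max lexx (seminorm_ge0 Nsemi).
by apply/eqP; rewrite eq_le le -[in X in X <= _](opprK x) le.
Qed.

Lemma seminormB_le x y t : N x <= t -> N y <= t -> N (x - y) <= t.
Proof. by move=> xt yt; rewrite (le_trans (seminormB Nsemi _ _))// ge_max xt. Qed.

Lemma seminormB_lt x y t : N x < t -> N y < t -> N (x - y) < t.
Proof. by move=> xt yt; rewrite (le_lt_trans (seminormB Nsemi _ _))// gt_max xt. Qed.

Lemma seminormD_le x y t : N x <= t -> N y <= t -> N (x + y) <= t.
Proof. by move=> xt yt; rewrite -(opprK y); apply: seminormB_le; rewrite ?seminormN. Qed.

Lemma seminormD_lt x y t : N x < t -> N y < t -> N (x + y) < t.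
Proof. by move=> xt yt; rewrite -(opprK y); apply: seminormB_lt; rewrite ?seminormN. Qed.

Lemma seminorm_sum_le (I : eqType) (r : seq I) (P : pred I) (F : I -> B) t :
  0 <= t -> (forall i, i \in r -> P i -> N (F i) <= t) ->
  N (\sum_(i <- r | P i) F i) <= t.
Proof.
move=> t0 Ft; rewrite big_seq_cond; apply: (big_ind (fun x => N x <= t)) => //.
- by rewrite (seminorm0 Nsemi).
- by move=> x y; exact: seminormD_le.
- by move=> j /andP[]; exact: Ft.
Qed.

Lemma seminorm_sum_lt (I : eqType) (r : seq I) (P : pred I) (F : I -> B) t :
  0 < t -> (forall i, i \in r -> P i -> N (F i) < t) ->
  N (\sum_(i <- r | P i) F i) < t.
Proof.
move=> t0 Ft; rewrite big_seq_cond; apply: (big_ind (fun x => N x < t)) => //.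
- by rewrite (seminorm0 Nsemi).
- by move=> x y; exact: seminormD_lt.
- by move=> j /andP[]; exact: Ft.
Qed.

(** The isosceles triangle principle. It replaces passages to the limit: an approximation at
    distance less than N x has exactly the norm of x. *)
Lemma seminorm_close x y : N (x - y) < N x -> N y = N x.
Proof.
move=> xy; apply/eqP; rewrite eq_le; apply/andP; split.
  by rewrite -[in X in X <= _](subKr x y); apply: seminormB_le => //; exact: ltW.
rewrite leNgt; apply/negP => yx; have := seminormD_lt xy yx.
by rewrite subrK ltxx.
Qed.

Lemma seminormX_le x n : N 1 <= 1 -> N (x ^+ n) <= N x ^+ n.
Proof.
move=> N1; elim: n => [|n IH]; first by rewrite !expr0.
by rewrite !exprS (le_trans (seminormM Nsemi _ _))// ler_wpM2l ?(seminorm_ge0 Nsemi).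
Qed.

End Seminorm.

(** * Extension of functionals to the tensor product *)

Section TensorAlgebra.
Variables (k l : fieldType) (A : comAlgType k) (i : {rmorphism k -> l}).
Local Notation T := (tensor A i).
Implicit Types (D : set l) (f : l -> l).

Lemma subfield_range : subfield (range i).
Proof.
split=> [|_ _ [a _ <-] [b _ <-]|_ _ [a _ <-] [b _ <-]|_ [a _ <-]].
- by exists 1; rewrite ?rmorph1.
- by exists (a - b); rewrite ?rmorphB.
- by exists (a * b); rewrite ?rmorphM.
- by exists a^-1; rewrite ?fmorphV.
Qed.

Lemma functional_range f : functional (range i) f ->
  exists g : l -> k, [/\ forall x, i (g x) = f x, {morph g : x y / x + y} &
    forall c x, g (i c * x) = c * g x].
Proof.
move=> ffun; have /choice[g gP] : forall x, exists c, i c = f x.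
  by move=> x; have [c _ <-] := functional_val ffun x; exists c.
exists g; split => // [x y|c x]; apply: (fmorph_inj i).
  by rewrite rmorphD !gP (functionalD ffun).
by rewrite rmorphM !gP (functionalZ ffun)//; exists c.
Qed.

Lemma tens0l b : tens i (0 : A) b = 0.
Proof. exact/tens_ofE/tens_zero. Qed.

Lemma tens0r (a : A) : tens i a 0 = 0.
Proof. by apply: (addrI (tens i a 0)); rewrite -tensDr !addr0. Qed.

(** A k-linear functional on l that sends 1 to 1 induces an additive map T -> A sending 1 to 1, and
    1 is not 0 in A. *)
Lemma tens_oner_neq0 : 1 != 0 :> T.
Proof.
have sub0 : lsubspace (range i) [set 0].
  by split=> [//|_ _ -> ->|d _ _ ->]; rewrite /= ?addr0 ?mulr0.
have [|g [gfun _ g1]] := separating_functional subfield_range sub0 (v := 1).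
  exact/eqP/oner_neq0.
have [h [hP hD hZ]] := functional_range gfun.
have h1 : h 1 = 1 by apply: (fmorph_inj i); rewrite hP g1 rmorph1.
have [|||H HD HP] := @tens_lift _ _ A i A (fun a b => h b *: a).
- by move=> a a' b; rewrite scalerDr.
- by move=> a b b'; rewrite hD scalerDl.
- by move=> c a b; rewrite hZ scalerA mulrC.
apply/eqP => T10; have : H 1 = H 0 by rewrite T10.
rewrite -(tens0l 1) [1]/(tens i 1 1) !HP h1 !scale1r.
exact/eqP/oner_neq0.
Qed.

HB.instance Definition _ := GRing.PzSemiRing_isNonZero.Build T tens_oner_neq0.

Definition tens_right (b : l) : T := tens i 1 b.

Fact tens_right_zmod_morphism : zmod_morphism tens_right.
Proof.
by move=> x y; apply/eqP; rewrite eq_sym subr_eq /tens_right -tensDr subrK.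
Qed.
HB.instance Definition _ :=
  GRing.isZmodMorphism.Build l T tens_right tens_right_zmod_morphism.

Fact tens_right_monoid_morphism : monoid_morphism tens_right.
Proof. by split=> // x y; rewrite /tens_right tensM mulr1. Qed.
HB.instance Definition _ :=
  GRing.isMonoidMorphism.Build l T tens_right tens_right_monoid_morphism.

Lemma tens_rightM (a : A) b v : tens i a b * tens_right v = tens i a (b * v).
Proof. by rewrite /tens_right tensM mulr1. Qed.

Definition tens_map_spec f (h : T -> T) :=
  {morph h : x y / x + y} /\ forall a b, h (tens i a b) = tens i a (f b).

Lemma tens_map_exists D f : functional D f -> range i `<=` D ->
  exists h, tens_map_spec f h.
Proof.
move=> ffun iD; have [|||h hD hP] := @tens_lift _ _ A i T (fun a b => tens i a (f b)).
- by move=> a a' b; rewrite tensDl.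
- by move=> a b b'; rewrite (functionalD ffun) tensDr.
- by move=> c a b; rewrite (functionalZ ffun) ?tensZ//; apply: iD; exists c.
by exists h.
Qed.

(** The map id ⊗ f, picked by choice so that it is a plain function of f; [id] is a default for maps
    f that induce nothing on T. *)
Definition tens_map f : T -> T :=
  if pselect (exists h, tens_map_spec f h) is left e then sval (cid e) else id.

(** For a subfield D containing the image of k, this is the image of A ⊗ D in T. *)
Definition tens_span D : set T := [set x | exists s : seq (A * l),
  (forall p, p \in s -> D p.2) /\ x = \sum_(p <- s) tens i p.1 p.2].

Lemma tens_spanW D D' : D `<=` D' -> tens_span D `<=` tens_span D'.
Proof. by move=> DD' x [s [sD ->]]; exists s; split=> // p /sD/DD'. Qed.

Lemma tens_span_full x : tens_span setT x.
Proof. by elim/tens_of_ind: x => s; exists s; split=> //; exact: tens_of_sum. Qed.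

Lemma tens_span_tens D a b : D b -> tens_span D (tens i a b).
Proof.
by move=> Db; exists [:: (a, b)]; rewrite big_seq1; split=> // p; rewrite inE => /eqP->.
Qed.

Lemma tens_span0 D : tens_span D 0.
Proof. by exists [::]; rewrite big_nil. Qed.

Lemma tens_spanD D x y : tens_span D x -> tens_span D y -> tens_span D (x + y).
Proof.
move=> [s [sD ->]] [s' [s'D ->]]; exists (s ++ s'); rewrite big_cat; split=> // p.
by rewrite mem_cat => /orP[/sD|/s'D].
Qed.

Lemma tens_span_sum D (I : eqType) (r : seq I) (P : pred I) (F : I -> T) :
  (forall j, j \in r -> P j -> tens_span D (F j)) ->
  tens_span D (\sum_(j <- r | P j) F j).
Proof.
move=> DF; rewrite big_seq_cond; apply: (big_ind (tens_span D)).
- exact: tens_span0.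
- exact: tens_spanD.
- by move=> j /andP[]; exact: DF.
Qed.

Lemma tens_span_ind D (P : T -> Prop) : P 0 ->
  (forall x y, P x -> P y -> P (x + y)) ->
  (forall a b, D b -> P (tens i a b)) ->
  forall x, tens_span D x -> P x.
Proof.
move=> P0 PD PD' x [s [sD ->]]; rewrite big_seq; apply: (big_ind P) => //.
by move=> p /sD; exact: PD'.
Qed.

Section Subfield.
Variables (D : set l) (Dsub : subfield D) (iD : range i `<=` D).

Lemma tens_spanM x y : tens_span D x -> tens_span D y -> tens_span D (x * y).
Proof.
move=> Sx Sy; elim/tens_span_ind: x / Sx => [|x x' IH IH'|a b Db].
- by rewrite mul0r; exact: tens_span0.
- by rewrite mulrDl; exact: tens_spanD.
elim/tens_span_ind: y / Sy => [|y y' IH IH'|a' b' Db'].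
- by rewrite mulr0; exact: tens_span0.
- by rewrite mulrDr; exact: tens_spanD.
by rewrite tensM; apply: tens_span_tens; exact: (subfieldM Dsub).
Qed.

Lemma tens_span_right b : D b -> tens_span D (tens_right b).
Proof. exact: tens_span_tens. Qed.

Lemma tens_span1 : tens_span D 1.
Proof. exact/tens_span_tens/(subfield1 Dsub). Qed.

Lemma tens_spanN x : tens_span D x -> tens_span D (- x).
Proof.
move=> Sx; rewrite -mulN1r -(rmorphN1 tens_right); apply: tens_spanM => //.
exact/tens_span_right/(subfieldN Dsub)/(subfield1 Dsub).
Qed.

Lemma tens_spanB x y : tens_span D x -> tens_span D y -> tens_span D (x - y).
Proof. by move=> Sx Sy; apply: tens_spanD => //; exact: tens_spanN. Qed.

Lemma tens_spanX x n : tens_span D x -> tens_span D (x ^+ n).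
Proof.
move=> Sx; elim: n => [|n IH]; first by rewrite expr0; exact: tens_span1.
by rewrite exprS; exact: tens_spanM.
Qed.

Section Map.
Variables (f : l -> l) (ffun : functional D f).

Lemma tens_mapP : tens_map_spec f (tens_map f).
Proof.
rewrite /tens_map; case: pselect => [e|[]]; first exact: svalP (cid e).
exact: tens_map_exists ffun iD.
Qed.

Lemma tens_mapD : {morph tens_map f : x y / x + y}.
Proof. exact: tens_mapP.1. Qed.

Lemma tens_mapE a b : tens_map f (tens i a b) = tens i a (f b).
Proof. exact: tens_mapP.2. Qed.

Lemma tens_map0 : tens_map f 0 = 0.
Proof. by apply: (addrI (tens_map f 0)); rewrite -tens_mapD !addr0. Qed.

Lemma tens_mapN x : tens_map f (- x) = - tens_map f x.
Proof. by apply: (addrI (tens_map f x)); rewrite -tens_mapD !subrr tens_map0. Qed.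

Lemma tens_mapB x y : tens_map f (x - y) = tens_map f x - tens_map f y.
Proof. by rewrite tens_mapD tens_mapN. Qed.

Lemma tens_map_sum (I : Type) (r : seq I) (P : pred I) (F : I -> T) :
  tens_map f (\sum_(j <- r | P j) F j) = \sum_(j <- r | P j) tens_map f (F j).
Proof. exact: (big_morph _ tens_mapD tens_map0). Qed.

(** The map f is only D-linear, but id ⊗ f leaves the factors in A alone, so all of A ⊗ D passes
    through. This turns coordinates over D into coordinates over A ⊗ D. *)
Lemma tens_mapZ x y : tens_span D x -> tens_map f (x * y) = x * tens_map f y.
Proof.
move=> Sx; elim/tens_span_ind: x / Sx => [|x x' IH IH'|a b Db].
- by rewrite !mul0r tens_map0.
- by rewrite !mulrDl tens_mapD IH IH'.
have := tens_span_full y; elim/tens_span_ind: y / => [|y y' IH IH'|a' b' _].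
- by rewrite tens_map0 !mulr0 tens_map0.
- by rewrite (tens_mapD y) !mulrDr tens_mapD IH IH'.
by rewrite tens_mapE !tensM tens_mapE (functionalZ ffun).
Qed.

Lemma tens_map_span x : tens_span D (tens_map f x).
Proof.
have := tens_span_full x; elim/tens_span_ind: x / => [|x y IH IH'|a b _].
- by rewrite tens_map0; exact: tens_span0.
- by rewrite tens_mapD; exact: tens_spanD.
- by rewrite tens_mapE; apply: tens_span_tens; exact: functional_val ffun b.
Qed.

Lemma tens_map_eq (W : set l) (g : l -> l) x : (forall b, W b -> f b = g b) ->
  forall s : seq (A * l), (forall p, p \in s -> W p.2) ->
  x = \sum_(p <- s) tens i p.1 p.2 -> tens_map f x = \sum_(p <- s) tens i p.1 (g p.2).
Proof.
move=> fg s sW ->; rewrite tens_map_sum; apply: eq_big_seq => p /sW Wp.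
by rewrite tens_mapE fg.
Qed.

End Map.
End Subfield.
End TensorAlgebra.

Arguments tens_right {k l} A i b.
Arguments tens_map {k l A i} f x.
Arguments tens_span {k l} A i D _.

(** * The tensor seminorm *)

Section TensorSeminorm.
Variables (R : realType) (k : realValuedFieldType R) (A : comAlgType k).
Variables (N : A -> R) (Nalg : alg_seminorm N).
Variables (L : realValuedFieldType R) (i : {rmorphism k -> L}).
Hypothesis iso : isometric i.
Local Notation T := (tensor A i).
Local Notation nrm := (@tensor_seminorm R k A L i N).
Let Nsemi := alg_seminorm_ring Nalg.
Implicit Types (x y : T) (a : A) (b v : L) (D W : set L) (f : L -> L) (s : seq (A * L)).

Let tsum s : T := \sum_(p <- s) tens i p.1 p.2.
Let size_of s : R := \big[Num.max/0]_(p <- s) (N p.1 * vnorm p.2).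
Let sizes x := [set size_of s | s in [set s | x = tsum s]].

Let sizes_has_inf x : has_inf (sizes x).
Proof.
split; last by exists 0 => _ [s _ <-]; exact: bigmax_seq_ge0.
by have [s [_ sx]] := tens_span_full x; exists (size_of s), s.
Qed.

Lemma tnorm_rep x t : nrm x < t ->
  exists s, x = \sum_(p <- s) tens i p.1 p.2 /\
    forall p, p \in s -> N p.1 * vnorm p.2 < t.
Proof.
move=> /(inf_lt (sizes_has_inf x).1)[_ [s sx <-] st]; exists s; split => //.
by apply/bigmax_seq_lt => //; exact: le_lt_trans (bigmax_seq_ge0 _ _) st.
Qed.

Lemma tnorm_le s t : 0 <= t -> (forall p, p \in s -> N p.1 * vnorm p.2 <= t) ->
  nrm (\sum_(p <- s) tens i p.1 p.2) <= t.
Proof.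
move=> t0 /(bigmax_seq_le _ _ t0); apply: le_trans.
by apply: ge_inf; [exact: (sizes_has_inf _).2|exists s].
Qed.

Lemma tnorm_ge0 x : 0 <= nrm x.
Proof.
apply: lb_le_inf; first exact: (sizes_has_inf x).1.
by move=> _ [s _ <-]; exact: bigmax_seq_ge0.
Qed.

Lemma tnorm_tens_le a b : nrm (tens i a b) <= N a * vnorm b.
Proof.
have := @tnorm_le [:: (a, b)] (N a * vnorm b); rewrite big_seq1; apply.
  by rewrite mulr_ge0 ?vnorm_ge0 ?(seminorm_ge0 Nsemi).
by move=> p; rewrite inE => /eqP->.
Qed.

Lemma tnorm_semi : ring_seminorm nrm.
Proof.
have nrm0 : nrm 0 = 0.
  apply/eqP; rewrite eq_le tnorm_ge0 andbT.
  by have := @tnorm_le [::] 0; rewrite big_nil; exact.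
have nrmN x : nrm (- x) <= nrm x.
  apply/ler_addgt0Pl => e e0; have xe : nrm x < e + nrm x by rewrite ltrDr.
  have [s [xs sx]] := tnorm_rep xe.
  have -> : - x = \sum_(p <- [seq (p.1, - p.2) | p <- s]) tens i p.1 p.2.
    rewrite xs -sumrN big_map; apply: eq_bigr => p _ /=.
    by rewrite -mulN1r -[-1](rmorphN1 (tens_right A i)) mulrC tens_rightM mulrN1.
  apply: tnorm_le; first by rewrite (le_trans (tnorm_ge0 x))// ltW.
  by move=> _ /mapP[p ps ->] /=; rewrite vnormN ltW// sx.
have nrmD_lt x y t : nrm x < t -> nrm y < t -> nrm (x + y) <= t.
  move=> xt yt; have [s [-> sx]] := tnorm_rep xt; have [s' [-> sy]] := tnorm_rep yt.
  rewrite -big_cat; apply: tnorm_le.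
    by rewrite (le_trans (tnorm_ge0 x))// ltW.
  by move=> p; rewrite mem_cat => /orP[/sx|/sy] ?; exact: ltW.
have nrmD x y : nrm (x + y) <= Num.max (nrm x) (nrm y).
  apply/ler_addgt0Pl => e e0.
  by apply: nrmD_lt; rewrite ltr_pwDl// le_max lexx ?orbT.
split=> //; first exact: tnorm_ge0.
  move=> x y; rewrite (le_trans (nrmD _ _))// ge_max !le_max lexx /=.
  by rewrite nrmN orbT.
move=> x y; apply: le_mul_gt; rewrite ?tnorm_ge0// => t u xt yu.
have t0 : 0 <= t by rewrite ltW// (le_lt_trans _ xt)// tnorm_ge0.
have u0 : 0 <= u by rewrite ltW// (le_lt_trans _ yu)// tnorm_ge0.
have [s [-> sx]] := tnorm_rep xt; have [s' [-> sy]] := tnorm_rep yu.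
rewrite big_distrlr /=.
rewrite (_ : \sum_(p <- s) _ = \sum_(p <- [seq (p.1 * q.1, p.2 * q.2) | p <- s, q <- s'])
    tens i p.1 p.2); last first.
  rewrite big_allpairs_dep; apply: eq_bigr => p _; apply: eq_bigr => q _.
  by rewrite tensM.
apply: tnorm_le; first exact: mulr_ge0.
move=> _ /allpairsP[[p q] /= [/sx pt /sy qu ->]] /=.
have N0 := seminorm_ge0 Nsemi.
rewrite vnormM (@le_trans _ _ ((N p.1 * vnorm p.2) * (N q.1 * vnorm q.2)))//.
  by rewrite mulrACA ler_wpM2r ?mulr_ge0 ?vnorm_ge0// (seminormM Nsemi).
by apply: ler_pM; rewrite ?mulr_ge0 ?vnorm_ge0// ltW.
Qed.

(** Multiplication by b raises the norm by a factor of at most vnorm b; the same bound for the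
    inverse of b gives equality. *)
Lemma tnormM_right x b : nrm (x * tens_right A i b) = nrm x * vnorm b.
Proof.
have le y c : nrm (y * tens_right A i c) <= nrm y * vnorm c.
  apply: le_mul_gt; rewrite ?tnorm_ge0 ?vnorm_ge0// => t u yt cu.
  have [s [-> sy]] := tnorm_rep yt.
  rewrite mulr_suml; under eq_bigr do rewrite tens_rightM.
  rewrite -(big_map (fun p => (p.1, p.2 * c)) predT (fun p => tens i p.1 p.2)).
  have t0 : 0 <= t by rewrite ltW// (le_lt_trans _ yt)// tnorm_ge0.
  have u0 : 0 <= u by rewrite ltW// (le_lt_trans _ cu)// vnorm_ge0.
  apply: tnorm_le; first exact: mulr_ge0.
  move=> _ /mapP[p ps ->] /=; rewrite vnormM mulrA ler_pM ?mulr_ge0 ?vnorm_ge0//.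
  - exact: (seminorm_ge0 Nsemi).
  - exact/ltW/sy.
  - exact: ltW.
apply/eqP; rewrite eq_le le /=.
have [->|b0] := eqVneq b 0; first by rewrite vnorm0 mulr0 tnorm_ge0.
rewrite -ler_pdivlMr ?vnorm_gt0// -vnormV (le_trans _ (le _ _))//.
by rewrite -mulrA -rmorphM mulfV// rmorph1 mulr1.
Qed.

(* The value of a functional on x only depends on the coordinates of x in W,
   but the bound applies to representations of x outside of W. *)
Lemma tnorm_coord W f (g : L -> k) C s :
  lsubspace (range i) W -> functional (range i) f -> 0 <= C ->
  (forall w, W w -> vnorm (f w) <= C * vnorm w) ->
  (forall v, i (g v) = f v) -> (forall p, p \in s -> W p.2) ->
  N (\sum_(p <- s) g p.2 *: p.1) <= C * nrm (\sum_(p <- s) tens i p.1 p.2).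
Proof.
move=> Wsub ffun C0 fC gf sW; set x := \sum_(p <- s) tens i p.1 p.2.
apply: le_mul_gt; rewrite ?tnorm_ge0// => D t CD xt.
have [s' [xs' s't]] := tnorm_rep xt.
have [f' [f'fun f'W f'C]] := bounded_extension (map snd s') (subfield_range i) Wsub ffun C0 fC.
have [g' [g'f' g'D g'Z]] := functional_range f'fun.
have [|||h hD hE] := @tens_lift _ _ A i A (fun a b => g' b *: a).
- by move=> a a' b; rewrite scalerDr.
- by move=> a b b'; rewrite g'D scalerDl.
- by move=> c a b; rewrite g'Z scalerA mulrC.
have h0 : h 0 = 0 by apply: (addrI (h 0)); rewrite -hD !addr0.
have hsum s0 : h (\sum_(p <- s0) tens i p.1 p.2) = \sum_(p <- s0) g' p.2 *: p.1.
  by rewrite (big_morph h hD h0); apply: eq_bigr => p _; rewrite hE.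
have -> : \sum_(p <- s) g p.2 *: p.1 = \sum_(p <- s') g' p.2 *: p.1.
  rewrite -hsum -xs' hsum; apply: eq_big_seq => p /sW Wp; congr (_ *: _).
  by apply: (fmorph_inj i); rewrite gf g'f' f'W.
have t0 : 0 <= t by rewrite ltW// (le_lt_trans _ xt)// tnorm_ge0.
have D0 : 0 <= D by rewrite ltW// (le_lt_trans _ CD).
apply: (seminorm_sum_le Nsemi); first exact: mulr_ge0.
move=> p ps' _; rewrite (le_trans (alg_seminormZ Nalg _ _))//.
rewrite -iso g'f' (@le_trans _ _ (D * vnorm p.2 * N p.1))//.
  rewrite ler_wpM2r ?(seminorm_ge0 Nsemi)// (le_trans (f'C _ (map_f snd ps')))//.
  by rewrite ler_wpM2r ?vnorm_ge0// ltW.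
by rewrite -mulrA ler_wpM2l// mulrC ltW// s't.
Qed.

(** A functional with value 1 at 1 is the identity on the image of k, hence bounded by 1 there. It
    reads a off a ⊗ 1, and [tnorm_coord] gives the lower bound. *)
Lemma tnorm_tens1 a : nrm (tens i a 1) = N a.
Proof.
apply/eqP; rewrite eq_le; apply/andP; split.
  by rewrite (le_trans (tnorm_tens_le _ _))// vnorm1 mulr1.
have sub0 : lsubspace (range i) [set 0 : L].
  by split=> [//|_ _ -> ->|d _ _ ->]; rewrite /= ?addr0 ?mulr0.
have [|f [ffun _ f1]] := separating_functional (subfield_range i) sub0 (v := 1).
  exact/eqP/oner_neq0.
have [g [gf _ gZ]] := functional_range ffun.
have := @tnorm_coord (range i) f g 1 [:: (a, 1)].
rewrite !big_seq1 /= mul1r => /(_ _ _ _ _ gf); have -> : g 1 = 1.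
  by apply: (fmorph_inj i); rewrite gf rmorph1.
rewrite scale1r; apply => //.
- exact/subspace_self/subfield_range.
- move=> _ [c _ <-]; rewrite mul1r -[i c]mulr1 (functionalZ ffun) ?f1//; by exists c.
- by move=> p; rewrite inE => /eqP->; exact: (subfield1 (subfield_range i)).
Qed.

Section Subfield.
Variables (D : set L) (Dsub : subfield D) (iD : range i `<=` D).

(** Extend the identity of D to a functional f that does not raise the norms of the right factors in
    a short representation of x. Applying id ⊗ f fixes x, keeps every term short and brings the
    right factors into D. *)
Lemma tnorm_rep_in x t : tens_span A i D x -> nrm x < t ->
  exists s, [/\ x = \sum_(p <- s) tens i p.1 p.2, forall p, p \in s -> D p.2 &
    forall p, p \in s -> N p.1 * vnorm p.2 < t].
Proof.
move=> [s0 [s0D xs0]] xt; have [s [xs st]] := tnorm_rep xt.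
have sub0 : lsubspace D [set 0 : L].
  by split=> [//|_ _ -> ->|d _ _ ->]; rewrite /= ?addr0 ?mulr0.
have [|f0 [f0fun _ f01]] := separating_functional Dsub sub0 (v := 1).
  exact/eqP/oner_neq0.
have [|f [ffun fD fs]] := bounded_extension (map snd s) Dsub (subspace_self Dsub) f0fun ler01.
  by move=> w Dw; rewrite mul1r (functional1 f0fun).
exists [seq (p.1, f p.2) | p <- s]; split.
- rewrite big_map /= -(tens_map_eq (W := setT) iD ffun _ _ xs)//.
  rewrite (@tens_map_eq _ _ _ _ _ iD f ffun D f0 x _ s0)// xs0.
  by apply: eq_big_seq => p /s0D Dp; rewrite (functional1 f0fun).
- by move=> _ /mapP[p ps ->]; exact: functional_val ffun _.
- move=> _ /mapP[p ps ->] /=; rewrite (le_lt_trans _ (st _ ps))//.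
  rewrite ler_wpM2l ?(seminorm_ge0 Nsemi)//.
  by have := fs _ (map_f snd ps); rewrite mul1r.
Qed.

End Subfield.

(** A bound for f on E is enough: by [tnorm_rep_in], an element of A ⊗ E has short representations
    with all right factors in E. *)
Lemma tnorm_map_le D (E : set L) f C x : subfield E -> range i `<=` D -> D `<=` E ->
  functional D f -> 0 <= C -> (forall v, E v -> vnorm (f v) <= C * vnorm v) ->
  tens_span A i E x -> nrm (tens_map f x) <= C * nrm x.
Proof.
move=> Esub iD DE ffun C0 fC Ex; apply: le_mul_gt; rewrite ?tnorm_ge0// => C' t CC' xt.
have t0 : 0 <= t by rewrite (le_trans (tnorm_ge0 x))// ltW.
have C'0 : 0 <= C' by rewrite (le_trans C0)// ltW.
have [s [xs sE st]] := tnorm_rep_in Esub (subset_trans iD DE) Ex xt.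
rewrite (tens_map_eq (W := setT) (g := f) iD ffun _ _ xs)//.
rewrite -(big_map (fun p => (p.1, f p.2)) predT (fun p => tens i p.1 p.2)).
apply: tnorm_le; first exact: mulr_ge0.
move=> _ /mapP[p ps ->] /=; rewrite (@le_trans _ _ (N p.1 * (C' * vnorm p.2)))//.
  rewrite ler_wpM2l ?(seminorm_ge0 Nsemi)// (le_trans (fC _ (sE _ ps)))//.
  by rewrite ler_wpM2r ?vnorm_ge0// ltW.
by rewrite mulrCA ler_wpM2l// ltW// st.
Qed.

Lemma tnorm_right b : N 1 = 1 -> nrm (tens_right A i b) = vnorm b.
Proof. by move=> N1; rewrite -[tens_right A i b]mul1r tnormM_right tnorm_tens1 N1 mul1r. Qed.

End TensorSeminorm.

(** * Powers of sums and power-multiplicativity *)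

Section PowerSum.
Variables (R : realType) (B : comPzRingType) (N : B -> R).
Hypotheses (Nsemi : ring_seminorm N) (N1 : N 1 <= 1).

Lemma seminorm_natmul_le x n : N (x *+ n) <= N x.
Proof.
elim: n => [|n IH]; first by rewrite mulr0n (seminorm0 Nsemi) (seminorm_ge0 Nsemi).
by rewrite mulrS; exact: (seminormD_le Nsemi).
Qed.

Variables (p : nat) (pr : prime p) (th : R).
Hypotheses (th0 : 0 <= th) (pth : forall x, N (p%:R * x) <= th * N x).

(** The mixed terms of the binomial formula are multiples of p, hence smaller by the factor th;
    longer sums follow by splitting off the last term. *)
Lemma seminorm_pow_sum_le m (F : nat -> B) M : 0 <= M ->
  (forall j, (j < m)%N -> N (F j) <= M) ->
  N ((\sum_(j < m) F j) ^+ p - \sum_(j < m) F j ^+ p) <= th * M ^+ p.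
Proof.
have N0 := seminorm_ge0 Nsemi; move=> M0.
have two x y : N x <= M -> N y <= M -> N ((x + y) ^+ p - x ^+ p - y ^+ p) <= th * M ^+ p.
  move=> xM yM; case: p pr pth (prime_gt0 pr) => [//|q] prq qth _.
  have -> : (x + y) ^+ q.+1 - x ^+ q.+1 - y ^+ q.+1 =
      \sum_(j < q) x ^+ (q - j) * y ^+ j.+1 *+ 'C(q.+1, j.+1).
    rewrite exprDn big_ord_recl big_ord_recr /= subn0 subnn !expr0 mulr1 mul1r.
    rewrite bin0 binn !mulr1n.
    have cancel (a b s : B) : a + (s + b) - a - b = s by ring.
    by rewrite cancel; apply: eq_bigr.
  apply: (seminorm_sum_le Nsemi); first by rewrite mulr_ge0// exprn_ge0.
  move=> j _ _; have /dvdnP[r ->] : (q.+1 %| 'C(q.+1, j.+1))%N.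
    by apply: prime_dvd_bin; rewrite //= ltnS ltn_ord.
  rewrite mulrnA -mulr_natl (le_trans (qth _))// ler_wpM2l//.
  rewrite (le_trans (seminorm_natmul_le _ _))// (le_trans (seminormM Nsemi _ _))//.
  have -> : q.+1 = ((q - j) + j.+1)%N by rewrite addnS subnK// ltnW.
  rewrite exprD; apply: ler_pM => //; rewrite (le_trans (seminormX_le Nsemi _ _ N1))//;
    by rewrite lerXn2r ?nnegrE.
elim: m F => [|m IH] F FM.
  rewrite !big_ord0 expr0n gtn_eqF ?prime_gt0// subrr (seminorm0 Nsemi).
  by rewrite mulr_ge0// exprn_ge0.
rewrite !big_ord_recr /=; set S := \sum_(j < m) F j; set S' := \sum_(j < m) F j ^+ p.
have -> : (S + F m) ^+ p - (S' + F m ^+ p) =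
    ((S + F m) ^+ p - S ^+ p - F m ^+ p) + (S ^+ p - S') by ring.
apply: (seminormD_le Nsemi); last by apply: IH => j jm; apply: FM; exact: ltnW.
apply: two; last exact: FM.
by apply: (seminorm_sum_le Nsemi) => // j _ _; apply: FM; exact: leqW (ltn_ord j).
Qed.

End PowerSum.

Section PowerMultiplicative.
Variables (R : realType) (B : comPzRingType) (N : B -> R).
Hypotheses (Nsemi : ring_seminorm N) (N1 : N 1 = 1).

(** A loss of norm in x ^+ n would persist in its multiple x ^+ (q ^ n), where iterating the
    hypothesis excludes it. *)
Lemma spectral_of_power q : (1 < q)%N -> (forall x, N (x ^+ q) = N x ^+ q) -> spectral N.
Proof.
move=> q1 Nq x n; have N0 := seminorm_ge0 Nsemi.
have Nqj j : N (x ^+ (q ^ j)) = N x ^+ (q ^ j).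
  elim: j => [|j IH]; first by rewrite expn0 !expr1.
  by rewrite expnSr !exprM Nq IH.
apply/eqP; rewrite eq_le seminormX_le ?N1//=.
have [->|x0] := eqVneq (N x) 0.
  by case: n => [|n]; rewrite ?expr0 ?N1// expr0n /= N0.
have xgt0 : 0 < N x by rewrite lt_def x0 N0.
have nq : (n <= q ^ n)%N by rewrite ltnW// ltn_expl.
rewrite -(@ler_pM2r _ (N x ^+ (q ^ n - n))) ?exprn_gt0//.
rewrite -exprD subnKC// -Nqj -{1}(subnKC nq) exprD.
rewrite (le_trans (seminormM Nsemi _ _))// ler_wpM2l// seminormX_le ?N1//.
Qed.

Lemma seminormX_close x y n : N (x - y) < N x ->
  N (x ^+ n - y ^+ n) <= N (x - y) * N x ^+ n.-1.
Proof.
move=> xy; have yx := seminorm_close Nsemi xy; have N0 := seminorm_ge0 Nsemi.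
rewrite subrXX (le_trans (seminormM Nsemi _ _))// ler_wpM2l//.
apply: (seminorm_sum_le Nsemi); first exact: exprn_ge0.
move=> j _ _; rewrite (le_trans (seminormM Nsemi _ _))//.
have -> : n.-1 = (n.-1 - j + j)%N.
  by rewrite subnK// -ltnS prednK ?ltn_ord// (leq_ltn_trans _ (ltn_ord j)).
rewrite addnK exprD ler_pM//.
  by rewrite -subn1 -subnDA add1n (le_trans (seminormX_le Nsemi _ _ _)) ?N1//.
by rewrite -[in X in _ <= X]yx seminormX_le ?N1.
Qed.

End PowerMultiplicative.

(** * Almost orthogonal families and the perfectoid case *)

Section Orthogonal.
Variables (R : realType) (k L : realValuedFieldType R) (i : {rmorphism k -> L}).
Hypothesis iso : isometric i.
Implicit Types (e : nat -> L) (c : nat -> k) (al : R).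

(** Families are functions on nat of which the first m values count, which makes adding a vector
    easy; e j = 0 is allowed. *)
Definition norm_orthogonal al m e := forall c j, (j < m)%N ->
  al * (vnorm (c j) * vnorm (e j)) <= vnorm (\sum_(j < m) i (c j) * e j).

Definition extend_seq (T : Type) m (e : nat -> T) (v : T) j := if (j < m)%N then e j else v.

Lemma sum_extend_seq m e v c :
  \sum_(j < m.+1) i (c j) * extend_seq m e v j =
  \sum_(j < m) i (c j) * e j + i (c m) * v.
Proof.
rewrite big_ord_recr /= /extend_seq ltnn; congr (_ + _).
by apply: eq_bigr => j _; rewrite ltn_ord.
Qed.

(** The distance condition bounds the new term by the whole sum, with factor be. The old part is the
    whole sum minus the new term, so it satisfies the same bound, and the factor al then passes to
    its own terms. *)
Lemma norm_orthogonal_extend al be m e v : 0 < al -> al <= 1 -> 0 < be -> be <= 1 ->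
  norm_orthogonal al m e ->
  (forall c, be * vnorm v <= vnorm (v + \sum_(j < m) i (c j) * e j)) ->
  norm_orthogonal (al * be) m.+1 (extend_seq m e v).
Proof.
move=> al0 al1 be0 be1 orth vdist c j jm; rewrite sum_extend_seq.
set w := \sum_(j < m) _.
have vle : be * (vnorm (c m) * vnorm v) <= vnorm (w + i (c m) * v).
  have [->|cm0] := eqVneq (c m) 0; first by rewrite vnorm0 mul0r mulr0 vnorm_ge0.
  have icm0 : i (c m) != 0 by rewrite fmorph_eq0.
  have -> : w + i (c m) * v = i (c m) * (v + \sum_(j < m) i (c j / c m) * e j).
    rewrite mulrDr addrC mulr_sumr; congr (_ + _); apply: eq_bigr => h _.
    by rewrite mulrA -rmorphM mulrCA divff// mulr1.
  by rewrite vnormM iso mulrCA ler_wpM2l ?vnorm_ge0// (vdist (fun j => c j / c m)).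
have wle : be * vnorm w <= vnorm (w + i (c m) * v).
  have wE : vnorm w <= Num.max (vnorm (w + i (c m) * v)) (vnorm (c m) * vnorm v).
    by rewrite -[w in vnorm w](addrK (i (c m) * v)) (le_trans (vnormD _ _))// vnormN vnormM iso.
  move: wE; rewrite le_max => /orP[wE|wE].
    by rewrite (le_trans _ wE)// ler_piMl ?vnorm_ge0.
  by rewrite (le_trans _ vle)// ler_wpM2l// ltW.
move: jm; rewrite ltnS leq_eqVlt /extend_seq => /orP[/eqP->|jm].
  by rewrite ltnn (le_trans _ vle)// -mulrA ler_piMl // !mulr_ge0 ?vnorm_ge0 ?(ltW be0).
by rewrite jm (le_trans _ wle)// mulrAC [X in X <= _]mulrC ler_wpM2l ?(ltW be0)// orth.
Qed.

(** Gram-Schmidt, where a point of the span whose distance to b is within a factor 1 / be of the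
    infimum replaces a nearest point. A vector at distance 0 from the span need not lie in it, so
    [bs] is only approximated, up to eta. *)
Lemma approx_norm_orthogonal (bs : seq L) al eta : 0 < al -> al < 1 -> 0 < eta ->
  exists m e, norm_orthogonal al m e /\
    forall b, b \in bs -> exists c, vnorm (b - \sum_(j < m) i (c j) * e j) < eta.
Proof.
move=> + + eta0; elim: bs al => [|b bs IH] al al0 al1.
  by exists 0, (fun=> 0); split.
(* The square of the mean of 1 and al is at least al: one factor be serves the old family, the other
   the new vector. *)
pose be := (1 + al) / 2; have be0 : 0 < be by rewrite /be; lra.
have be1 : be < 1 by rewrite /be; lra.
have bebe : al <= be * be by rewrite /be; nra.
have [m [e [orth bse]]] := IH be be0 be1.
have orth_al : norm_orthogonal al m e.
  move=> c j jm; rewrite (le_trans _ (orth c j jm))// ler_wpM2r ?mulr_ge0 ?vnorm_ge0//.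
  by rewrite /be; lra.
pose dists := [set vnorm (b - \sum_(j < m) i (c j) * e j) | c in [set: nat -> k]].
have dists_inf : has_inf dists.
  split; first by exists (vnorm (b - \sum_(j < m) i 0 * e j)), (fun=> 0).
  by exists 0 => _ [c _ <-]; exact: vnorm_ge0.
have d0 : 0 <= inf dists.
  by apply: lb_le_inf; [exact: dists_inf.1|move=> _ [c _ <-]; exact: vnorm_ge0].
(* At distance 0 from the span, b is already approximated and no vector is added. *)
have [dE|dN] := eqVneq (inf dists) 0.
  exists m, e; split=> // b'; rewrite inE => /orP[/eqP->|]; last exact: bse.
  have [||_ [c _ <-]] := inf_lt (S := dists) (x := eta); rewrite ?dE//; first exact: dists_inf.1.
  by move=> ?; exists c.
have dpos : 0 < inf dists by rewrite lt_def dN.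
have [||_ [c0 _ <-] c0d] := inf_lt (S := dists) (x := inf dists / be).
- exact: dists_inf.1.
- by rewrite ltr_pdivlMr// gtr_pMr.
pose v := b - \sum_(j < m) i (c0 j) * e j; rewrite -/v in c0d.
exists m.+1, (extend_seq m e v); split.
  have orth' : norm_orthogonal (be * be) m.+1 (extend_seq m e v).
    apply: norm_orthogonal_extend; rewrite ?ltW// => c; apply: (@le_trans _ _ (inf dists)).
      by move: c0d; rewrite ltr_pdivlMr// mulrC => /ltW.
    apply: ge_inf; first exact: dists_inf.2.
    exists (fun j => c0 j - c j) => //; congr vnorm.
    rewrite /v -addrA; congr (_ + _); rewrite -[RHS]opprK opprD opprK -sumrB; congr (- _).
    by apply: eq_bigr => j _; rewrite rmorphB mulrBl.
  move=> c j jm; rewrite (le_trans _ (orth' c j jm))//.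
  by rewrite ler_wpM2r ?mulr_ge0 ?vnorm_ge0.
move=> b'; rewrite inE => /orP[/eqP->|/bse[c cP]].
  pose c' j := if (j < m)%N then c0 j else 1.
  exists c'; rewrite sum_extend_seq /c' ltnn rmorph1 mul1r.
  under eq_bigr do rewrite ltn_ord.
  by rewrite /v addrCA subrr addr0 subrr vnorm0.
pose c' j := if (j < m)%N then c j else 0.
exists c'; rewrite sum_extend_seq /c' ltnn rmorph0 mul0r addr0.
by under eq_bigr do rewrite ltn_ord.
Qed.

Section Frobenius.
Variables (p : nat) (th : R).
Hypotheses (pr : prime p) (th1 : th < 1) (pth : vnorm (p%:R : k) <= th).
Hypothesis frob : forall c : k, exists y, vnorm (c - y ^+ p) <= th * vnorm c.

Lemma vnorm_semi (K : realValuedFieldType R) : ring_seminorm (@vnorm R K).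
Proof.
split=> [x||x y|x y]; rewrite ?vnorm_ge0 ?vnorm0 ?vnormM//.
by rewrite -(vnormN y) vnormD.
Qed.

(** Choose y j with y j ^+ p close to c j. Then S' differs from S ^+ p by at most th * M, where M is
    the largest norm of a term of S', while S ^+ p has norm at least al ^+ p * M > th * M; so both
    have the same norm. *)
Lemma norm_orthogonal_pow al m e : 0 < al -> th < al ^+ p ->
  norm_orthogonal al m e -> norm_orthogonal (al ^+ p) m (fun j => e j ^+ p).
Proof.
move=> al0 thal orth c j0 j0m; have p0 := prime_gt0 pr.
have th0 : 0 <= th := le_trans (vnorm_ge0 _) pth.
have /choice[y yP] := fun j => frob (c j).
have yc j : vnorm (c j) = vnorm (y j) ^+ p.
  have [c0|c0] := eqVneq (c j) 0.
    have := yP j; rewrite c0 sub0r vnormN vnorm0 mulr0 -vnormX => h.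
    by apply/eqP; rewrite eq_le h vnorm_ge0.
  rewrite -vnormX; apply/esym/(seminorm_close (vnorm_semi k)).
  by rewrite (le_lt_trans (yP j))// gtr_pMl// vnorm_gt0.
have [j1 _ j1max] := arg_maxP (fun j : 'I_m => vnorm (c j) * vnorm (e j) ^+ p) (i0 := Ordinal j0m) (P := predT) isT.
set M := vnorm (c j1) * vnorm (e j1) ^+ p in j1max.
have cM j : (j < m)%N -> vnorm (c j) * vnorm (e j) ^+ p <= M.
  by move=> jm; exact: (j1max (Ordinal jm)).
have M0 : 0 <= M by rewrite mulr_ge0 ?exprn_ge0 ?vnorm_ge0.
apply: (@le_trans _ _ (al ^+ p * M)).
  by rewrite vnormX ler_wpM2l ?exprn_ge0 ?(ltW al0) ?cM.
have [M00|M00] := eqVneq M 0; first by rewrite M00 mulr0 vnorm_ge0.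
have Mpos : 0 < M by rewrite lt_def M00.
set S := \sum_(j < m) i (y j) * e j; set S' := \sum_(j < m) i (c j) * e j ^+ p.
pose mu := vnorm (y j1) * vnorm (e j1).
have muM : mu ^+ p = M by rewrite /mu exprMn -yc.
have mu0 : 0 <= mu by rewrite mulr_ge0 ?vnorm_ge0.
have SM : al ^+ p * M <= vnorm (S ^+ p).
  rewrite vnormX -muM -exprMn lerXn2r ?nnegrE ?vnorm_ge0 ?(mulr_ge0 (ltW al0) mu0)//.
  exact: (orth y _ (ltn_ord j1)).
suff SS' : vnorm (S ^+ p - S') <= th * M.
  rewrite (_ : vnorm S' = vnorm (S ^+ p))//.
  apply: (seminorm_close (vnorm_semi L)); rewrite (le_lt_trans SS')//.
  by rewrite (lt_le_trans _ SM)// ltr_pM2r.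
(* The first difference consists of multiples of p, the second of the errors of the approximate p-th
   roots; both carry the factor th. *)
have -> : S ^+ p - S' = (S ^+ p - \sum_(j < m) (i (y j) * e j) ^+ p) +
    \sum_(j < m) i (y j ^+ p - c j) * e j ^+ p.
  under [X in _ = _ + X]eq_bigr do rewrite rmorphB mulrBl rmorphXn -exprMn.
  by rewrite sumrB addrA subrK.
have thM : 0 <= th * M by rewrite mulr_ge0.
apply: vnormD_le; last first.
  apply: vnorm_sum_le => // j _; rewrite vnormM iso vnormX.
  rewrite (@le_trans _ _ (th * vnorm (c j) * vnorm (e j) ^+ p))//.
    by rewrite ler_wpM2r ?exprn_ge0 ?vnorm_ge0// vnorm_distC.
  by rewrite -mulrA ler_wpM2l// cM.
rewrite -muM; apply: (@seminorm_pow_sum_le _ _ _ (vnorm_semi L) _ p pr th th0 _ m (fun j => i (y j) * e j) mu mu0).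
- by rewrite vnorm1.
- by move=> x; rewrite vnormM ler_wpM2r ?vnorm_ge0// -(rmorph_nat i) iso.
move=> j jm; rewrite -(@ler_pXn2r _ p) ?nnegrE ?vnorm_ge0// muM vnormM iso.
by rewrite exprMn -yc cM.
Qed.
End Frobenius.
End Orthogonal.

(** * The tensor norm over a base with approximate p-th roots *)

Section PerfectoidBase.
Variables (R : realType) (k : realValuedFieldType R) (A : comAlgType k).
Variables (N : A -> R) (Nalg : alg_seminorm N) (Nspec : spectral N).
Variables (L : realValuedFieldType R) (i : {rmorphism k -> L}).
Hypothesis iso : isometric i.
Local Notation T := (tensor A i).
Local Notation nrm := (@tensor_seminorm R k A L i N).
Let Nsemi := alg_seminorm_ring Nalg.
Let Tsemi := tnorm_semi Nalg i.

Lemma spectral_norm1 : N 1 = 1.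
Proof. by have := Nspec 1 0; rewrite !expr0. Qed.

Lemma tnorm1 : nrm 1 = 1.
Proof. by rewrite [1]/(tens i 1 1) (tnorm_tens1 Nalg iso) spectral_norm1. Qed.

Lemma tensX (a : A) (b : L) n : tens i a b ^+ n = tens i (a ^+ n) (b ^+ n).
Proof.
elim: n => [|n IH]; first by rewrite !expr0.
by rewrite !exprS IH tensM.
Qed.

(** Almost orthogonality says that the j-th coordinate on the span W of the e h has norm at most the
    inverse of al * vnorm (e j). By [tnorm_coord] the bound carries over to T, where the coordinate
    of the sum is a j. *)
Lemma tnorm_orthogonal al m e (a : nat -> A) j : 0 < al -> norm_orthogonal i al m e ->
  (j < m)%N -> al * (N (a j) * vnorm (e j)) <= nrm (\sum_(h < m) tens i (a h) (e h)).
Proof.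
move=> al0 orth jm.
have [ej0|ej0] := eqVneq (e j) 0.
  by rewrite ej0 vnorm0 !mulr0 (seminorm_ge0 Tsemi).
(* Orthogonality keeps e j out of the span W0 of the other vectors, so the j-th coordinate is well
   defined modulo W0, without independence of the whole family. *)
pose W0 := [set v | exists c : nat -> k, c j = 0 /\ v = \sum_(h < m) i (c h) * e h].
pose W := [set v | exists c : nat -> k, v = \sum_(h < m) i (c h) * e h].
have Wsub : lsubspace (range i) W.
  split=> [|_ _ [c ->] [d ->]|_ _ [b _ <-] [c ->]].
  - by exists (fun=> 0); rewrite big1// => h _; rewrite rmorph0 mul0r.
  - exists (fun h => c h + d h); rewrite -big_split; apply: eq_bigr => h _.
    by rewrite rmorphD mulrDl.
  - exists (fun h => b * c h); rewrite mulr_sumr; apply: eq_bigr => h _.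
    by rewrite rmorphM mulrA.
have W0sub : lsubspace (range i) W0.
  split=> [|_ _ [c [c0 ->]] [d [d0 ->]]|_ _ [b _ <-] [c [c0 ->]]].
  - by exists (fun=> 0); rewrite big1// => h _; rewrite rmorph0 mul0r.
  - exists (fun h => c h + d h); rewrite c0 d0 addr0 -big_split; split=> //.
    by apply: eq_bigr => h _; rewrite rmorphD mulrDl.
  - exists (fun h => b * c h); rewrite c0 mulr0 mulr_sumr; split=> //.
    by apply: eq_bigr => h _; rewrite rmorphM mulrA.
pose del (h h' : nat) : k := (h == h')%:R.
have We h : (h < m)%N -> e h = \sum_(h' < m) i (del h h') * e h'.
  move=> hm; rewrite (bigD1 (Ordinal hm)) //= big1 ?addr0 => [|h' hh'].
    by rewrite /del eqxx rmorph1 mul1r.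
  by rewrite /del (_ : h == h' = false) ?rmorph0 ?mul0r//; apply/negbTE; rewrite eq_sym.
have W0ej : ~ W0 (e j).
  move=> [c [cj0 ej]]; have := orth (fun h => del j h - c h) j jm.
  under eq_bigr do rewrite rmorphB mulrBl.
  rewrite sumrB -We// -ej subrr vnorm0 /del eqxx cj0 subr0 vnorm1 mul1r.
  by rewrite pmulr_rle0// leNgt vnorm_gt0 ej0.
have [f [ffun f0 f1]] := separating_functional (subfield_range i) W0sub W0ej.
have [g [gf gD gZ]] := functional_range ffun.
have fW (c : nat -> k) : f (\sum_(h < m) i (c h) * e h) = i (c j).
  rewrite -[X in f X](subrK (i (c j) * e j)) (functionalD ffun) f0 ?add0r.
    by rewrite (functionalZ ffun) ?f1 ?mulr1//; exists (c j).
  exists (fun h => c h - c j * del j h); rewrite /del eqxx mulr1 subrr; split=> //.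
  rewrite [X in i (c j) * X](We _ jm) mulr_sumr -sumrB; apply: eq_bigr => h _.
  by rewrite rmorphB rmorphM mulrBl mulrA.
have eal0 : 0 < al * vnorm (e j) by rewrite mulr_gt0// vnorm_gt0.
pose s := [seq (a h, e h) | h <- index_iota 0 m].
have := @tnorm_coord _ _ _ _ Nalg _ i iso W f g (al * vnorm (e j))^-1 s Wsub ffun.
rewrite !big_map /= !big_mkord => /(_ _ _ gf) coord.
rewrite mulrCA mulrC -ler_pdivlMl// -[in X in X <= _](_ : \sum_(h < m) g (e h) *: a h = a j).
  apply: coord.
  - by rewrite invr_ge0 ltW.
  - move=> _ [c ->]; rewrite fW iso mulrC ler_pdivlMr// mulrCA; exact: orth.
  - move=> p /mapP[h]; rewrite mem_index_iota => /andP[_ hm] -> /=.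
    by exists (del h); rewrite -We.
rewrite (bigD1 (Ordinal jm)) //= big1 ?addr0 => [|h hj].
  suff -> : g (e j) = 1 by rewrite scale1r.
  by apply: (fmorph_inj i); rewrite gf f1 rmorph1.
suff -> : g (e h) = 0 by rewrite scale0r.
apply: (fmorph_inj i); rewrite gf rmorph0; apply: f0.
exists (del h); rewrite -We//; split=> //.
by rewrite /del (_ : (h : nat) == j = false)//; apply/negbTE.
Qed.


(** Approximate the right factors of x by combinations of an almost orthogonal family, so closely
    that the error stays below eps after multiplication by the norm of any left factor, then move
    the coefficients to the left. *)
Lemma tnorm_approx_orthogonal x al eps : 0 < al -> al < 1 -> 0 < eps ->
  exists m e (a : nat -> A), norm_orthogonal i al m e /\
    nrm (x - \sum_(h < m) tens i (a h) (e h)) < eps.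
Proof.
move=> al0 al1 eps0; have [s [_ ->]] := tens_span_full x.
pose M := \big[Num.max/0]_(q <- s) N q.1.
have M0 : 0 < 1 + M by rewrite ltr_pwDl// bigmax_seq_ge0.
have eta0 : 0 < eps / (1 + M) by rewrite divr_gt0.
have [m [e [orth se]]] := approx_norm_orthogonal iso (map snd s) al0 al1 eta0.
exists m, e; suff [a aP] : exists a : nat -> A,
    nrm (\sum_(q <- s) tens i q.1 q.2 - \sum_(h < m) tens i (a h) (e h)) < eps by exists a.
have sN q : q \in s -> N q.1 * (eps / (1 + M)) < eps.
  move=> qs; rewrite mulrA ltr_pdivrMr// mulrC ltr_pM2l//.
  have : N q.1 <= M.
    by move: q qs; apply/bigmax_seq_le => //; exact: bigmax_seq_ge0.
  by lra.
move: (eps / (1 + M)) eta0 sN se => eta _; elim: s {M M0} => [|q s IH] sN se.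
  exists (fun=> 0); rewrite big_nil big1 ?subrr ?(seminorm0 Tsemi)// => h _.
  exact: tens0l.
have [r rs|v vs|a aP] := IH.
- by apply: sN; rewrite inE rs orbT.
- by apply: se; rewrite inE vs orbT.
have [c cP] := se q.2 (mem_head _ _).
exists (fun h => c h *: q.1 + a h).
under [X in nrm (_ - X)]eq_bigr do rewrite tensDl.
rewrite big_split big_cons opprD addrACA /=; apply: (seminormD_lt Tsemi) => //.
have -> : \sum_(h < m) tens i (c h *: q.1) (e h) = tens i q.1 (\sum_(h < m) i (c h) * e h).
  rewrite (big_morph (tens i q.1) (tensDr i q.1) (tens0r i q.1)).
  by apply: eq_bigr => h _; rewrite tensZ.
have -> : tens i q.1 q.2 = tens i q.1 (q.2 - \sum_(h < m) i (c h) * e h) +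
    tens i q.1 (\sum_(h < m) i (c h) * e h) by rewrite -tensDr subrK.
rewrite addrK (le_lt_trans (tnorm_tens_le Nalg _ _ _))//.
rewrite (le_lt_trans _ (sN q (mem_head _ _)))// ler_wpM2l ?(seminorm_ge0 Nsemi)//.
exact: ltW.
Qed.

Section Frobenius.
Variables (p : nat) (th : R).
Hypotheses (pr : prime p) (th1 : th < 1) (pth : vnorm (p%:R : k) <= th).
Hypothesis frob : forall c : k, exists y, vnorm (c - y ^+ p) <= th * vnorm c.

Let th0 : 0 <= th := le_trans (vnorm_ge0 _) pth.

(** Replace x by a sum y over an almost orthogonal family. The sum of the p-th powers of its terms
    is again almost orthogonal, and it differs from y ^+ p by less than its own norm. *)
Lemma tnorm_pow_ge al x : 0 < al -> al < 1 -> th < al ^+ p ->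
  al ^+ p * nrm x ^+ p <= nrm (x ^+ p).
Proof.
move=> al0 al1 thal; have p0 := prime_gt0 pr.
have N0 := seminorm_ge0 Nsemi; have T0 := seminorm_ge0 Tsemi.
have [->|x0] := eqVneq (nrm x) 0; first by rewrite expr0n gtn_eqF// mulr0.
have xpos : 0 < nrm x by rewrite lt_def x0 T0.
have alp0 : 0 < al ^+ p by rewrite exprn_gt0.
have alp1 : al ^+ p < 1 by rewrite exprn_ilt1 ?(ltW al0)// gtn_eqF.
(* With this precision x ^+ p - y ^+ p has norm below al ^+ p * nrm x ^+ p, a lower bound for the
   norm of y ^+ p. *)
have ep0 : 0 < al ^+ p * nrm x by rewrite mulr_gt0.
have [m [e [a [orth xa]]]] := tnorm_approx_orthogonal x al0 al1 ep0.
set y := \sum_(h < m) _ in xa.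
have xy : nrm (x - y) < nrm x by rewrite (lt_le_trans xa)// ler_piMl ?ltW.
have yx := seminorm_close Tsemi xy.
have N1 := spectral_norm1.
pose F (h : nat) := N (a h) * vnorm (e h).
have [j1 yM] : exists j1 : 'I_m, nrm y <= F j1.
  apply: contrapT => /forallNP yM; suff : nrm y < nrm y by rewrite ltxx.
  apply: (seminorm_sum_lt Tsemi) => [|h _ _]; first by rewrite yx.
  rewrite (le_lt_trans (tnorm_tens_le Nalg _ _ _))// ltNge.
  exact/negP/yM.
have [j2 _ j2max] := arg_maxP (fun j : 'I_m => F j) (i0 := j1) (P := predT) isT.
have FM j : (j < m)%N -> F j <= F j2 by move=> jm; exact: (j2max (Ordinal jm)).
have {}yM : nrm x <= F j2 by rewrite -yx (le_trans yM)// FM.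
have F0 : 0 < F j2 by rewrite (lt_le_trans xpos).
have y'M : al ^+ p * F j2 ^+ p <= nrm (\sum_(h < m) tens i (a h) (e h) ^+ p).
  have orth' := norm_orthogonal_pow iso pr th1 pth frob al0 thal orth.
  have := tnorm_orthogonal (fun h => a h ^+ p) alp0 orth' (ltn_ord j2).
  rewrite Nspec vnormX -exprMn => /le_trans; apply.
  by under [X in _ <= nrm X]eq_bigr do rewrite tensX.
have pT z : nrm (p%:R * z) <= th * nrm z.
  rewrite -(rmorph_nat (tens_right A i)) mulrC (tnormM_right Nalg) mulrC ler_wpM2r//.
  by rewrite -(rmorph_nat i) iso.
have Fp0 : 0 < F j2 ^+ p by rewrite exprn_gt0.
have yE : nrm (y ^+ p - \sum_(h < m) tens i (a h) (e h) ^+ p) <= th * F j2 ^+ p.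
  apply: (@seminorm_pow_sum_le _ _ _ Tsemi _ p pr th th0 pT m (fun h => tens i (a h) (e h)) _ (ltW F0)).
    by rewrite tnorm1.
  by move=> j jm; rewrite (le_trans (tnorm_tens_le Nalg _ _ _))// FM.
have yp : al ^+ p * F j2 ^+ p <= nrm (y ^+ p).
  rewrite (_ : nrm (y ^+ p) = nrm (\sum_(h < m) tens i (a h) (e h) ^+ p))//.
  apply: (seminorm_close Tsemi); rewrite -(seminormN Tsemi) opprB (le_lt_trans yE)//.
  by rewrite (lt_le_trans _ y'M)// ltr_pM2r.
have ayp : al ^+ p * nrm x ^+ p <= nrm (y ^+ p).
  by rewrite (le_trans _ yp)// ler_pM2l// lerXn2r ?nnegrE// ltW.
rewrite (_ : nrm (x ^+ p) = nrm (y ^+ p))//; apply: (seminorm_close Tsemi).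
rewrite -(seminormN Tsemi) opprB (lt_le_trans _ ayp)//.
rewrite (le_lt_trans (seminormX_close Tsemi tnorm1 p xy))//.
have -> : nrm x ^+ p = nrm x * nrm x ^+ p.-1 by rewrite -exprS prednK.
by rewrite mulrA ltr_pM2r ?exprn_gt0.
Qed.

Lemma tnorm_spectral_frobenius : spectral nrm.
Proof.
apply: (spectral_of_power Tsemi tnorm1 (prime_gt1 pr)) => x.
have T0 := seminorm_ge0 Tsemi.
apply/eqP; rewrite eq_le seminormX_le ?tnorm1//= leNgt; apply/negP => xp.
have xpos : 0 < nrm x ^+ p by rewrite (le_lt_trans _ xp).
(* If x ^+ p lost norm, al could be taken so close to 1 that al ^+ p exceeds the ratio, against
   [tnorm_pow_ge]. *)
have [|al [al0 al1]] := exists_power_gt (rho := Num.max th (nrm (x ^+ p) / nrm x ^+ p)) p.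
  by rewrite gt_max th1 ltr_pdivrMr// mul1r.
rewrite gt_max ltr_pdivrMr// => /andP[thal]; apply/negP; rewrite -leNgt.
exact: tnorm_pow_ge.
Qed.

End Frobenius.
End PerfectoidBase.

Lemma exists_expr_lt (R : realType) (h e : R) : 0 <= h -> h < 1 -> 0 < e ->
  exists n, h ^+ n < e.
Proof.
move=> h0 h1 e0; have : `|h| < 1 by rewrite ger0_norm.
move=> /cvg_expr/cvgrPdist_lt/(_ e e0)[n _ /(_ n (leqnn n))] /=.
by rewrite sub0r normrN ger0_norm ?exprn_ge0//; exists n.
Qed.

(** * Value group and approximate p-th roots of a perfectoid field *)

Section PerfectoidField.
Variables (R : realType) (K : realValuedFieldType R).

(** If no value lay between rho and 1, quotients of values would show that every value is
    isolated. *)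
Lemma exists_vnorm_between (rho : R) : ~ discretely_valued K -> rho < 1 ->
  exists u : K, rho < vnorm u < 1.
Proof.
move=> ndisc rho1; apply: contrapT => /forallNP nu; apply: ndisc.
move=> _ [x /= x0 <-]; split; first by apply/mem_set; exists x.
have x0' : 0 < vnorm x by rewrite vnorm_gt0.
pose r := Num.max rho (1 / 2); have r1 : r < 1 by rewrite gt_max rho1/=; lra.
have r0 : 1 / 2 <= r by rewrite le_max lexx orbT.
have far (u : K) : r < vnorm u -> vnorm u < 1 -> False.
  by move=> ru u1; case: (nu u); rewrite u1 andbT (le_lt_trans _ ru)// le_max lexx.
have e0 : 0 < vnorm x * (1 - r) by rewrite mulr_gt0// subr_gt0.
(* A different value this close to vnorm x has a ratio to it, one way or the other, strictly between
   r and 1. *)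
exists (ball (vnorm x) (vnorm x * (1 - r))); first exact: nbhsx_ballx.
apply/seteqP; split=> [t [/= xt [y /= y0 yt]]|_ ->]; last first.
  by split; [exact: ballxx|exists x].
have y0' : 0 < vnorm y by rewrite vnorm_gt0.
move: xt; rewrite -yt /ball /= ltr_distlC => /andP[yx xy]; apply/eqP; rewrite eq_le; apply/andP; split.
  rewrite leNgt; apply/negP => lt; apply: (far (x / y)).
    rewrite vnormM vnormV ltr_pdivlMr//; nra.
  by rewrite vnormM vnormV ltr_pdivrMr// mul1r.
rewrite leNgt; apply/negP => lt; apply: (far (y / x)).
  rewrite vnormM vnormV ltr_pdivlMr//; nra.
by rewrite vnormM vnormV ltr_pdivrMr// mul1r.
Qed.

(** Consecutive powers of vnorm u ^+ q have ratio above h, so, scaled by vnorm c, they cannot jump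
    over the interval [h, 1]. *)
Lemma rescale_vnorm (h : R) (u c : K) q : 0 < h -> h < vnorm u ^+ q ->
  vnorm u ^+ q < 1 -> c != 0 ->
  exists w : K, w != 0 /\ h <= vnorm c * vnorm w ^+ q <= 1.
Proof.
move=> h0 hu u1 c0; have c0' : 0 < vnorm c by rewrite vnorm_gt0.
set g := vnorm u ^+ q in hu u1; have g0 : 0 < g := lt_trans h0 hu.
have q0 : (0 < q)%N by case: q @g hu u1 g0 => // ? ?; rewrite ltxx.
have u0 : u != 0.
  by apply/eqP => u0; move: g0; rewrite /g u0 vnorm0 expr0n gtn_eqF// ltxx.
have [c1|c1] := leP 1 (vnorm c).
  have ex : exists n, vnorm c * g ^+ n <= 1.
    have [|n gn] := exists_expr_lt (ltW g0) u1 (e := (vnorm c)^-1).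
      by rewrite invr_gt0.
    by exists n; rewrite -ler_pdivlMl// mulr1 ltW.
  case: (ex_minnP ex) => -[|n] cn nmin.
    exists 1; rewrite oner_eq0 vnorm1 expr1n mulr1; split=> //.
    by rewrite -[vnorm c]mulr1 cn andbT mulr1 (le_trans _ c1)// ltW// (lt_trans hu).
  exists (u ^+ n.+1); rewrite expf_neq0// vnormX exprAC cn andbT; split=> //.
  have : 1 < vnorm c * g ^+ n.
    by rewrite ltNge; apply/negP => /nmin; rewrite ltnn.
  rewrite -/g exprSr mulrA => lt; rewrite (le_trans (ltW hu))// ler_peMl ?ltW//.
have ex : exists n, g ^+ n <= vnorm c.
  by have [n gn] := exists_expr_lt (ltW g0) u1 c0'; exists n; exact: ltW.
case: (ex_minnP ex) => -[|n] cn nmin; first by move: cn; rewrite leNgt c1.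
have gn : vnorm c < g ^+ n.
  by rewrite ltNge; apply/negP => /nmin; rewrite ltnn.
have gn0 : 0 < g ^+ n by rewrite exprn_gt0.
(* Here n + 1 is the minimal exponent, so that g ^+ n.+1 <= vnorm c < g ^+ n. *)
exists (u ^+ n)^-1; rewrite invr_neq0 ?expf_neq0// vnormV vnormX exprVn exprAC -/g.
split=> //; rewrite ler_pdivlMr// ler_pdivrMr// mul1r (ltW gn) andbT.
by rewrite (le_trans _ cn)// exprS ler_pM2r// ltW.
Qed.

(** The definition gives an absolute error vnorm pi for integral elements. Taking th as the square
    root of vnorm pi and scaling c by a p-th power into norms between th and 1 makes this error at
    most th times the norm of the scaled element. *)
Lemma perfectoid_frobenius : perfectoid K -> exists p th,
  [/\ prime p, 0 < th < 1, vnorm (p%:R : K) <= th &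
      forall c : K, exists y, vnorm (c - y ^+ p) <= th * vnorm c].
Proof.
move=> [p [pchar _ ndisc [pi [pi0 pi1 ppi surj]]]].
have pr : prime p := pcharf_prime pchar.
have th0 : 0 < vnorm (val pi).
  by rewrite vnorm_gt0; apply: contra pi0 => /eqP h; apply/eqP/val_inj; rewrite h rmorph0.
have th1 : vnorm (val pi) < 1 := pi1.
pose th := Num.sqrt (vnorm (val pi)).
have thth : th * th = vnorm (val pi) by rewrite -expr2 sqr_sqrtr// ltW.
have sq0 : 0 < th by rewrite sqrtr_gt0.
have sq1 : th < 1 by nra.
exists p, th; split => //; first by rewrite sq0.
  by rewrite (le_trans ppi)// -thth ler_piMl ?ltW.
move=> c; have [->|c0] := eqVneq c 0.
  by exists 0; rewrite expr0n gtn_eqF ?prime_gt0// subrr vnorm0 mulr0.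
have [al [al0 al1 thal]] := exists_power_gt p sq1.
have [u /andP[alu u1]] := exists_vnorm_between ndisc al1.
have u1' : vnorm u ^+ p < 1 by rewrite exprn_ilt1 ?vnorm_ge0// gtn_eqF ?prime_gt0.
have thu : th < vnorm u ^+ p.
  by rewrite (lt_trans thal)// ltrXn2r ?gtn_eqF ?prime_gt0 ?ltW.
have [w [w0 /andP[cw cw1]]] := rescale_vnorm sq0 thu u1' c0.
have cwv : c * w ^+ p \in @vring_pred R K by rewrite inE vnormM vnormX.
have [y [z yz]] := surj (Sub (c * w ^+ p) cwv).
exists (val y / w); rewrite -(@ler_pM2r _ (vnorm (w ^+ p))); last first.
  by rewrite vnorm_gt0 expf_neq0.
rewrite -vnormM mulrBl expr_div_n divfK ?expf_neq0//.
have -> : c * w ^+ p - val y ^+ p = val pi * val z.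
  have -> : c * w ^+ p = val y ^+ p + val pi * val z.
    by rewrite -rmorphXn -rmorphM -rmorphD -yz.
  by rewrite addrAC subrr add0r.
rewrite vnormM -thth -!mulrA ler_pM2l// -vnormM.
rewrite (@le_trans _ _ th)//; last by rewrite vnormM vnormX.
have zle : vnorm (val z) <= 1 := valP z.
by rewrite ler_piMr// ltW.
Qed.

End PerfectoidField.

(** An approximate p-th root y in the completion is replaced by an element of k within th * vnorm y;
    as vnorm y ^+ p = vnorm c, this changes the p-th power by at most th * vnorm c. *)
Lemma completion_perfectoid_frobenius (R : realType) (k : realValuedFieldType R) :
  completion_perfectoid k -> exists p th,
  [/\ prime p, th < 1, vnorm (p%:R : k) <= th &
      forall c : k, exists y, vnorm (c - y ^+ p) <= th * vnorm c].
Proof.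
move=> [K [j [[jiso _ jdense] /perfectoid_frobenius[p [th [pr /andP[th0 th1] pth frob]]]]]].
have p0 := prime_gt0 pr.
exists p, th; split=> //; first by rewrite -jiso rmorph_nat.
move=> c; have [->|c0] := eqVneq c 0.
  by exists 0; rewrite expr0n gtn_eqF// subrr vnorm0 mulr0.
have c0' : 0 < vnorm c by rewrite vnorm_gt0.
have [y yP] := frob (j c); rewrite jiso in yP.
have yc : vnorm y ^+ p = vnorm c.
  rewrite -vnormX -jiso; apply: (seminorm_close (vnorm_semi K)).
  by rewrite (le_lt_trans yP)// jiso gtr_pMl.
have y0 : 0 < vnorm y.
  rewrite lt_def vnorm_ge0 andbT; apply/eqP => y0; move: c0'.
  by rewrite -yc y0 expr0n gtn_eqF// ltxx.
have [|y' y'P] := jdense y (th * vnorm y); first exact: mulr_gt0.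
exists y'; rewrite -jiso rmorphB rmorphXn -(subrK (y ^+ p) (j c)) -addrA.
apply: vnormD_le => //.
have yy' : vnorm (y - j y') < vnorm y by rewrite (lt_trans y'P)// gtr_pMl.
rewrite (le_trans (seminormX_close (vnorm_semi K) vnorm1 p yy'))//.
by rewrite -yc -(prednK p0) /= exprS mulrA ler_pM2r ?exprn_gt0// ltW.
Qed.

(** * Completion *)

Section Completion.
Variables (R : realType) (L : realValuedFieldType R).
Implicit Types (u v : nat -> L).

Definition cauchy_pred : {pred (nat -> L)} := [pred u | `[< vcauchy u >]].

Definition vnull u := forall e : R, 0 < e -> exists n, forall m, (n <= m)%N -> vnorm (u m) < e.

Lemma cauchyP u : reflect (vcauchy u) (u \in cauchy_pred).
Proof. exact: asboolP. Qed.

(** Once the oscillation of u is below some vnorm (u m0), the isosceles principle freezes the norm.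
    Inverses and multiplicativity of the norm in the completion follow from this. *)
Lemma cauchy_dichotomy u : vcauchy u -> vnull u \/
  exists c n, 0 < c /\ forall m, (n <= m)%N -> vnorm (u m) = c.
Proof.
move=> uC; have [|nnull] := pselect (vnull u); [by left|right].
have [e [e0 eP]] : exists e, 0 < e /\ forall n, exists m, (n <= m)%N /\ e <= vnorm (u m).
  apply: contrapT => /forallNP h; apply: nnull => e e0.
  apply: contrapT => /forallNP h'; apply: (h e); split=> // n.
  apply: contrapT => /forallNP h''; apply: (h' n) => m nm.
  by rewrite ltNge; apply/negP => em; apply: (h'' m).
have [n nP] := uC e e0; have [m0 [nm0 em0]] := eP n.
exists (vnorm (u m0)), m0; split; first exact: lt_le_trans em0.
move=> m m0m; apply: (seminorm_close (vnorm_semi L)).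
rewrite (lt_le_trans _ em0)// nP// (leq_trans nm0)//.
Qed.

Lemma cauchy_bounded u : vcauchy u -> exists M, 0 < M /\ forall m, vnorm (u m) <= M.
Proof.
move=> /(_ 1 ltr01)[n nP].
exists (1 + \sum_(j < n.+1) vnorm (u j)); split.
  by rewrite ltr_pwDl// sumr_ge0// => j _; exact: vnorm_ge0.
have le j : (j <= n)%N -> vnorm (u j) <= \sum_(j < n.+1) vnorm (u j).
  move=> jn; rewrite (bigD1 (Ordinal (jn : (j < n.+1)%N)))//= lerDl.
  by rewrite sumr_ge0// => h _; exact: vnorm_ge0.
move=> m; have [mn|nm] := leqP m n; first by rewrite (le_trans (le _ mn))// lerDr.
rewrite -(subrK (u n) (u m)); apply: vnormD_le.
  rewrite (le_trans (ltW (nP _ _ (ltnW nm) (leqnn n))))// lerDl.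
  by rewrite sumr_ge0// => h _; exact: vnorm_ge0.
by rewrite (le_trans (le _ (leqnn n)))// lerDr.
Qed.

Lemma cauchy_subring_closed : subring_closed cauchy_pred.
Proof.
split=> [|u v /cauchyP uC /cauchyP vC|u v /cauchyP uC /cauchyP vC]; apply/cauchyP => e e0.
- by exists 0%N => m m' _ _; rewrite subrr vnorm0.
- have [n nP] := uC e e0; have [n' nP'] := vC e e0.
  exists (maxn n n') => m m'; rewrite !geq_max => /andP[nm n'm] /andP[nm' n'm'].
  have -> : (u - v) m - (u - v) m' = (u m - u m') - (v m - v m').
    by rewrite !fctE; ring.
  by apply: vnormB_lt; [exact: nP|exact: nP'].
have [M [M0 uM]] := cauchy_bounded uC; have [M' [M'0 vM]] := cauchy_bounded vC.
have [n nP] := uC (e / M') (divr_gt0 e0 M'0); have [n' nP'] := vC (e / M) (divr_gt0 e0 M0).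
exists (maxn n n') => m m'; rewrite !geq_max => /andP[nm n'm] /andP[nm' n'm'].
have -> : (u * v) m - (u * v) m' = (u m - u m') * v m + u m' * (v m - v m').
  by rewrite !fctE; ring.
apply: vnormD_lt; rewrite vnormM.
  rewrite (le_lt_trans (ler_wpM2l _ (vM m))) ?vnorm_ge0//.
  by rewrite -ltr_pdivlMr// nP.
rewrite (le_lt_trans (ler_wpM2r _ (uM m'))) ?vnorm_ge0//.
by rewrite -ltr_pdivlMl// mulrC nP'.
Qed.

HB.instance Definition _ :=
  GRing.isSubringClosed.Build (nat -> L) cauchy_pred cauchy_subring_closed.

Definition cauchy_seq := {u : nat -> L | u \in cauchy_pred}.
HB.instance Definition _ := SubChoice.on cauchy_seq.
HB.instance Definition _ := [SubChoice_isSubComNzRing of cauchy_seq by <:].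

Definition null_pred : {pred cauchy_seq} := [pred u : cauchy_seq | `[< vnull (val u) >]].

Lemma null_closed : idealr_closed null_pred.
Proof.
split=> [||a x y].
- by apply/asboolP => e e0; exists 0%N => m _; rewrite rmorph0 vnorm0.
- apply/negP => /asboolP /(_ 1 ltr01)[n /(_ n (leqnn n))].
  by rewrite rmorph1 vnorm1 ltxx.
move=> /asboolP x0 /asboolP y0; apply/asboolP => e e0.
have /cauchyP aC := valP a; have [M [M0 aM]] := cauchy_bounded aC.
have [n nP] := x0 (e / M) (divr_gt0 e0 M0); have [n' nP'] := y0 e e0.
exists (maxn n n') => m; rewrite geq_max => /andP[nm n'm].
rewrite rmorphD rmorphM; apply: vnormD_lt; last exact: nP'.
rewrite [vnorm _]vnormM (le_lt_trans (ler_wpM2r _ (aM m))) ?vnorm_ge0//.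
by rewrite -ltr_pdivlMl// mulrC nP.
Qed.
HB.instance Definition _ := isIdealr.Build cauchy_seq null_pred null_closed.

Definition completion := {ideal_quot null_pred}.
HB.instance Definition _ := GRing.ComNzRing.on completion.


Local Open Scope quotient_scope.

Definition cclass (u : cauchy_seq) : completion := \pi_({ideal_quot null_pred}) u.

Fact cclass_zmod_morphism : zmod_morphism cclass.
Proof. exact: rmorphB. Qed.
HB.instance Definition _ :=
  GRing.isZmodMorphism.Build cauchy_seq completion cclass cclass_zmod_morphism.

Fact cclass_monoid_morphism : monoid_morphism cclass.
Proof. by split; [exact: rmorph1|exact: rmorphM]. Qed.
HB.instance Definition _ :=
  GRing.isMonoidMorphism.Build cauchy_seq completion cclass cclass_monoid_morphism.

Lemma cclass_ind (P : completion -> Prop) : (forall u : cauchy_seq, P (cclass u)) -> forall x, P x.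
Proof. by move=> Pu x; rewrite -(reprK x); exact: Pu. Qed.

Lemma cclass_eq (u v : cauchy_seq) : cclass u = cclass v <-> vnull (val u - val v).
Proof.
rewrite -rmorphB; split=> [/eqP|uv].
  by rewrite -Quotient.idealrBE => /asboolP.
by apply/eqP; rewrite -Quotient.idealrBE; apply/asboolP.
Qed.

Lemma cclass_eq0 (u : cauchy_seq) : cclass u = 0 <-> vnull (val u).
Proof. by rewrite -(rmorph0 cclass) cclass_eq rmorph0 subr0. Qed.

(** The terms are eventually nonzero of constant norm, so their inverses form a Cauchy sequence;
    zero terms at the beginning invert to 0 and do no harm. *)
Lemma completion_inverse (x : completion) : x != 0 -> exists y, y * x = 1.
Proof.
elim/cclass_ind: x => u /eqP u0; have /cauchyP uC := valP u.
have [/cclass_eq0//|[c [n [c0 uc]]]] := cauchy_dichotomy uC.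
have unz m : (n <= m)%N -> val u m != 0 by move=> nm; rewrite -vnorm_gt0 uc.
have vC : (fun m => (val u m)^-1) \in cauchy_pred.
  apply/cauchyP => e e0; have [n' nP'] := uC (e * (c * c)) (mulr_gt0 e0 (mulr_gt0 c0 c0)).
  exists (maxn n n') => m m'; rewrite !geq_max => /andP[nm n'm] /andP[nm' n'm'].
  have -> : (val u m)^-1 - (val u m')^-1 = (val u m' - val u m) / (val u m * val u m').
    by field; rewrite !unz.
  by rewrite vnormM vnormV vnormM !uc// ltr_pdivrMr ?mulr_gt0// nP'.
pose v : cauchy_seq := Sub (fun m => (val u m)^-1) vC.
exists (cclass v); rewrite -rmorphM -(rmorph1 cclass); apply/cclass_eq => e e0.
exists n => m nm.
suff -> : (val (v * u) - val (1 : cauchy_seq)) m = 0 by rewrite vnorm0.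
rewrite rmorphM rmorph1.
rewrite -[LHS]/((val u m)^-1 * val u m - 1) mulVf ?subrr//; exact: unz.
Qed.

Definition completion_inv (x : completion) : completion :=
  if pselect (exists y, y * x = 1) is left e then sval (cid e) else 0.

Fact completion_mulVf x : x != 0 -> completion_inv x * x = 1.
Proof.
move=> x0; rewrite /completion_inv; case: pselect => [e|[]]; first exact: svalP (cid e).
exact: completion_inverse.
Qed.

Fact completion_inv0 : completion_inv 0 = 0.
Proof.
rewrite /completion_inv; case: pselect => // e; exfalso; case: e => y; rewrite mulr0 => /esym/eqP.
by rewrite oner_eq0.
Qed.

HB.instance Definition _ :=
  GRing.ComNzRing_isField.Build completion completion_mulVf completion_inv0.

Definition seq_norm u (c : R) := forall e : R, 0 < e ->
  exists n, forall m, (n <= m)%N -> `|vnorm (u m) - c| < e.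

Lemma seq_norm_uniq u c d : seq_norm u c -> seq_norm u d -> c = d.
Proof.
move=> uc ud; apply/eqP; rewrite -subr_eq0 -normr_le0 leNgt; apply/negP => cd.
have cd2 : 0 < `|c - d| / 2 by lra.
have [n nP] := uc _ cd2; have [n' nP'] := ud _ cd2.
have := ltrD (nP _ (leq_maxl n n')) (nP' _ (leq_maxr n n')).
rewrite -splitr ltNge => /negP; apply; rewrite [X in _ <= X + _]distrC.
exact: ler_distD.
Qed.

Lemma seq_norm_null u : vnull u -> seq_norm u 0.
Proof.
move=> u0 e /u0[n nP]; exists n => m /nP.
by rewrite subr0 ger0_norm ?vnorm_ge0.
Qed.

Lemma seq_norm_exists u : vcauchy u -> exists c, seq_norm u c.
Proof.
move=> /cauchy_dichotomy[u0|[c [n [c0 uc]]]]; first by exists 0; exact: seq_norm_null.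
by exists c => e e0; exists n => m /uc->; rewrite subrr normr0.
Qed.

Lemma vnorm_dist (x y : L) : `|vnorm x - vnorm y| <= vnorm (x - y).
Proof.
have le (z t : L) : vnorm z <= vnorm (z - t) + vnorm t.
  rewrite -[z in X in X <= _](subrK t) (le_trans (vnormD _ _))// ge_max.
  by rewrite lerDl lerDr !vnorm_ge0.
rewrite ler_norml lerBlDr le andbT lerNl opprB lerBlDr vnorm_distC.
exact: le.
Qed.

Lemma seq_norm_eq u v c : vnull (u - v) -> seq_norm u c -> seq_norm v c.
Proof.
move=> uv uc e e0; have e2 : 0 < e / 2 by lra.
have [n nP] := uv _ e2; have [n' nP'] := uc _ e2.
exists (maxn n n') => m; rewrite geq_max => /andP[nm n'm].
rewrite -(subrK (vnorm (u m)) (vnorm (v m))) -addrA (splitr e).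
rewrite (le_lt_trans (ler_normD _ _))// ltrD ?nP'//.
by rewrite (le_lt_trans (vnorm_dist _ _))// vnorm_distC nP.
Qed.

Definition completion_norm (x : completion) : R :=
  sval (cid (seq_norm_exists (elimT (cauchyP _) (valP (repr x))))).

Lemma completion_normE (u : cauchy_seq) c :
  seq_norm (val u) c -> completion_norm (cclass u) = c.
Proof.
rewrite /completion_norm; case: cid => d /= ud; apply: seq_norm_uniq.
by apply: seq_norm_eq ud; apply/cclass_eq; rewrite /cclass reprK.
Qed.

Lemma completion_normP (u : cauchy_seq) : seq_norm (val u) (completion_norm (cclass u)).
Proof.
have /cauchyP/seq_norm_exists[c uc] := valP u.
by rewrite (completion_normE uc).
Qed.

Lemma completion_norm_le (u : cauchy_seq) t n :
  (forall m, (n <= m)%N -> vnorm (val u m) <= t) -> completion_norm (cclass u) <= t.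
Proof.
move=> ut; apply/ler_addgt0Pr => e e0; have [n' nP] := completion_normP u e0.
have := nP _ (leq_maxr n n'); rewrite ltr_distl => /andP[+ _].
move=> /ltW; rewrite lerBlDr => /le_trans; apply; rewrite lerD2r.
exact/ut/leq_maxl.
Qed.

Fact completion_norm_ge0 x : 0 <= completion_norm x.
Proof.
elim/cclass_ind: x => u; apply/ler_addgt0Pr => e e0.
have [n /(_ n (leqnn n))] := completion_normP u e0.
by rewrite ltr_distl => /andP[_ +]; move/ltW; apply: le_trans; exact: vnorm_ge0.
Qed.

Fact completion_norm_eq0 x : (completion_norm x == 0) = (x == 0).
Proof.
elim/cclass_ind: x => u; apply/eqP/eqP => [u0|/cclass_eq0 u0].
  apply/cclass_eq0 => e e0; have := completion_normP u; rewrite u0.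
  move=> /(_ e e0)[n nP]; exists n => m /nP.
  by rewrite subr0 ger0_norm ?vnorm_ge0.
exact/completion_normE/seq_norm_null.
Qed.

Fact completion_norm1 : completion_norm 1 = 1.
Proof.
rewrite -(rmorph1 cclass); apply: completion_normE => e e0; exists 0%N => m _.
by rewrite rmorph1 -[X in vnorm X]/(1 : L) vnorm1 subrr normr0.
Qed.

Fact completion_normM : {morph completion_norm : x y / x * y}.
Proof.
elim/cclass_ind=> u; elim/cclass_ind=> v.
have /cauchyP/cauchy_dichotomy[u0|[c [n [c0 uc]]]] := valP u.
  by rewrite (cclass_eq0 u).2// mul0r (eqP (etrans (completion_norm_eq0 0) (eqxx 0))) mul0r.
have /cauchyP/cauchy_dichotomy[v0|[d [n' [d0 vd]]]] := valP v.
  by rewrite (cclass_eq0 v).2// mulr0 (eqP (etrans (completion_norm_eq0 0) (eqxx 0))) mulr0.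
have const w e n0 : (forall m, (n0 <= m)%N -> vnorm (w m) = e) -> seq_norm w e.
  by move=> we e' e'0; exists n0 => m /we->; rewrite subrr normr0.
rewrite (completion_normE (const _ _ _ uc)) (completion_normE (const _ _ _ vd)) -rmorphM.
apply: completion_normE; apply: (const _ _ (maxn n n')) => m; rewrite geq_max => /andP[nm n'm].
by rewrite rmorphM [LHS]vnormM uc// vd.
Qed.

Fact completion_normD x y :
  completion_norm (x + y) <= Num.max (completion_norm x) (completion_norm y).
Proof.
elim/cclass_ind: x => u; elim/cclass_ind: y => v; apply/ler_addgt0Pr => e e0.
have [n nP] := completion_normP u e0; have [n' nP'] := completion_normP v e0.
rewrite -rmorphD; apply: (@completion_norm_le _ _ (maxn n n')) => m.
rewrite geq_max => /andP[/nP + /nP'].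
rewrite !ltr_distl => /andP[_ um] /andP[_ vm]; rewrite rmorphD; apply: vnormD_le.
  by rewrite (le_trans (ltW um))// lerD2r le_max lexx.
by rewrite (le_trans (ltW vm))// lerD2r le_max lexx orbT.
Qed.

HB.instance Definition _ := Field_isRealValued.Build R completion completion_norm_ge0
  completion_norm_eq0 completion_norm1 completion_normM completion_normD.

Fact const_seq_cauchy (a : L) : (fun=> a) \in cauchy_pred.
Proof. by apply/cauchyP => e e0; exists 0%N => m m' _ _; rewrite subrr vnorm0. Qed.

Definition const_seq (a : L) : cauchy_seq := Sub (fun=> a) (const_seq_cauchy a).

Definition to_completion (a : L) : completion := cclass (const_seq a).

Fact to_completion_zmod_morphism : zmod_morphism to_completion.
Proof. by move=> a b; rewrite /to_completion -rmorphB; congr cclass; apply: val_inj. Qed.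
HB.instance Definition _ :=
  GRing.isZmodMorphism.Build L completion to_completion to_completion_zmod_morphism.

Fact to_completion_monoid_morphism : monoid_morphism to_completion.
Proof.
split=> [|a b]; rewrite /to_completion.
  by rewrite -(rmorph1 cclass); congr cclass; apply: val_inj.
by rewrite -rmorphM; congr cclass; apply: val_inj.
Qed.
HB.instance Definition _ :=
  GRing.isMonoidMorphism.Build L completion to_completion to_completion_monoid_morphism.

Lemma to_completion_isometric : isometric to_completion.
Proof.
by move=> a; apply: completion_normE => e e0; exists 0%N => m _; rewrite subrr normr0.
Qed.

Lemma to_completion_close (u : cauchy_seq) n t :
  (forall m, (n <= m)%N -> vnorm (val u m - val u n) <= t) ->
  vnorm (cclass u - to_completion (val u n)) <= t.
Proof.
by move=> ut; rewrite -rmorphB; apply: (@completion_norm_le _ _ n) => m /ut; rewrite rmorphB.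
Qed.

Lemma to_completion_dense (y : completion) (e : R) : 0 < e ->
  exists x : L, vnorm (y - to_completion x) < e.
Proof.
elim/cclass_ind: y => u e0; have e2 : 0 < e / 2 by lra.
have /cauchyP uC := valP u; have [n nP] := uC _ e2.
exists (val u n); apply: (@le_lt_trans _ _ (e / 2)); last by lra.
by apply: to_completion_close => m nm; apply/ltW/nP.
Qed.

(** Approximate the n-th term by a constant a n within 1 / (n + 1); the class of the sequence a is
    the limit. *)
Lemma completion_complete : vcomplete completion.
Proof.
move=> x xC; have /choice[a aP] : forall n, exists a, vnorm (x n - to_completion a) < n.+1%:R^-1.
  by move=> n; apply: to_completion_dense; rewrite invr_gt0.
have small (e : R) : 0 < e -> exists n0, forall n, (n0 <= n)%N -> n.+1%:R^-1 < e.
  move=> e0; exists (Num.bound e^-1) => n n0n.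
  rewrite invf_plt ?posrE// (lt_le_trans (archi_boundP _))// ?invr_ge0 ?(ltW e0)//.
  by rewrite ler_nat leqW.
have aC : a \in cauchy_pred.
  apply/cauchyP => e e0; have [n nP] := xC e e0; have [n' nP'] := small e e0.
  exists (maxn n n') => m m'; rewrite !geq_max => /andP[nm n'm] /andP[nm' n'm'].
  rewrite -to_completion_isometric rmorphB.
  have -> : to_completion (a m) - to_completion (a m') = (x m - x m') -
      ((x m - to_completion (a m)) - (x m' - to_completion (a m'))) by ring.
  apply: vnormB_lt; first exact: nP.
  by apply: vnormB_lt; rewrite (lt_trans (aP _))// nP'.
pose u : cauchy_seq := Sub a aC; exists (cclass u) => e e0.
have e2 : 0 < e / 2 by lra.
have /cauchyP/(_ _ e2)[n nP] := aC; have [n' nP'] := small _ e2.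
exists (maxn n n') => m; rewrite geq_max => /andP[nm n'm].
have -> : x m - cclass u = (x m - to_completion (a m)) - (cclass u - to_completion (val u m)).
  by rewrite (_ : val u m = a m)//; ring.
apply: (@le_lt_trans _ _ (e / 2)); last by lra.
apply: vnormB_le; first by rewrite ltW// (lt_trans (aP _))// nP'.
by apply: to_completion_close => m' mm'; apply/ltW/nP => //; exact: leq_trans mm'.
Qed.

End Completion.

(** * Polynomials over a subfield *)

Section PolynomialsOverSubfield.
Variables (L : fieldType) (D : set L) (Dsub : subfield D).
Implicit Types p q f : {poly L}.

Definition poly_over p := forall i, D p`_i.

Lemma poly_over0 : poly_over 0.
Proof. by move=> i; rewrite coef0; exact: subfield0. Qed.

Lemma poly_overC c : D c -> poly_over c%:P.
Proof. by move=> Dc i; rewrite coefC; case: eqP => // _; exact: subfield0. Qed.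

Lemma poly_overX : poly_over 'X.
Proof. by move=> i; rewrite coefX; exact: subfield_nat. Qed.

Lemma poly_overD p q : poly_over p -> poly_over q -> poly_over (p + q).
Proof. by move=> Dp Dq i; rewrite coefD; exact: subfieldD. Qed.

Lemma poly_overN p : poly_over p -> poly_over (- p).
Proof. by move=> Dp i; rewrite coefN; exact: subfieldN. Qed.

Lemma poly_overB p q : poly_over p -> poly_over q -> poly_over (p - q).
Proof. by move=> Dp Dq; apply: poly_overD => //; exact: poly_overN. Qed.

Lemma poly_overM p q : poly_over p -> poly_over q -> poly_over (p * q).
Proof.
move=> Dp Dq i; rewrite coefM; apply: subfield_sum => // j _.
exact: (subfieldM Dsub).
Qed.

Lemma poly_overX_exp p n : poly_over p -> poly_over (p ^+ n).
Proof.
move=> Dp; elim: n => [|n IH]; last by rewrite exprS; exact: poly_overM.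
by rewrite expr0; apply: poly_overC; exact: subfield1.
Qed.

Lemma poly_overXn n : poly_over 'X^n.
Proof. exact/poly_overX_exp/poly_overX. Qed.

Lemma poly_over_sum (I : Type) (r : seq I) (P : pred I) (F : I -> {poly L}) :
  (forall j, P j -> poly_over (F j)) -> poly_over (\sum_(j <- r | P j) F j).
Proof. by move=> DF; apply: (big_ind poly_over) => //; [exact: poly_over0|exact: poly_overD]. Qed.

Lemma poly_over_deriv p : poly_over p -> poly_over p^`().
Proof.
move=> Dp i; rewrite coef_deriv -mulr_natl; apply: (subfieldM Dsub) => //.
exact: subfield_nat.
Qed.

Lemma poly_over_comp p q : poly_over p -> poly_over q -> poly_over (p \Po q).
Proof.
move=> Dp Dq; rewrite comp_polyE; apply: poly_over_sum => i _.
by rewrite -mul_polyC; apply: poly_overM; [exact: poly_overC|exact: poly_overX_exp].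
Qed.

(** Long division divides only by the leading coefficient of p and therefore stays over D. *)
Lemma poly_over_divp f p : poly_over f -> poly_over p -> p != 0 ->
  exists a r, [/\ poly_over a, poly_over r, f = a * p + r & (size r < size p)%N].
Proof.
move=> + Dp p0; move: {2}(size f) (leqnn (size f)) => n; elim: n f => [|n IH] f fn Df.
  exists 0, f; split=> //; first exact: poly_over0.
    by rewrite mul0r add0r.
  by move: fn; rewrite leqn0 => /eqP->; rewrite lt0n size_poly_eq0.
have [fp|pf] := ltnP (size f) (size p).
  by exists 0, f; split=> //; [exact: poly_over0|rewrite mul0r add0r].
pose g := (lead_coef f / lead_coef p) *: 'X^(size f - size p).
have Dg : poly_over g.
  rewrite /g -mul_polyC; apply: poly_overM; last exact/poly_overX_exp/poly_overX.
  apply: poly_overC; apply: (subfieldM Dsub); first exact: Df.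
  by apply: (subfieldV Dsub); exact: Dp.
have p0' : (0 < size p)%N by rewrite lt0n size_poly_eq0.
have sfpos : (0 < size f)%N := leq_trans p0' pf.
have [||a [r [Da Dr fE rp]]] := IH (f - g * p).
- apply/leq_sizeP => j nj; rewrite coefB /g -scalerAl coefZ coefXnM.
  have [sfj|jsf] := leqP (size f) j.
    rewrite nth_default// ltnNge (leq_trans _ sfj) ?leq_subr//= (@nth_default _ _ p) ?mulr0 ?subr0//.
    by rewrite -(leq_add2r (size f - size p)%N) subnK ?(leq_trans (leq_subr _ _))// addnC subnK.
  have -> : j = (size f).-1.
    apply/eqP; rewrite eqn_leq -ltnS prednK// jsf /= -ltnS prednK// (leq_trans fn)//.
  rewrite (_ : ((size f).-1 < size f - size p)%N = false); last first.
    by apply/negbTE; rewrite -leqNgt -subn1 leq_sub2l.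
  rewrite (_ : ((size f).-1 - (size f - size p))%N = (size p).-1).
    by rewrite -!lead_coefE divfK ?lead_coef_eq0// subrr.
  by lia.
- exact/poly_overB/poly_overM.
- exists (g + a), r; split=> //; first exact: poly_overD.
  by rewrite mulrDl -addrA -fE addrCA subrr addr0.
Qed.

Definition algebraic_over c := exists2 p, poly_over p & p != 0 /\ root p c.

End PolynomialsOverSubfield.

(** * Newton's method and best centers *)

Section Newton.
Variables (R : realType) (L : realValuedFieldType R).
Implicit Types (u f : {poly L}) (x y h : L) (r : R).

Lemma vnorm_subX_le x y rho n : vnorm x <= rho -> vnorm y <= rho ->
  vnorm (x ^+ n.+1 - y ^+ n.+1) <= vnorm (x - y) * rho ^+ n.
Proof.
move=> xr yr; have rho0 := le_trans (vnorm_ge0 x) xr.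
rewrite subrXX vnormM ler_wpM2l ?vnorm_ge0//.
apply: vnorm_sum_le => [|j _]; first exact: exprn_ge0.
have jn : (j <= n)%N by rewrite -ltnS.
rewrite vnormM !vnormX -[in X in _ <= X](subnK jn) exprD.
by apply: ler_pM; rewrite ?exprn_ge0 ?vnorm_ge0// lerXn2r ?nnegrE ?vnorm_ge0.
Qed.

(** Newton's iteration with the slope frozen at u_1. On the ball of radius rho = vnorm u_0 / vnorm
    u_1 the hypothesis gives vnorm u_i * rho ^ (i - 1) <= vnorm u_1 * th ^ (i - 1) with th = rho / r
    < 1, so the iteration contracts this ball by th. *)
Lemma newton_root u r : vcomplete L ->
  (forall i, vnorm u`_i.+1 * r ^+ i.+1 <= vnorm u`_1 * r) ->
  vnorm u`_0 < vnorm u`_1 * r ->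
  exists h, u.[h] = 0 /\ vnorm u`_1 * vnorm h <= vnorm u`_0.
Proof.
move=> Lcomplete ur u01; have u1r := le_lt_trans (vnorm_ge0 _) u01.
have u1 : 0 < vnorm u`_1.
  by rewrite lt_def vnorm_ge0 andbT; apply/eqP => u1; move: u1r; rewrite u1 mul0r ltxx.
have r0 : 0 < r by move: u1r; rewrite pmulr_rgt0.
have u1N : u`_1 != 0 by rewrite -vnorm_gt0.
pose rho := vnorm u`_0 / vnorm u`_1; pose th := rho / r.
have rho0 : 0 <= rho by rewrite divr_ge0 ?vnorm_ge0.
have rhor : rho < r by rewrite ltr_pdivrMr// mulrC.
have th0 : 0 <= th by rewrite divr_ge0// ltW.
have th1 : th < 1 by rewrite ltr_pdivrMr// mul1r.
pose g x := x - u.[x] / u`_1.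
have gcontract x y : vnorm x <= rho -> vnorm y <= rho ->
    vnorm (g x - g y) <= th * vnorm (x - y).
  move=> xr yr; have -> : g x - g y = - ((u.[x] - u.[y] - u`_1 * (x - y)) / u`_1).
    by rewrite /g; field.
  rewrite vnormN vnormM vnormV ler_pdivrMr//.
  have u1size : (1 < size u)%N.
    by rewrite ltnNge; apply/negP => su; move: u1N; rewrite nth_default// eqxx.
  rewrite !horner_coef -sumrB; under eq_bigr do rewrite -mulrBr.
  rewrite (bigD1 (Ordinal u1size))//= !expr1 addrAC subrr add0r.
  have bound0 : 0 <= th * vnorm (x - y) * vnorm u`_1.
    by rewrite mulr_ge0 ?vnorm_ge0// mulr_ge0 ?vnorm_ge0.
  apply: vnorm_sum_le => // -[[|[|i]] isz] //= _.
    by rewrite !expr0 subrr mulr0 vnorm0.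
  rewrite vnormM (le_trans (ler_wpM2l (vnorm_ge0 _) (vnorm_subX_le _ xr yr)))//.
  rewrite mulrCA mulrAC mulrC ler_wpM2r ?vnorm_ge0//.
  have thr : rho = th * r by rewrite /th divfK// gt_eqF.
  rewrite (@le_trans _ _ (vnorm u`_i.+2 * (th * r ^+ i.+1)))//.
    rewrite ler_wpM2l ?vnorm_ge0// thr exprMn [X in X * _]exprS -mulrA ler_wpM2l//.
    by rewrite ler_piMl ?exprn_ge0 ?(ltW r0)// exprn_ile1// ltW.
  rewrite mulrCA ler_wpM2l//.
  by have := ur i.+1; rewrite exprSr mulrA ler_pM2r.
have g0 : vnorm (g 0) = rho.
  by rewrite /g sub0r vnormN vnormM vnormV horner_coef0.
have gmap x : vnorm x <= rho -> vnorm (g x) <= rho.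
  move=> xr; rewrite -(subrK (g 0) (g x)); apply: vnormD_le; last by rewrite g0.
  rewrite (le_trans (gcontract _ _ xr _)) ?vnorm0// subr0.
  by rewrite (le_trans _ xr)// ler_piMl ?vnorm_ge0// ltW.
pose xs n := iter n g 0.
have xsr n : vnorm (xs n) <= rho.
  by elim: n => [|n IH]; [rewrite vnorm0|exact: gmap].
have xsS n : vnorm (xs n.+1 - xs n) <= th ^+ n * rho.
  elim: n => [|n IH]; first by rewrite expr0 mul1r subr0 g0.
  apply: (le_trans (gcontract (xs n.+1) (xs n) (xsr _) (xsr _))).
  by rewrite exprS -mulrA ler_wpM2l.
have xsD n m : vnorm (xs (n + m)%N - xs n) <= th ^+ n * rho.
  elim: m => [|m IH]; first by rewrite addn0 subrr vnorm0 mulr_ge0 ?exprn_ge0.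
  rewrite -(subrK (xs (n + m)%N) (xs (n + m.+1)%N)) -addrA; apply: vnormD_le => //.
  rewrite addnS (le_trans (xsS _))// exprD ler_wpM2r// ler_piMr ?exprn_ge0//.
  by rewrite exprn_ile1// ltW.
have small e : 0 < e -> exists n, th ^+ n * rho < e.
  move=> e0; have rho1 : 0 < rho + 1 by lra.
  have [n nP] := exists_expr_lt th0 th1 (divr_gt0 e0 rho1).
  exists n; rewrite (le_lt_trans (y := th ^+ n * (rho + 1)))//.
    by rewrite ler_wpM2l ?exprn_ge0// lerDl.
  by rewrite -ltr_pdivlMr.
have [|h hP] := Lcomplete xs.
  move=> e e0; have [n nP] := small e e0; exists n => m m' nm nm'.
  have -> : xs m - xs m' = (xs m - xs n) - (xs m' - xs n) by ring.
  by apply: vnormB_lt; apply: le_lt_trans nP;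
    [rewrite -(subnKC nm)|rewrite -(subnKC nm')]; exact: xsD.
have hr : vnorm h <= rho.
  rewrite leNgt; apply/negP => rh; have h0 : 0 < vnorm h by rewrite (le_lt_trans rho0).
  have [n /(_ n (leqnn n))] := hP (vnorm h) h0.
  rewrite vnorm_distC => /(seminorm_close (vnorm_semi L)) xh.
  by have := xsr n; rewrite xh leNgt rh.
have gh : g h = h.
  apply/eqP; rewrite -subr_eq0 -vnorm_eq0 eq_le vnorm_ge0 andbT leNgt; apply/negP => e0.
  have [n nP] := hP _ e0.
  have gx : vnorm (g h - xs n.+1) < vnorm (g h - h).
    apply: (le_lt_trans (gcontract _ _ hr (xsr n))).
    rewrite (le_lt_trans (y := vnorm (h - xs n)))//.
      by rewrite ler_piMl ?vnorm_ge0// ltW.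
    by rewrite vnorm_distC; exact: nP.
  by have := vnormD_lt gx (nP _ (leqnSn n)); rewrite addrA subrK ltxx.
exists h; split; last by rewrite mulrC -ler_pdivlMr.
move/eqP: gh; rewrite /g -subr_eq0 addrAC subrr add0r oppr_eq0 mulf_eq0 invr_eq0.
by rewrite (negbTE u1N) orbF => /eqP.
Qed.

(** Moving the center inside the disc of radius r does not change the disc, so it cannot raise the
    Gauss norm; it is enough to check this on powers of X. *)
Lemma coef_comp_shift_le u h r M : vnorm h <= r -> 0 <= M ->
  (forall i, vnorm u`_i * r ^+ i <= M) ->
  forall k, vnorm (u \Po ('X + h%:P))`_k * r ^+ k <= M.
Proof.
move=> hr M0 uM k; have r0 := le_trans (vnorm_ge0 _) hr.
have powle i j : vnorm (('X + h%:P) ^+ i)`_j * r ^+ j <= r ^+ i.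
  elim: i j => [|i IH] j.
    rewrite expr0 coef1; case: j => [|j] /=; first by rewrite vnorm1 mul1r.
    by rewrite vnorm0 mul0r ler01.
  rewrite exprS mulrDl coefD coefXM coefCM exprS.
  have hle : vnorm (h * (('X + h%:P) ^+ i)`_j) * r ^+ j <= r * r ^+ i.
    by rewrite vnormM -mulrA ler_pM ?mulr_ge0 ?exprn_ge0 ?vnorm_ge0.
  case: j hle => [|j] hle; first by rewrite add0r.
  rewrite /= (le_trans (ler_wpM2r (exprn_ge0 _ r0) (vnormD _ _)))//.
  rewrite maxr_pMl ?exprn_ge0// ge_max hle andbT exprS mulrCA.
  by rewrite ler_wpM2l.
rewrite comp_polyE coef_sum.
have rk0 : 0 <= r ^+ k by rewrite exprn_ge0.
have [rkE|rkN] := eqVneq (r ^+ k) 0; first by rewrite rkE mulr0.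
have rkpos : 0 < r ^+ k by rewrite lt_def rkN.
rewrite -ler_pdivlMr//; apply: vnorm_sum_le => [|i _]; first by rewrite divr_ge0.
rewrite coefZ vnormM ler_pdivlMr// -mulrA (le_trans _ (uM i))//.
by rewrite ler_wpM2l ?vnorm_ge0.
Qed.

Section BestCenter.
Variables (D : set L) (Dsub : subfield D).
Hypothesis Lcomplete : vcomplete L.
Hypothesis nat1 : forall n, (0 < n)%N -> vnorm (n%:R : L) = 1.
Hypothesis Dalg : forall c, algebraic_over D c -> D c.

(* By induction on the degree, the derivative of f has a center c. If c is not
   a center for f, then b is close to a root of f, which is itself a center. *)
Lemma best_center b f : poly_over D f -> f != 0 ->
  exists c, D c /\ forall i,
    vnorm (f \Po ('X + b%:P))`_i * vnorm (b - c) ^+ i <= vnorm f.[b].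
Proof.
move: {2}(size f) (leqnn (size f)) => n; elim: n f => [|n IH] f fn Df f0.
  by move: fn; rewrite leqn0 size_poly_eq0 (negbTE f0).
have f0E : (f \Po ('X + b%:P))`_0 = f.[b].
  by rewrite -horner_coef0 horner_comp hornerD hornerX hornerC add0r.
have [fsz|fsz] := leqP (size f) 1.
  exists 0; split=> [|i]; first exact: subfield0.
  rewrite (size1_polyC fsz) comp_polyC hornerC coefC.
  by case: i => [|i]; rewrite ?expr0 ?mulr1// vnorm0 mul0r vnorm_ge0.
have f'0 : f^`() != 0.
  apply/eqP => /(congr1 (fun p : {poly L} => p`_(size f).-2)).
  rewrite coef0 coef_deriv => /(congr1 (@vnorm R L)).
  rewrite -mulr_natr vnormM nat1// vnorm0 mulr1 prednK; last by case: (size f) fsz => [|[]].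
  by move/eqP; rewrite vnorm_eq0 -lead_coefE lead_coef_eq0 (negbTE f0).
have f'n : (size f^`() <= n)%N by rewrite -ltnS (leq_trans (lt_size_deriv f0)).
have [c [Dc cP]] := IH _ f'n (poly_over_deriv Dsub Df) f'0.
set u := f \Po ('X + b%:P) in f0E *.
have uE : f^`() \Po ('X + b%:P) = u^`().
  by rewrite /u deriv_comp derivD derivX derivC addr0 mulr1.
have f'bE : f^`().[b] = u`_1.
  have := congr1 (fun p : {poly L} => p.[0]) uE.
  by rewrite horner_comp hornerD hornerX hornerC add0r horner_coef0 coef_deriv mulr1n.
(* Differentiation multiplies the coefficient of index i + 1 by i + 1, of norm 1, so the center of
   f' controls every coefficient of u but the constant one. *)
have {}cP i : vnorm u`_i.+1 * vnorm (b - c) ^+ i <= vnorm u`_1.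
  by have := cP i; rewrite uE f'bE coef_deriv -mulr_natr vnormM nat1// mulr1.
rewrite -f0E; have [u01|u01] := leP (vnorm u`_1 * vnorm (b - c)) (vnorm u`_0).
  exists c; split=> // -[|i]; first by rewrite expr0 mulr1.
  by rewrite exprSr mulrA (le_trans _ u01)// ler_wpM2r ?vnorm_ge0.
have [|h [uh hle]] := newton_root Lcomplete _ u01.
  by move=> i; rewrite exprSr mulrA ler_wpM2r ?vnorm_ge0.
have u1pos : 0 < vnorm u`_1.
  rewrite lt_def vnorm_ge0 andbT; apply/eqP => u1.
  by move: u01; rewrite u1 mul0r ltNge vnorm_ge0.
have hr : vnorm h <= vnorm (b - c).
  by rewrite -(ler_pM2l u1pos) (le_trans hle)// ltW.
exists (b + h); split.
  apply: Dalg; exists f => //; split=> //.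
  by move: uh; rewrite /u horner_comp hornerD hornerX hornerC addrC => /eqP.
have -> : vnorm (b - (b + h)) = vnorm h by rewrite opprD addNKr vnormN.
case=> [|i]; first by rewrite expr0 mulr1.
rewrite exprSr mulrA (le_trans _ hle)// ler_wpM2r ?vnorm_ge0//.
by rewrite (le_trans _ (cP i))// ler_wpM2l ?vnorm_ge0// lerXn2r ?nnegrE ?vnorm_ge0.
Qed.

End BestCenter.
End Newton.

(** * Gauss norms and the trace *)

(** The constant C disappears on taking m-th roots. *)
Lemma le_of_power_le (R : realType) (a b C : R) : 0 <= b ->
  (forall m, a ^+ m <= C * b ^+ m) -> a <= b.
Proof.
move=> b0 ab; rewrite leNgt; apply/negP => ba; have a0 : 0 < a := le_lt_trans b0 ba.
have C0 : 0 < C by have := ab 0; rewrite !expr0 mulr1; apply: lt_le_trans.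
have [||m mP] := @exists_expr_lt R (b / a) C^-1 (divr_ge0 b0 (ltW a0)).
- by rewrite ltr_pdivrMr// mul1r.
- by rewrite invr_gt0.
have := ab m; rewrite leNgt => /negP; apply.
by move: mP; rewrite expr_div_n ltr_pdivrMr ?exprn_gt0// ltr_pdivlMl// mulrC.
Qed.

Section Gauss.
Variables (R : realType) (B : comNzRingType) (N : B -> R) (Nsemi : ring_seminorm N).
Variables (s : R) (s0 : 0 < s).
Implicit Types (f g : {poly B}) (c d : B) (M : R).

(** A bound for the Gauss norm of radius s; stating bounds avoids forming the maximum over the
    coefficients. *)
Definition gauss_le f M := forall j, N f`_j * s ^+ j <= M.

Let N0 := seminorm_ge0 Nsemi.
Let sX0 j : 0 <= s ^+ j. Proof. by rewrite exprn_ge0// ltW. Qed.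

Lemma gauss_le0 : gauss_le 0 0.
Proof. by move=> j; rewrite coef0 (seminorm0 Nsemi) mul0r. Qed.

Lemma gauss_leD f g M : gauss_le f M -> gauss_le g M -> gauss_le (f + g) M.
Proof.
move=> fM gM j; rewrite coefD -ler_pdivlMr ?exprn_gt0//.
by apply: (seminormD_le Nsemi); rewrite ler_pdivlMr ?exprn_gt0.
Qed.

Lemma gauss_le_sum (I : Type) (r : seq I) (P : pred I) (F : I -> {poly B}) M :
  0 <= M -> (forall i, P i -> gauss_le (F i) M) -> gauss_le (\sum_(i <- r | P i) F i) M.
Proof.
move=> M0 FM; apply: (big_ind (gauss_le^~ M)) => //; last first.
  by move=> f g; exact: gauss_leD.
by move=> j; exact: le_trans (gauss_le0 j) M0.
Qed.

Lemma gauss_le_ge0 f M : gauss_le f M -> 0 <= M.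
Proof. by move=> /(_ 0%N); apply: le_trans; rewrite expr0 mulr1. Qed.

Lemma gauss_leM f g M M' : gauss_le f M -> gauss_le g M' -> gauss_le (f * g) (M * M').
Proof.
move=> fM gM' j; have M0 := gauss_le_ge0 fM; have M'0 := gauss_le_ge0 gM'.
rewrite coefM -ler_pdivlMr ?exprn_gt0//; apply: (seminorm_sum_le Nsemi).
  by rewrite divr_ge0// mulr_ge0.
move=> i _ _; rewrite ler_pdivlMr ?exprn_gt0//.
have ij : (i <= j)%N by rewrite -ltnS.
have -> : s ^+ j = s ^+ i * s ^+ (j - i) by rewrite -exprD subnKC.
rewrite (le_trans (ler_wpM2r _ (seminormM Nsemi _ _))) ?mulr_ge0//.
by rewrite mulrACA ler_pM ?mulr_ge0.
Qed.

Lemma gauss_leC c M : N c <= M -> gauss_le c%:P M.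
Proof.
move=> cM j; have M0 := le_trans (N0 c) cM.
by rewrite coefC; case: j => [|j]; rewrite ?expr0 ?mulr1//= (seminorm0 Nsemi) mul0r.
Qed.

Lemma gauss_leXn n : N 1 <= 1 -> gauss_le 'X^n (s ^+ n).
Proof.
move=> N1 j; rewrite coefXn; case: eqP => [->|_]; last by rewrite (seminorm0 Nsemi) mul0r.
by rewrite ler_piMl.
Qed.

(* The index i is the first one where the Gauss norm M of f is reached, and the
   coefficient there is c up to smaller terms. *)
Definition dominant f i c M :=
  [/\ forall j, (j < i)%N -> N f`_j * s ^+ j < M, gauss_le f M & N (f`_i - c) * s ^+ i < M].

Lemma dominant_gt0 f i c M : dominant f i c M -> 0 < M.
Proof. by move=> [_ _]; apply: le_lt_trans; rewrite mulr_ge0. Qed.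

(** As in Gauss's lemma: in the coefficient of index i + j, every product except that of the i-th
    and j-th coefficients involves an index below i or below j, hence is strictly smaller than M *
    M'. As N is not multiplicative, c * d itself may be smaller too. *)
Lemma dominantM f g i j c d M M' :
  dominant f i c M -> dominant g j d M' -> dominant (f * g) (i + j) (c * d) (M * M').
Proof.
move=> df dg; have M0 := dominant_gt0 df; have M'0 := dominant_gt0 dg.
have [fi fM fc] := df; have [gj gM gd] := dg.
have term a b : (a < i)%N || (b < j)%N -> N (f`_a * g`_b) * s ^+ (a + b) < M * M'.
  move=> ab; rewrite exprD (le_lt_trans (ler_wpM2r _ (seminormM Nsemi _ _))) ?mulr_ge0//.
  rewrite mulrACA; case/orP: ab => [/fi ai|/gj bj].
    rewrite (le_lt_trans (ler_wpM2l _ (gM b))) ?mulr_ge0// ltr_pM2r//.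
  by rewrite (le_lt_trans (ler_wpM2r _ (fM a))) ?mulr_ge0// ltr_pM2l.
split; last 1 first.
- rewrite coefM (bigD1 (inord i : 'I_(i + j).+1))//= inordK ?ltnS ?leq_addr// addKn.
  rewrite addrAC -ltr_pdivlMr ?exprn_gt0//; apply: (seminormD_lt Nsemi); last first.
    apply: (seminorm_sum_lt Nsemi); first by rewrite divr_gt0 ?mulr_gt0 ?exprn_gt0.
    move=> h _ hi; rewrite ltr_pdivlMr ?exprn_gt0//.
    have hij : (h <= i + j)%N by rewrite -ltnS.
    have -> : s ^+ (i + j) = s ^+ (h + (i + j - h)) by rewrite subnKC.
    apply: term.
    have : (h : nat) != i.
      by apply: contra hi => /eqP hi; apply/eqP/val_inj; rewrite /= inordK ?ltnS ?leq_addr.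
    by rewrite neq_ltn; lia.
  have -> : f`_i * g`_j - c * d = f`_i * (g`_j - d) + (f`_i - c) * d by ring.
  have dM' : N d * s ^+ j <= M'.
    rewrite -ler_pdivlMr ?exprn_gt0// -(subKr g`_j d); apply: (seminormB_le Nsemi).
      by rewrite ler_pdivlMr ?exprn_gt0.
    by rewrite ler_pdivlMr ?exprn_gt0// ltW.
  apply: (seminormD_lt Nsemi); rewrite ltr_pdivlMr ?exprn_gt0// exprD;
    rewrite (le_lt_trans (ler_wpM2r _ (seminormM Nsemi _ _))) ?mulr_ge0// mulrACA.
    by rewrite (le_lt_trans (ler_wpM2r _ (fM i))) ?mulr_ge0// ltr_pM2l.
  by rewrite (le_lt_trans (ler_wpM2l _ dM')) ?mulr_ge0// ltr_pM2r.
- move=> h hij; rewrite coefM -ltr_pdivlMr ?exprn_gt0//; apply: (seminorm_sum_lt Nsemi).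
    by rewrite divr_gt0 ?mulr_gt0 ?exprn_gt0.
  move=> a _ _; rewrite ltr_pdivlMr ?exprn_gt0//.
  have ah : (a <= h)%N by rewrite -ltnS.
  have -> : s ^+ h = s ^+ (a + (h - a)) by rewrite subnKC.
  by apply: term; lia.
- exact: gauss_leM.
Qed.

Lemma dominantX f i c M n : N 1 = 1 -> dominant f i c M ->
  dominant (f ^+ n) (n * i) (c ^+ n) (M ^+ n).
Proof.
move=> N1 fi; elim: n => [|n IH]; last by rewrite !exprS mulSn; exact: dominantM.
rewrite !expr0 mul0n; split=> //; last by rewrite coef1 subrr (seminorm0 Nsemi) mul0r ltr01.
by rewrite -[1]polyC1; apply: gauss_leC; rewrite N1.
Qed.

(** For products N c may drop, but for powers power-multiplicativity supplies the condition on c,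
    and the smaller terms cannot change the norm. *)
Lemma dominant_coef f i c M : dominant f i c M -> N c * s ^+ i = M -> N f`_i * s ^+ i = M.
Proof.
move=> [_ _ fc] cM; suff -> : N f`_i = N c by [].
by apply: (seminorm_close Nsemi); rewrite -(ltr_pM2r (exprn_gt0 i s0)) -(seminormN Nsemi) opprB cM.
Qed.

Lemma exists_dominant f j0 : 0 < N f`_j0 ->
  exists i M, [/\ dominant f i f`_i M & N f`_i * s ^+ i = M].
Proof.
move=> fj0; have j0f : (j0 < size f)%N.
  rewrite ltnNge; apply/negP => fj; move: fj0.
  by rewrite nth_default// (seminorm0 Nsemi) ltxx.
have [j1 _ j1max] := arg_maxP (fun j : 'I_(size f) => N f`_j * s ^+ j)
  (i0 := Ordinal j0f) (P := predT) isT.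
set M := N f`_j1 * s ^+ j1 in j1max.
have fM : gauss_le f M.
  move=> j; have [jf|fj] := ltnP j (size f); first exact: (j1max (Ordinal jf)).
  by rewrite nth_default// (seminorm0 Nsemi) mul0r mulr_ge0.
have M0 : 0 < M by rewrite (lt_le_trans _ (fM j0))// mulr_gt0// exprn_gt0.
have ex : exists j, N f`_j * s ^+ j == M by exists j1.
case: (ex_minnP ex) => i /eqP iM imin; exists i, M; split=> //; split=> //.
  by move=> j ji; rewrite lt_def fM andbT eq_sym; apply/negP => /imin; rewrite leqNgt ji.
by rewrite subrr (seminorm0 Nsemi) mul0r.
Qed.

End Gauss.

Section TraceBound.
Variables (R : realType) (B : comNzRingType) (N : B -> R).
Hypotheses (Nsemi : ring_seminorm N) (N1 : N 1 = 1).
Variable S : set B.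
Hypotheses (S1 : S 1) (SB : forall x y, S x -> S y -> S (x - y))
  (SM : forall x y, S x -> S y -> S (x * y)).
Hypothesis Spow : forall x n, S x -> N (x ^+ n) = N x ^+ n.

Let S0 : S 0. Proof. by rewrite -(subrr 1); exact: SB. Qed.
Let SN x : S x -> S (- x). Proof. by move=> Sx; rewrite -sub0r; exact: SB. Qed.
Let SD x y : S x -> S y -> S (x + y).
Proof. by move=> Sx Sy; rewrite -(opprK y); apply/SB => //; exact: SN. Qed.

Let Spoly (f : {poly B}) := forall i, S f`_i.

Let SpolyD f g : Spoly f -> Spoly g -> Spoly (f + g).
Proof. by move=> Sf Sg i; rewrite coefD; exact: SD. Qed.

Let SpolyC c : S c -> Spoly c%:P.
Proof. by move=> Sc i; rewrite coefC; case: eqP. Qed.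

Let SpolyM f g : Spoly f -> Spoly g -> Spoly (f * g).
Proof.
by move=> Sf Sg i; rewrite coefM; apply: (big_ind S) => // j _; exact: SM.
Qed.

Lemma char_poly_coef_in n (Y : 'M[B]_n) : (forall i j, S (Y i j)) ->
  forall i, S (char_poly Y)`_i.
Proof.
move=> SY; rewrite /char_poly /determinant.
have SpolyS (b : bool) : Spoly ((-1) ^+ b).
  case: b; last by rewrite expr0 -polyC1; exact: SpolyC.
  by rewrite expr1 -polyC1 -polyCN; apply/SpolyC/SN.
apply: (big_ind Spoly) => [i||sg _]; [by rewrite coef0|exact: SpolyD|].
apply: SpolyM; first exact: SpolyS.
apply: (big_ind Spoly) => [||i _]; [by rewrite -polyC1; exact: SpolyC|exact: SpolyM|].
rewrite !mxE; apply: SpolyD.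
  by move=> j; rewrite coefMn coefX; case: eqP; case: eqP; rewrite ?mulr1n ?mulr0n ?mul0rn.
by move=> j; rewrite coefN coefC; case: eqP; rewrite ?oppr0// => _; exact: SN.
Qed.

(* The Gauss norm of det(X - Y) ^ m = det((X - Y) ^ m) grows at most like
   s ^ (m n), and it is power-multiplicative. *)
Lemma trace_le n (Y : 'M[B]_n.+1) (K s : R) : 0 < s -> (forall i j, S (Y i j)) ->
  (forall m i j, N ((Y ^+ m) i j) <= K * s ^+ m) -> N (\tr Y) <= s.
Proof.
move=> s0 SY YK; pose f := char_poly Y; pose X : 'M[{poly B}]_n.+1 := char_poly_mx Y.
have K0 : 0 <= K.
  by have := YK 0%N ord0 ord0; rewrite expr0 mxE eqxx mulr1n N1 mulr1; apply: le_trans.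
have sX0 j : 0 <= s ^+ j by rewrite exprn_ge0// ltW.
pose Z : 'M[{poly B}]_n.+1 := 'X%:M.
have ZX a : Z ^+ a = ('X^a)%:M.
  elim: a => [|a IH]; first by rewrite !expr0.
  by rewrite !exprS IH [RHS]scalar_mxM.
have mapX (W : 'M[B]_n.+1) a : map_mx polyC W ^+ a = map_mx polyC (W ^+ a).
  elim: a => [|a IH]; first by rewrite !expr0 map_mx1.
  by rewrite !exprS IH [RHS]map_mxM.
(* The scalar matrix Z commutes with Y, so the binomial formula applies, and its h-th term is
   bounded by s ^+ (m - h) * (K * s ^+ h). *)
have XK m i j : gauss_le N s ((X ^+ m) i j) (K * s ^+ m).
  have -> : X = Z + map_mx polyC (- Y) by rewrite /X /char_poly_mx map_mxN.
  rewrite exprDn_comm; last exact/commr_sym/scalar_mxC.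
  rewrite summxE; apply: (gauss_le_sum Nsemi s0) => [|h _]; first by rewrite mulr_ge0.
  have hm : (h <= m)%N by rewrite -ltnS.
  rewrite ZX mapX.
  rewrite mulmxnE -[_ * _]/(_ *m _) mul_scalar_mx !mxE => l.
  rewrite coefMn (le_trans (ler_wpM2r _ (seminorm_natmul_le Nsemi _ _)))//.
  have -> : K * s ^+ m = s ^+ (m - h) * (K * s ^+ h).
    by rewrite mulrCA -exprD subnK.
  apply: (gauss_leM Nsemi s0); first by apply: gauss_leXn; rewrite ?N1.
  apply: (gauss_leC Nsemi); rewrite exprNn -signr_odd mulr_sign.
  by case: odd; rewrite ?mxE ?(seminormN Nsemi) YK.
have fK m : gauss_le N s (f ^+ m) (K ^+ n.+1 * (s ^+ n.+1) ^+ m).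
  have -> : f ^+ m = \det (X ^+ m).
    elim: m => [|m IH]; first by rewrite !expr0 det1.
    by rewrite !exprS IH -det_mulmx.
  have -> : K ^+ n.+1 * (s ^+ n.+1) ^+ m = (K * s ^+ m) ^+ n.+1.
    by rewrite exprMn exprAC.
  have Ks : 0 <= K * s ^+ m by rewrite mulr_ge0.
  apply: (gauss_le_sum Nsemi s0) => [|sg _]; first exact: exprn_ge0.
  rewrite -[(K * s ^+ m) ^+ _]mul1r; apply: (gauss_leM Nsemi s0).
    rewrite -polyC1 -polyCN -polyC_exp; apply: (gauss_leC Nsemi).
    have Nsign (b : bool) : N ((-1) ^+ b) <= 1.
      by case: b; rewrite ?expr1 ?expr0 ?(seminormN Nsemi) N1.
    exact: Nsign.
  have -> : (K * s ^+ m) ^+ n.+1 = \prod_(h < n.+1) (K * s ^+ m).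
    by rewrite prodr_const card_ord.
  apply: (big_ind2 (fun g M => gauss_le N s g M)) => //.
    by rewrite -polyC1; apply: (gauss_leC Nsemi); rewrite N1.
  by move=> g1 M1 g2 M2; exact: gauss_leM.
(* The leading coefficient 1 ensures that the Gauss norm is positive. *)
have fn : f`_n.+1 = 1.
  by have := char_poly_monic Y; rewrite monicE lead_coefE size_char_poly => /eqP.
have [|i [M [dom iM]]] := exists_dominant Nsemi s0 (f := f) (j0 := n.+1).
  by rewrite fn N1 ltr01.
have Ms : M <= s ^+ n.+1.
  apply: (@le_of_power_le _ _ _ (K ^+ n.+1)) => // m.
  have domX := dominantX Nsemi s0 m N1 dom.
  have Sfi : S f`_i := char_poly_coef_in SY i.
  have pM : N (f`_i ^+ m) * s ^+ (m * i) = M ^+ m.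
    by rewrite (Spow _ Sfi) mulnC exprM -exprMn iM.
  by rewrite -(dominant_coef Nsemi s0 domX pM); exact: fK.
(* The trace is, up to sign, the coefficient of index n, so N (\tr Y) * s ^+ n <= M <= s ^+ n.+1. *)
have [_ fM _] := dom; have := fM n; rewrite char_poly_trace// (seminormN Nsemi) => trM.
by rewrite -(ler_pM2r (exprn_gt0 n s0)) -exprS (le_trans trM).
Qed.

End TraceBound.

(** * Algebraic extensions *)

(** Divide m by n with remainder. Each full block of n factors gains al ^+ n over N x ^+ n, and K =
    al ^- n absorbs the remainder. *)
Lemma exponential_gap (R : realType) (B : comPzRingType) (N : B -> R) x n :
  ring_seminorm N -> N 1 = 1 -> N (x ^+ n) < N x ^+ n ->
  exists s K, [/\ 0 < s, s < N x & forall m, N (x ^+ m) <= K * s ^+ m].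
Proof.
move=> Nsemi N1 xn; have N0 := seminorm_ge0 Nsemi.
have n0 : (0 < n)%N by case: n xn => //; rewrite !expr0 N1 ltxx.
have u0 : 0 < N x.
  rewrite lt_def N0 andbT; apply/eqP => u0; move: xn.
  by rewrite u0 expr0n gtn_eqF// ltNge N0.
have [|al [al0 al1 aln]] := exists_power_gt (rho := N (x ^+ n) / N x ^+ n) n.
  by rewrite ltr_pdivrMr ?exprn_gt0// mul1r.
have s0 : 0 < al * N x by rewrite mulr_gt0.
exists (al * N x), ((al^-1) ^+ n); split=> //; first by rewrite gtr_pMl.
move=> m; rewrite {1}(divn_eq m n) exprD mulnC exprM.
rewrite (le_trans (seminormM Nsemi _ _))//.
have -> : (al * N x) ^+ m = (al * N x) ^+ n ^+ (m %/ n) * (al * N x) ^+ (m %% n).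
  by rewrite -exprM -exprD mulnC -divn_eq.
rewrite mulrCA; apply: ler_pM => //.
  rewrite (le_trans (seminormX_le Nsemi _ _ _)) ?N1// lerXn2r ?nnegrE ?exprn_ge0 ?(ltW s0)//.
  by rewrite exprMn -ler_pdivrMr ?exprn_gt0// ltW.
rewrite (le_trans (seminormX_le Nsemi _ _ _)) ?N1// exprMn mulrA ler_peMl ?exprn_ge0//.
have rn : (m %% n <= n)%N by rewrite ltnW// ltn_mod.
move: (m %% n)%N rn => r rn; rewrite -(subnK rn) exprD -mulrA -exprMn mulVf ?gt_eqF//.
by rewrite expr1n mulr1 exprn_ege1// invf_ge1 ?ltW.
Qed.

Section SimpleExtension.
Variables (R : realType) (L : realValuedFieldType R).
Variables (D : set L) (Dsub : subfield D) (c : L).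
Implicit Types p q : {poly L}.

Definition simple_extension : set L := [set v | exists2 p, poly_over D p & v = p.[c]].
Local Notation E := simple_extension.

Definition closed_under_limits (W : set L) :=
  forall u, (forall n, W (u n)) -> vcauchy u -> exists x, W x /\ vcvg u x.

Variable d : nat.
Hypothesis red : forall p, poly_over D p ->
  exists q, [/\ poly_over D q, (size q <= d)%N & p.[c] = q.[c]].
Hypothesis free : forall p, poly_over D p -> (size p <= d)%N -> p.[c] = 0 -> p = 0.

(** By freeness c ^+ j is not a value of a polynomial of size at most d with zero j-th coefficient,
    so it can be separated from these values. For transcendental c, any d will do. *)
Lemma simple_extension_coord j : (j < d)%N -> exists f, functional D f /\
  forall p, poly_over D p -> (size p <= d)%N -> f p.[c] = p`_j.
Proof.
move=> jd; pose W := [set v | exists p, [/\ poly_over D p, (size p <= d)%N, p`_j = 0 & v = p.[c]]].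
have Wsub : lsubspace D W.
  split=> [|_ _ [p [Dp pd pj ->]] [q [Dq qd qj ->]]|b _ Db [p [Dp pd pj ->]]].
  - by exists 0; split; rewrite ?size_poly0 ?coef0 ?horner0//; exact: poly_over0.
  - exists (p + q); split; rewrite ?hornerD ?coefD ?pj ?qj ?addr0//; first exact: poly_overD.
    by rewrite (leq_trans (size_polyD _ _))// geq_max pd.
  - exists (b%:P * p); split; rewrite ?hornerM ?hornerC ?coefCM ?pj ?mulr0//.
      by apply: (poly_overM Dsub) => //; exact: poly_overC.
    by rewrite mul_polyC (leq_trans (size_scale_leq _ _)).
have DXj : poly_over D 'X^j by exact: poly_overXn.
have Xjd : (size ('X^j : {poly L}) <= d)%N by rewrite size_polyXn.
have Wc : ~ W (c ^+ j).
  move=> [p [Dp pd pj cp]]; have : 'X^j - p = 0.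
    apply: free; [exact: poly_overB| |by rewrite hornerD hornerN hornerXn cp subrr].
    by rewrite (leq_trans (size_polyD _ _))// geq_max size_polyN pd Xjd.
  move=> /(congr1 (fun q : {poly L} => q`_j)); rewrite coefB coefXn eqxx pj subr0 coef0.
  by move/eqP; rewrite oner_eq0.
have [f [ffun f0 f1]] := separating_functional Dsub Wsub Wc.
exists f; split=> // p Dp pd.
have -> : p.[c] = (p - (p`_j)%:P * 'X^j).[c] + p`_j * c ^+ j.
  by rewrite !hornerE subrK.
rewrite (functionalD ffun) (functionalZ ffun)// f1 mulr1 f0 ?add0r//.
exists (p - (p`_j)%:P * 'X^j); split=> //.
- by apply: (poly_overB Dsub) => //; apply: (poly_overM Dsub) => //; exact: poly_overC.
- rewrite (leq_trans (size_polyD _ _))// geq_max pd size_polyN mul_polyC.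
  by rewrite (leq_trans (size_scale_leq _ _)).
- by rewrite coefB coefCM coefXn eqxx mulr1 subrr.
Qed.

(** Coordinates are continuous on finite-dimensional spaces over a complete field: by induction the
    span of the lower powers of c is complete, so c ^+ n has positive distance from it. *)
Lemma simple_extension_bounded : closed_under_limits D ->
  exists C, 0 <= C /\ forall p j, poly_over D p -> (size p <= d)%N ->
    vnorm p`_j <= C * vnorm p.[c].
Proof.
move=> Dlim; suff main n : (n <= d)%N -> exists C, 0 <= C /\
    forall p j, poly_over D p -> (size p <= n)%N -> vnorm p`_j <= C * vnorm p.[c].
  exact: main.
elim: n => [|n IH] nd.
  exists 0; split=> // p j _; rewrite leqn0 size_poly_eq0 => /eqP->.
  by rewrite coef0 vnorm0 mul0r.
have [C [C0 pC]] := IH (ltnW nd).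
(* Otherwise some q m have c ^+ n + (q m).[c] tending to 0. Their coefficients are Cauchy by the
   induction hypothesis, and the limits give a forbidden relation Q.[c] = 0. *)
have [del [del0 cdel]] : exists del, 0 < del /\ forall q, poly_over D q -> (size q <= n)%N ->
    del <= vnorm (c ^+ n + q.[c]).
  apply: contrapT => /forallNP nodel.
  have /choice[q qP] : forall m : nat, exists q, [/\ poly_over D q, (size q <= n)%N &
      vnorm (c ^+ n + q.[c]) < m.+1%:R^-1].
    move=> m; apply: contrapT => /forallNP h; apply: (nodel m.+1%:R^-1).
    split; first by rewrite invr_gt0.
    by move=> q Dq qn; rewrite leNgt; apply/negP => lt; apply: (h q).
  have qC j : vcauchy (fun m => (q m)`_j).
    move=> e e0; have e1 : 0 < e / (C + 1) by rewrite divr_gt0// ltr_wpDl.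
    exists (Num.bound (e / (C + 1))^-1) => m m' nm nm'.
    have small h : (Num.bound (e / (C + 1))^-1 <= h)%N -> vnorm (c ^+ n + (q h).[c]) < e / (C + 1).
      move=> nh; have [_ _ lt] := qP h; rewrite (lt_trans lt)//.
      rewrite invf_plt ?posrE// (lt_le_trans (archi_boundP _))// ?invr_ge0 ?(ltW e1)//.
      by rewrite ler_nat leqW.
    have [Dq qn _] := qP m; have [Dq' qn' _] := qP m'.
    have qqn : (size (q m - q m')%R <= n)%N.
      by rewrite (leq_trans (size_polyD _ _))// geq_max size_polyN qn.
    rewrite -coefB (le_lt_trans (pC _ j (poly_overB Dsub Dq Dq') qqn))//.
    have -> : (q m - q m').[c] = (c ^+ n + (q m).[c]) - (c ^+ n + (q m').[c]).
      by rewrite !hornerE; ring.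
    rewrite (@le_lt_trans _ _ ((C + 1) * vnorm (c ^+ n + (q m).[c] - (c ^+ n + (q m').[c]))))//.
      by rewrite ler_wpM2r ?vnorm_ge0// lerDl.
    rewrite mulrC -ltr_pdivlMr ?ltr_wpDl//.
    by apply: vnormB_lt; exact: small.
  have /choice[l lP] : forall j, exists x, D x /\ vcvg (fun m => (q m)`_j) x.
    by move=> j; apply: Dlim => // m; have [Dq _ _] := qP m; exact: Dq.
  pose Q := 'X^n + \poly_(j < n) l j.
  have DQ : poly_over D Q.
    apply: (poly_overD Dsub); first exact: poly_overXn.
    by move=> j; rewrite coef_poly; case: ifP => _; [exact: (lP j).1|exact: subfield0].
  have Qsz : (size Q <= d)%N.
    rewrite (leq_trans (size_polyD _ _))// geq_max size_polyXn nd.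
    by rewrite (leq_trans (size_poly _ _))// ltnW.
  have Q0 : Q.[c] = 0.
    apply/eqP; rewrite -vnorm_eq0 eq_le vnorm_ge0 andbT; apply/ler_addgt0Pl => e e0; rewrite addr0.
    pose M := \sum_(j < n) vnorm (c ^+ j).
    have M0 : 0 <= M by rewrite sumr_ge0// => j _; exact: vnorm_ge0.
    have eM : 0 < e / (M + 1) by rewrite divr_gt0// ltr_wpDl.
    have /choice[b bP] : forall j, exists b, forall m, (b <= m)%N -> vnorm ((q m)`_j - l j) < e / (M + 1).
      by move=> j; exact: (lP j).2.
    pose m := (Num.bound e^-1 + \sum_(j < n) b j)%N.
    have [Dq qn qlt] := qP m.
    have -> : Q.[c] = (c ^+ n + (q m).[c]) - \sum_(j < n) ((q m)`_j - l j) * c ^+ j.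
      rewrite /Q hornerD hornerXn horner_poly (horner_coef_wide _ qn) -addrA; congr (_ + _).
      by rewrite -sumrB; apply: eq_bigr => j _; ring.
    apply: vnormB_le.
      rewrite (le_trans (ltW qlt))// ltW// invf_plt ?posrE//.
      rewrite (lt_le_trans (archi_boundP _)) ?invr_ge0 ?(ltW e0)//.
      by rewrite ler_nat leqW// leq_addr.
    apply: vnorm_sum_le => [|j _]; first exact: ltW.
    have bjm : (b j <= m)%N by rewrite /m (bigD1 j)//= addnCA leq_addr.
    rewrite vnormM (le_trans (ler_wpM2r (vnorm_ge0 _) (ltW (bP j m bjm))))//.
    rewrite mulrAC ler_pdivrMr ?ltr_wpDl// ler_pM2l//.
    rewrite /M (bigD1 j)//= -addrA lerDl addr_ge0// sumr_ge0// => h _; exact: vnorm_ge0.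
  have := congr1 (fun p : {poly L} => p`_n) (free DQ Qsz Q0).
  rewrite coefD coefXn eqxx coef_poly ltnn addr0 coef0 => /eqP.
  by rewrite oner_eq0.
(* The first summand bounds the top coefficient. Subtracting the top term costs the factor in
   parentheses, and C then bounds the lower coefficients. *)
exists (del^-1 + C * (1 + vnorm c ^+ n / del)); split.
  by rewrite addr_ge0 ?invr_ge0 ?(ltW del0)// mulr_ge0// addr_ge0// divr_ge0 ?exprn_ge0 ?vnorm_ge0 ?ltW.
move=> p j Dp pn.
pose q := \poly_(h < n) p`_h.
have Dq : poly_over D q.
  by move=> h; rewrite coef_poly; case: ifP => _; [exact: Dp|exact: subfield0].
have pE : p.[c] = q.[c] + p`_n * c ^+ n.
  by rewrite (horner_coef_wide _ pn) big_ord_recr/= horner_poly.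
have pn_le : vnorm p`_n <= del^-1 * vnorm p.[c].
  have [->|pn0] := eqVneq p`_n 0; first by rewrite vnorm0 mulr_ge0 ?vnorm_ge0 ?invr_ge0 ?ltW.
  rewrite mulrC ler_pdivlMr//.
  have -> : p.[c] = p`_n * (c ^+ n + (((p`_n)^-1)%:P * q).[c]).
    by rewrite pE hornerM hornerC mulrDr mulVKf// addrC.
  rewrite vnormM ler_wpM2l ?vnorm_ge0// cdel//.
    by apply: (poly_overM Dsub) => //; apply: (poly_overC Dsub); exact: (subfieldV Dsub).
  by rewrite mul_polyC (leq_trans (size_scale_leq _ _))// size_poly.
have q_le : vnorm q.[c] <= (1 + vnorm c ^+ n / del) * vnorm p.[c].
  have -> : q.[c] = p.[c] - p`_n * c ^+ n by rewrite pE addrK.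
  rewrite mulrDl mul1r; apply: vnormB_le.
    by rewrite lerDl mulr_ge0 ?vnorm_ge0// divr_ge0 ?exprn_ge0 ?vnorm_ge0 ?ltW.
  rewrite vnormM vnormX (le_trans (ler_wpM2r _ pn_le)) ?exprn_ge0 ?vnorm_ge0//.
  by rewrite mulrC mulrA lerDr vnorm_ge0.
have [jn|nj|->] := ltngtP j n; last first.
- by rewrite (le_trans pn_le)// mulrDl lerDl !mulr_ge0 ?vnorm_ge0// addr_ge0// divr_ge0 ?exprn_ge0 ?vnorm_ge0 ?ltW.
- rewrite nth_default ?(leq_trans pn)// vnorm0 mulr_ge0 ?vnorm_ge0//.
  by rewrite addr_ge0 ?invr_ge0 ?(ltW del0)// mulr_ge0// addr_ge0// divr_ge0 ?exprn_ge0 ?vnorm_ge0 ?ltW.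
have -> : p`_j = q`_j by rewrite coef_poly jn.
rewrite (le_trans (pC _ _ Dq (size_poly _ _)))// mulrDl -mulrA.
rewrite (le_trans (ler_wpM2l C0 q_le))// lerDr mulr_ge0 ?vnorm_ge0 ?invr_ge0 ?ltW//.
Qed.

End SimpleExtension.

(** Here d is the degree of a polynomial phi of least size that vanishes at c. To invert p.[c],
    divide phi by p: the remainder r satisfies r.[c] = - (a.[c] * p.[c]) and has smaller size, so
    its inverse is known by induction. *)
Lemma simple_extension_subfield (R : realType) (L : realValuedFieldType R)
    (D : set L) (c : L) : subfield D -> algebraic_over D c ->
  exists d, [/\ (0 < d)%N,
    forall p, poly_over D p ->
      exists q, [/\ poly_over D q, (size q <= d)%N & p.[c] = q.[c]],
    forall p, poly_over D p -> (size p <= d)%N -> p.[c] = 0 -> p = 0 &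
    subfield (simple_extension D c)].
Proof.
move=> Dsub [phi0 Dphi0 [phi00 /rootP phi0c]].
pose P n := `[< exists p, [/\ poly_over D p, p != 0, p.[c] = 0 & size p = n] >].
have exP : exists n, P n by exists (size phi0); apply/asboolP; exists phi0.
case: (ex_minnP exP) => n /asboolP[phi [Dphi phiN0 phic phin]] nmin.
have n0 : (0 < n)%N by rewrite -phin lt0n size_poly_eq0.
have free p : poly_over D p -> (size p <= n.-1)%N -> p.[c] = 0 -> p = 0.
  move=> Dp pn pc; apply/eqP; apply: contraT => p0.
  have : (n <= size p)%N by apply: nmin; apply/asboolP; exists p.
  by move=> np; move: (leq_trans np pn); rewrite leqNgt prednK// leqnn.
have red p : poly_over D p ->
    exists q, [/\ poly_over D q, (size q <= n.-1)%N & p.[c] = q.[c]].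
  move=> Dp; have [a [r [Da Dr -> rphi]]] := poly_over_divp Dsub Dp Dphi phiN0.
  exists r; split=> //; first by rewrite -ltnS prednK// -phin.
  by rewrite hornerD hornerM phic mulr0 add0r.
have inv p : poly_over D p -> (size p <= n.-1)%N -> p != 0 ->
    exists2 q, poly_over D q & p.[c] * q.[c] = 1.
  move: {2}(size p) (leqnn (size p)) => m; elim: m p => [|m IH] p pm Dp pn p0.
    by move: pm; rewrite leqn0 size_poly_eq0 (negbTE p0).
  have pc0 : p.[c] != 0 by apply: contra_neq p0; exact: free.
  have [p1|p1] := leqP (size p) 1.
    exists ((p`_0)^-1)%:P; first by apply: (poly_overC Dsub); exact: (subfieldV Dsub).
    by move: pc0; rewrite (size1_polyC p1) !hornerC coefC eqxx => ?; rewrite mulfV.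
  have [a [r [Da Dr phiE rp]]] := poly_over_divp Dsub Dphi Dp p0.
  have r0 : r != 0.
    apply/eqP => r0; move: phiE; rewrite r0 addr0 => phiE.
    have aN0 : a != 0 by apply: contra_neq phiN0 => a0; rewrite phiE a0 mul0r.
    have : a = 0.
      apply: free => //; last first.
        by move: phic; rewrite phiE hornerM => /eqP; rewrite mulf_eq0 (negbTE pc0) orbF => /eqP.
      have := size_mul aN0 p0; rewrite -phiE phin => ->.
      by move: p1; case: (size p) => [|[|u]] // _; rewrite !addnS /= leq_addr.
    by move/eqP; rewrite (negbTE aN0).
  have [||//|q Dq rq] := IH r _ Dr.
  - by rewrite -ltnS (leq_trans rp).
  - by rewrite (leq_trans (ltnW rp)).
  exists (- a * q); first by apply: (poly_overM Dsub) => //; exact: poly_overN.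
  have rc : r.[c] = - (a.[c] * p.[c]).
    by apply/eqP; rewrite -addr_eq0 addrC -hornerM -hornerD -phiE phic.
  by rewrite -rq rc hornerM hornerN; ring.
exists n.-1; split=> //.
  rewrite -ltnS prednK// -phin ltnNge; apply/negP => phi1.
  by move: phiN0 phic; rewrite (size1_polyC phi1) hornerC polyC_eq0 => /eqP.
split=> [|_ _ [p Dp ->] [q Dq ->]|_ _ [p Dp ->] [q Dq ->]|_ [p Dp ->]].
- by exists 1; rewrite ?hornerC// -polyC1; apply: (poly_overC Dsub); exact: subfield1.
- by exists (p - q); rewrite ?hornerD ?hornerN//; exact: poly_overB.
- by exists (p * q); rewrite ?hornerM//; exact: poly_overM.
have [q [Dq qn ->]] := red p Dp.
have [->|q0] := eqVneq q 0.
  by exists 0; rewrite ?horner0 ?invr0//; exact: poly_over0.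
have [g Dg qg] := inv q Dq qn q0; exists g => //.
have qc0 : q.[c] != 0 by apply: contra_eq_neq qg => ->; rewrite mul0r eq_sym oner_eq0.
by apply: (mulfI qc0); rewrite qg mulfV.
Qed.

Section AlgebraicStep.
Variables (R : realType) (k : realValuedFieldType R) (A : comAlgType k).
Variables (N : A -> R) (Nalg : alg_seminorm N) (Nspec : spectral N).
Variables (L : realValuedFieldType R) (i : {rmorphism k -> L}).
Hypothesis iso : isometric i.
Local Notation T := (tensor A i).
Local Notation nrm := (@tensor_seminorm R k A L i N).
Local Notation iota := (tens_right A i).
Let Tsemi := tnorm_semi Nalg i.
Let T1 := tnorm1 Nalg Nspec iso.

Definition power_mult_on (D : set L) :=
  forall x n, tens_span A i D x -> nrm (x ^+ n) = nrm x ^+ n.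

(* A functional t with t 1 = 1 splits off the summands of x one by one. *)
Lemma tnorm_le_of_functional (D E : set L) t (s : R) x :
  subfield D -> range i `<=` D -> subfield E -> D `<=` E -> functional D t -> t 1 = 1 ->
  (forall v, E v -> vnorm (t v) <= vnorm v) -> tens_span A i E x ->
  (forall z, E z -> nrm (tens_map t (x * iota z)) <= s * vnorm z) -> nrm x <= s.
Proof.
move=> Dsub iD Esub DE tfun t1 tle Ex.
have s0 : (forall z, E z -> nrm (tens_map t (x * iota z)) <= s * vnorm z) -> 0 <= s.
  move=> /(_ 1 (subfield1 Esub)); rewrite vnorm1 mulr1; apply: le_trans.
  exact: tnorm_ge0.
have [r [rP xr]] : exists r : seq (T * L),
    (forall q, q \in r -> tens_span A i D q.1 /\ E q.2) /\ x = \sum_(q <- r) q.1 * iota q.2.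
  have [r [rE ->]] := Ex; exists [seq (tens i q.1 1, q.2) | q <- r]; split.
    move=> _ /mapP[q /rE Eq ->]; split=> //=; apply: tens_span_tens.
    exact: (subfield1 Dsub).
  by rewrite big_map; apply: eq_bigr => q _; rewrite tens_rightM mul1r.
move: {2}(size r) (leqnn (size r)) => n; elim: n r x xr rP s0 {Ex} => [|n IH] r x xr rP s0 rn xz.
  by move: rn; rewrite leqn0 size_eq0 xr => /eqP->; rewrite big_nil (seminorm0 Tsemi) s0.
case: r xr rP rn => [|[y w] r] xr rP rn.
  by rewrite xr big_nil (seminorm0 Tsemi); exact: s0 xz.
have [w0|w0] := eqVneq w 0.
  apply: (IH r) => //.
    by rewrite xr big_cons /= w0 rmorph0 mulr0 add0r.
  by move=> q qr; apply: rP; rewrite inE qr orbT.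
have [Dy Ew] := rP _ (mem_head _ _); rewrite /= in Dy Ew.
(* As t 1 = 1, subtracting a * iota w cancels the summand of w, and the other right factors change
   by multiples of w in E; so the number of summands drops. *)
pose a := tens_map t (x * iota w^-1).
have Da : tens_span A i D a by exact: tens_map_span.
have aw : nrm (a * iota w) <= s.
  rewrite (tnormM_right Nalg) -ler_pdivlMr ?vnorm_gt0// -vnormV.
  by apply: xz; exact: (subfieldV Esub).
have aE : a = \sum_(q <- (y, w) :: r) q.1 * iota (t (q.2 / w)).
  rewrite /a xr mulr_suml (tens_map_sum iD tfun); apply: eq_big_seq => q /rP[Dq _].
  by rewrite -mulrA -rmorphM (tens_mapZ iD tfun)// /tens_right (tens_mapE iD tfun).
have xaE : x - a * iota w = \sum_(q <- [seq (q.1, q.2 - t (q.2 / w) * w) | q <- r]) q.1 * iota q.2.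
  rewrite aE xr mulr_suml !big_cons /= mulfV// t1 rmorph1 mulr1 opprD addrACA subrr add0r.
  rewrite big_map -sumrB; apply: eq_bigr => q _ /=.
  by rewrite rmorphB rmorphM mulrBr mulrA.
rewrite -(subrK (a * iota w) x); apply: (seminormD_le Tsemi) => //.
have tE v : E (t v) by apply: DE; exact: functional_val tfun _.
apply: (IH _ _ xaE).
- move=> _ /mapP[q qr ->] /=; have [|Dq Eq] := rP q; first by rewrite inE qr orbT.
  by split=> //; apply: (subfieldB Esub) => //; apply: (subfieldM Esub).
- by move=> _; exact: s0 xz.
- by rewrite size_map.
(* The hypothesis survives: t takes a * iota (w * z) to a * iota (t (w * z)), of norm at most nrm (a
   * iota w) * vnorm z. *)
- move=> z Ez; rewrite mulrBl (tens_mapB iD tfun); apply: (seminormB_le Tsemi); first exact: xz.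
  rewrite -mulrA (tens_mapZ iD tfun)// -rmorphM /tens_right (tens_mapE iD tfun).
  rewrite -/(tens_right A i _) (tnormM_right Nalg).
  have /tle twz : E (w * z) by exact: (subfieldM Esub).
  rewrite (le_trans (ler_wpM2l (seminorm_ge0 Tsemi _) twz))//.
  by rewrite vnormM mulrA ler_wpM2r ?vnorm_ge0// -(tnormM_right Nalg).
Qed.

Hypothesis nat1 : forall n, (0 < n)%N -> vnorm (n%:R : L) = 1.

(** Closedness of D bounds the coordinates in the basis of powers of c. Growth of the powers of y
    thus passes to the matrices of multiplication by them, where the trace bound applies. *)
Lemma power_mult_simple_extension (D : set L) c : subfield D -> range i `<=` D ->
  closed_under_limits D -> power_mult_on D -> algebraic_over D c ->
  subfield (simple_extension D c) /\ power_mult_on (simple_extension D c).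
Proof.
move=> Dsub iD Dlim Dpow calg; have [d' [d0 red free Esub]] := simple_extension_subfield Dsub calg.
case: d' d0 red free => [//|d] _ red free.
split=> //; set E := simple_extension D c in Esub *.
have DE : D `<=` E.
  by move=> v Dv; exists v%:P; rewrite ?hornerC//; exact: (poly_overC Dsub).
have iE : range i `<=` E := subset_trans iD DE.
have Ec : E c by exists 'X; rewrite ?hornerX//; exact: (poly_overX Dsub).
have EcX n : E (c ^+ n) by exact: (subfieldX Esub).
have [C [C0 coefC]] := simple_extension_bounded Dsub free Dlim.
have /choice[kap kapP] : forall j : 'I_d.+1, exists f, functional D f /\
    forall p, poly_over D p -> (size p <= d.+1)%N -> f p.[c] = p`_j.
  by move=> j; exact: simple_extension_coord.
have kfun j := (kapP j).1.
have Eexpand v : E v -> v = \sum_(j < d.+1) kap j v * c ^+ j.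
  move=> [p Dp ->]; have [q [Dq qd ->]] := red p Dp.
  rewrite {1}(horner_coef_wide _ qd); apply: eq_bigr => j _.
  by rewrite (kapP j).2.
have kapE v j : E v -> vnorm (kap j v) <= C * vnorm v.
  by move=> [p Dp ->]; have [q [Dq qd ->]] := red p Dp; rewrite (kapP j).2// coefC.
have kapX (j h : 'I_d.+1) : kap j (c ^+ h) = (j == h)%:R.
  by rewrite -hornerXn (kapP j).2 ?size_polyXn ?coefXn//; exact: poly_overXn.
pose dinv : L := (d.+1)%:R^-1.
have Ddinv : D dinv by apply: (subfieldV Dsub); exact: subfield_nat.
have dinv1 : vnorm dinv = 1 by rewrite /dinv vnormV nat1// invr1.
(* The summands are the diagonal entries of multiplication by v, so this is the trace divided by the
   degree, here d + 1. *)
pose t v := dinv * \sum_(j < d.+1) kap j (v * c ^+ j).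
have tfun : functional D t.
  split=> [x y|b x Db|x]; rewrite /t.
  - rewrite -mulrDr -big_split; congr (_ * _); apply: eq_bigr => j _.
    by rewrite mulrDl (functionalD (kfun j)).
  - rewrite mulrCA; congr (_ * _); rewrite mulr_sumr; apply: eq_bigr => j _.
    by rewrite -mulrA (functionalZ (kfun j)).
  - by apply: (subfieldM Dsub) => //; apply: subfield_sum => // j _; exact: functional_val (kfun j) _.
have t1 : t 1 = 1.
  rewrite /t; under eq_bigr do rewrite mul1r kapX eqxx.
  by rewrite sumr_const card_ord mulVf// -vnorm_gt0 nat1.
have kap_le y j : tens_span A i E y -> nrm (tens_map (kap j) y) <= C * nrm y.
  by apply: (tnorm_map_le Nalg Esub iD DE (kfun j) C0) => v; exact: kapE.
have expand y : tens_span A i E y -> y = \sum_(j < d.+1) tens_map (kap j) y * iota (c ^+ j).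
  move=> Ey; elim/tens_span_ind: y / Ey => [|x y IHx IHy|a b Eb].
  - by rewrite big1// => j _; rewrite (tens_map0 _ iD (kfun j)) mul0r.
  - rewrite [in LHS]IHx [in LHS]IHy -big_split; apply: eq_bigr => j _.
    by rewrite (tens_mapD iD (kfun j)) mulrDl.
  rewrite {1}(Eexpand _ Eb) (big_morph (tens i a) (tensDr i a) (tens0r i a)).
  by apply: eq_bigr => j _; rewrite (tens_mapE iD (kfun j)) tens_rightM.
(* Multiplication by y as a matrix over A ⊗ D. Since Y is multiplicative on A ⊗ E, the entries of Y
   y ^+ m are coordinates of y ^+ m * iota (c ^+ b). *)
pose Y y : 'M[T]_d.+1 := \matrix_(a, b) tens_map (kap a) (y * iota (c ^+ b)).
have spanEM y v : tens_span A i E y -> E v -> tens_span A i E (y * iota v).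
  by move=> Ey Ev; apply: (tens_spanM Esub) => //; exact: tens_span_right.
have YM y z : tens_span A i E y -> tens_span A i E z -> Y (y * z) = Y y * Y z.
  move=> Ey Ez; apply/matrixP => a b; rewrite !mxE.
  rewrite -mulrA {1}(expand (z * iota (c ^+ b))); last exact: spanEM.
  rewrite mulr_sumr (tens_map_sum iD (kfun a)); apply: eq_bigr => h _; rewrite !mxE.
  rewrite mulrCA [LHS](tens_mapZ iD (kfun a)); first by rewrite mulrC.
  exact: (tens_map_span iD (kfun h)).
have Y1 : Y 1 = 1.
  apply/matrixP => a b; rewrite !mxE mul1r /tens_right (tens_mapE iD (kfun a)) kapX.
  by rewrite -/(tens_right A i _) rmorph_nat.
have YX y m : tens_span A i E y -> Y (y ^+ m) = Y y ^+ m.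
  move=> Ey; elim: m => [|m IH]; first by rewrite !expr0.
  by rewrite !exprS YM ?IH//; exact: tens_spanX.
have trY y : tens_map t y = iota dinv * \tr (Y y).
  have := tens_span_full y; elim/tens_span_ind: y / => [|x y IHx IHy|a b _].
  - rewrite (tens_map0 _ iD tfun) /mxtrace big1 ?mulr0// => j _.
    by rewrite mxE mul0r (tens_map0 _ iD (kfun j)).
  - rewrite (tens_mapD iD tfun) IHx IHy -mulrDr /mxtrace -big_split; congr (_ * _).
    apply: eq_bigr => j _; rewrite !mxE mulrDl.
    by rewrite (tens_mapD iD (kfun j)).
  rewrite (tens_mapE iD tfun) mulrC mulr_suml /t mulr_sumr.
  rewrite (big_morph (tens i a) (tensDr i a) (tens0r i a)); apply: eq_bigr => j _.
  by rewrite mxE tens_rightM (tens_mapE iD (kfun j)) tens_rightM mulrC.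
(* The entries of Y (y ^+ m) are at most C * (K * M) * s ^+ m, where M bounds the basis, and
   division by the degree preserves the norm. *)
have tbound y K s : tens_span A i E y -> 0 < s -> (forall m, nrm (y ^+ m) <= K * s ^+ m) ->
    nrm (tens_map t y) <= s.
  move=> Ey s0 yK; rewrite trY mulrC (tnormM_right Nalg) dinv1 mulr1.
  pose M := \sum_(j < d.+1) vnorm (c ^+ j).
  have cM (j : 'I_d.+1) : vnorm (c ^+ j) <= M.
    by rewrite /M (bigD1 j)//= lerDl sumr_ge0// => h _; exact: vnorm_ge0.
  apply: (@trace_le _ _ _ Tsemi T1 (tens_span A i D) _ _ _ _ _ _ (C * (K * M)) _ s0).
  - exact: tens_span1.
  - by move=> x z; exact: tens_spanB.
  - by move=> x z; exact: tens_spanM.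
  - by move=> x n; exact: Dpow.
  - by move=> a b; rewrite mxE; exact: (tens_map_span iD (kfun a)).
  move=> m a b; rewrite -YX// mxE (le_trans (kap_le _ _ _))//.
    by apply: spanEM => //; exact: (tens_spanX Esub).
  rewrite -!mulrA ler_wpM2l// (tnormM_right Nalg) mulrCA [X in _ <= X]mulrC.
  by apply: ler_pM; rewrite ?vnorm_ge0 ?(seminorm_ge0 Tsemi).
(* The powers of [iota v] have norm exactly vnorm v ^+ m, so [tbound] applies with K = 1. *)
have tle v : E v -> vnorm (t v) <= vnorm v.
  move=> Ev; have [->|v0] := eqVneq v 0; first by rewrite (functional0 tfun).
  have right u := tnorm_right Nalg iso u (spectral_norm1 Nspec).
  have := @tbound (iota v) 1 (vnorm v); rewrite /tens_right (tens_mapE iD tfun).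
  rewrite -/(tens_right A i (t v)) right; apply; rewrite ?vnorm_gt0//.
    exact: tens_span_right.
  by move=> m; rewrite -/(tens_right A i v) -rmorphXn right vnormX mul1r.
(* If some power of x lost norm, the powers would grow at a rate s below nrm x, and those of x *
   iota z at the rate s * vnorm z. Then [tbound] and [tnorm_le_of_functional] force nrm x <= s. *)
move=> x n Ex; apply/eqP; rewrite eq_le seminormX_le ?T1//= leNgt; apply/negP => xn.
have [s [K [s0 sx xK]]] := exponential_gap Tsemi T1 xn.
suff : nrm x <= s by rewrite leNgt sx.
apply: (tnorm_le_of_functional Dsub iD Esub DE tfun t1 tle Ex) => z Ez.
have [->|z0] := eqVneq z 0.
  by rewrite rmorph0 mulr0 (tens_map0 _ iD tfun) (seminorm0 Tsemi) vnorm0 mulr0.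
apply: (@tbound _ K); [exact: spanEM|by rewrite mulr_gt0// vnorm_gt0|].
move=> m; rewrite exprMn -rmorphXn (tnormM_right Nalg) vnormX exprMn mulrA.
by rewrite ler_wpM2r ?exprn_ge0 ?vnorm_ge0.
Qed.

End AlgebraicStep.

(** * Transcendental extensions *)

Section TranscendentalStep.
Variables (R : realType) (k : realValuedFieldType R) (A : comAlgType k).
Variables (N : A -> R) (Nalg : alg_seminorm N) (Nspec : spectral N).
Variables (L : realValuedFieldType R) (i : {rmorphism k -> L}).
Hypothesis iso : isometric i.
Local Notation T := (tensor A i).
Local Notation nrm := (@tensor_seminorm R k A L i N).
Local Notation iota := (tens_right A i).
Local Notation power_mult D := (@power_mult_on R k A N L i D).
Let Tsemi := tnorm_semi Nalg i.
Let T1 := tnorm1 Nalg Nspec iso.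
Let nrm_iota v : nrm (iota v) = vnorm v.
Proof. exact: (tnorm_right Nalg iso v (spectral_norm1 Nspec)). Qed.

Section Transcendental.
Variables (D : set L) (Dsub : subfield D) (iD : range i `<=` D).
Hypothesis Dpow : power_mult D.

(** The functional on L that reads the coefficient of be ^+ j, extended to T, reads Z_j off the
    value of Z. The size bound is chosen to exceed both j and the degree of Z. *)
Lemma transcendental_free (Z : {poly T}) be : ~ algebraic_over D be ->
  (forall j, tens_span A i D Z`_j) -> Z.[iota be] = 0 -> Z = 0.
Proof.
move=> bealg ZD Zbe; apply/polyP => j; rewrite coef0.
have free p : poly_over D p -> (size p <= (size Z + j.+1)%N)%N -> p.[be] = 0 -> p = 0.
  move=> Dp _ pbe; apply/eqP/negPn/negP => p0; apply: bealg; exists p => //.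
  by split=> //; apply/rootP.
have [|f [ffun fE]] := simple_extension_coord Dsub free (j := j).
  by rewrite addnS ltnS leq_addl.
have fX h : (h < size Z + j.+1)%N -> f (be ^+ h) = (j == h)%:R.
  move=> hZ; rewrite -hornerXn fE ?size_polyXn ?coefXn//; exact: poly_overXn.
have : tens_map f Z.[iota be] = 0 by rewrite Zbe (tens_map0 _ iD ffun).
have jZ : (j < size Z + j.+1)%N by rewrite addnS ltnS leq_addl.
rewrite (horner_coef_wide _ (leq_addr j.+1 (size Z))) (tens_map_sum iD ffun).
rewrite (bigD1 (Ordinal jZ))//= big1 ?addr0 => [|h hj].
  rewrite (tens_mapZ iD ffun)// -rmorphXn /tens_right (tens_mapE iD ffun) fX// eqxx.
  by rewrite -/(tens_right A i _) rmorph1 mulr1.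
rewrite (tens_mapZ iD ffun)// -rmorphXn /tens_right (tens_mapE iD ffun) fX//.
rewrite (_ : j == h = false) ?tens0r ?mulr0//.
by apply/negbTE; apply: contra hj => /eqP jh; apply/eqP/val_inj.
Qed.

Hypothesis Lcomplete : vcomplete L.
Hypothesis nat1 : forall n, (0 < n)%N -> vnorm (n%:R : L) = 1.
Hypothesis Dalg : forall c, algebraic_over D c -> D c.
Variable b : L.
Hypothesis Db : ~ D b.

(** A center may be replaced by any point of D nearer to b, so the nearest of finitely many centers
    serves all the polynomials; [coef_comp_shift_le] then moves the expansion from b to c. *)
Lemma best_center_seq (fs : seq {poly L}) : (forall f, f \in fs -> poly_over D f) ->
  exists c, D c /\ forall f, f \in fs -> forall j,
    vnorm (f \Po ('X + c%:P))`_j * vnorm (b - c) ^+ j <= vnorm f.[b].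
Proof.
move=> Dfs; have [c [Dc cP]] : exists c, D c /\ forall f, f \in fs -> forall j,
    vnorm (f \Po ('X + b%:P))`_j * vnorm (b - c) ^+ j <= vnorm f.[b].
  elim: fs Dfs => [|f fs IH] Dfs.
    by exists 0; split=> //; exact: subfield0.
  have [g gfs|c [Dc cP]] := IH; first by apply: Dfs; rewrite inE gfs orbT.
  have [c' [Dc' c'P]] : exists c, D c /\ forall j,
      vnorm (f \Po ('X + b%:P))`_j * vnorm (b - c) ^+ j <= vnorm f.[b].
    have [f0|f0] := eqVneq f 0; last first.
      by apply: best_center => //; apply: Dfs; exact: mem_head.
    exists 0; split=> [|j]; first exact: subfield0.
    by rewrite f0 comp_poly0 coef0 vnorm0 mul0r vnorm_ge0.
  have close d d' (g : {poly L}) : vnorm (b - d) <= vnorm (b - d') ->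
      (forall j, vnorm (g \Po ('X + b%:P))`_j * vnorm (b - d') ^+ j <= vnorm g.[b]) ->
      forall j, vnorm (g \Po ('X + b%:P))`_j * vnorm (b - d) ^+ j <= vnorm g.[b].
    move=> dd' gd' j; rewrite (le_trans _ (gd' j))// ler_wpM2l ?vnorm_ge0//.
    by rewrite lerXn2r ?nnegrE ?vnorm_ge0.
  have [cc'|cc'] := leP (vnorm (b - c)) (vnorm (b - c')).
    exists c; split=> // g; rewrite inE => /orP[/eqP->|/cP//].
    exact: close cc' c'P.
  exists c'; split=> // g; rewrite inE => /orP[/eqP->//|/cP cg].
  by apply: close cg; exact: ltW.
exists c; split=> // f ffs j.
have -> : f \Po ('X + c%:P) = (f \Po ('X + b%:P)) \Po ('X + (c - b)%:P).
  rewrite -comp_polyA; congr (_ \Po _).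
  by rewrite comp_polyD comp_polyX comp_polyC -addrA -polyCD subrK.
apply: coef_comp_shift_le; [by rewrite vnorm_distC|exact: vnorm_ge0|exact: cP].
Qed.

Definition fraction_extension : set L := [set v | exists p q,
  [/\ poly_over D p, poly_over D q, q.[b] != 0 & v = p.[b] / q.[b]]].

Lemma fraction_extension_subfield : subfield fraction_extension.
Proof.
have D1 : poly_over D 1 by rewrite -polyC1; apply: (poly_overC Dsub); exact: subfield1.
split=> [|_ _ [p [q [Dp Dq q0 ->]]] [p' [q' [Dp' Dq' q'0 ->]]]
  |_ _ [p [q [Dp Dq q0 ->]]] [p' [q' [Dp' Dq' q'0 ->]]]|_ [p [q [Dp Dq q0 ->]]]].
- by exists 1, 1; rewrite hornerC oner_neq0 divr1; split.
- exists (p * q' - p' * q), (q * q'); rewrite !hornerE mulf_neq0//; split=> //.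
  + by apply: (poly_overB Dsub); exact: (poly_overM Dsub).
  + exact: (poly_overM Dsub).
  + by field; rewrite ?q0 ?q'0.
- exists (p * p'), (q * q'); rewrite !hornerM mulf_neq0//; split=> //; try exact: (poly_overM Dsub).
  by field; rewrite ?q0 ?q'0.
have [p0|p0] := eqVneq p.[b] 0.
  exists 0, 1; rewrite hornerC oner_neq0 horner0 p0 !mul0r invr0; split=> //.
  exact: poly_over0.
by exists q, p; split=> //; rewrite invf_div.
Qed.

Lemma common_denominator (vs : seq L) : (forall v, v \in vs -> fraction_extension v) ->
  exists q, [/\ poly_over D q, q.[b] != 0 &
    forall v, v \in vs -> exists2 p, poly_over D p & v * q.[b] = p.[b]].
Proof.
elim: vs => [|v vs IH] vsE.
  exists 1; rewrite hornerC oner_neq0; split=> //.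
  by rewrite -polyC1; apply: (poly_overC Dsub); exact: subfield1.
have [w wvs|q [Dq q0 qP]] := IH; first by apply: vsE; rewrite inE wvs orbT.
have [p [q' [Dp Dq' q'0 vE]]] := vsE _ (mem_head _ _).
exists (q * q'); rewrite hornerM mulf_neq0//; split=> //; first exact: (poly_overM Dsub).
move=> w; rewrite inE => /orP[/eqP->|/qP[p' Dp' wE]].
  by exists (p * q); [exact: (poly_overM Dsub)|rewrite hornerM vE; field].
by exists (p' * q'); [exact: (poly_overM Dsub)|rewrite hornerM -wE mulrA].
Qed.

(** The Taylor expansion of f at c, over T, to be evaluated at b - c. *)
Let lift c (f : {poly L}) : {poly T} := map_poly iota (f \Po ('X + c%:P)).

Let lift_horner c f : (lift c f).[iota (b - c)] = iota f.[b].
Proof. by rewrite horner_map /= horner_comp !hornerE subrK. Qed.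

Let polys (s : seq (A * {poly L})) : T := \sum_(q <- s) tens i q.1 q.2.[b].
Let lifts c (s : seq (A * {poly L})) : {poly T} :=
  \sum_(q <- s) (tens i q.1 1)%:P * lift c q.2.

Let lifts_horner c s : (lifts c s).[iota (b - c)] = polys s.
Proof.
rewrite /lifts horner_sum; apply: eq_bigr => q _.
by rewrite hornerM hornerC lift_horner tens_rightM mul1r.
Qed.

Let lift_span c f j : D c -> poly_over D f -> tens_span A i D (lift c f)`_j.
Proof.
move=> Dc Df; rewrite coef_map; apply: tens_span_right; apply: (poly_over_comp Dsub) => //.
by apply: (poly_overD Dsub); [exact: poly_overX|exact: poly_overC].
Qed.

Let lifts_span c s j : D c -> (forall q, q \in s -> poly_over D q.2) ->
  tens_span A i D (lifts c s)`_j.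
Proof.
move=> Dc sD; rewrite coef_sum; apply: tens_span_sum => q qs _; rewrite coefCM.
apply: (tens_spanM Dsub); first by apply: tens_span_tens; exact: subfield1.
by apply: lift_span => //; exact: sD.
Qed.

Let horner_le (f : {poly T}) be M : 0 <= M ->
  gauss_le nrm (vnorm be) f M -> nrm f.[iota be] <= M.
Proof.
move=> M0 fM; rewrite horner_coef; apply: (seminorm_sum_le Tsemi) => // j _ _.
by rewrite -rmorphXn (tnormM_right Nalg) vnormX fM.
Qed.


(** If x ^+ n lost norm, it would have a representation over D(b) with all terms smaller than nrm x
    ^+ n. Clear denominators and expand at a center common to the polynomials that occur: there the
    value at b dominates every Taylor term, so the representation bounds the Gauss norm of X ^+ n *
    Q strictly by nrm x ^+ n * vnorm d.[b]. But that Gauss norm is M ^+ n * M', with M >= nrm x and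
    M' >= vnorm d.[b]. *)
Lemma power_mult_fraction_extension : power_mult fraction_extension.
Proof.
have Esub := fraction_extension_subfield.
have DE : D `<=` fraction_extension.
  move=> v Dv; exists v%:P, 1; rewrite !hornerC oner_neq0 divr1; split=> //.
    exact: poly_overC.
  by rewrite -polyC1; apply: (poly_overC Dsub); exact: subfield1.
have iE := subset_trans iD DE.
have clear_den (s : seq (A * L)) : (forall q, q \in s -> fraction_extension q.2) ->
    exists d, [/\ poly_over D d, d.[b] != 0 & exists ps : seq (A * {poly L}),
      [/\ forall q, q \in ps -> poly_over D q.2,
          (\sum_(q <- s) tens i q.1 q.2) * iota d.[b] = polys ps &
          forall M, (forall q, q \in s -> N q.1 * vnorm q.2 < M) ->
            forall q, q \in ps -> N q.1 * vnorm q.2.[b] < M * vnorm d.[b]]].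
  move=> sE; have [v /mapP[q /sE Eq ->]//|d [Dd d0 dP]] := @common_denominator (map snd s).
  have /choice[P PP] : forall v, exists p, v \in map snd s -> poly_over D p /\ v * d.[b] = p.[b].
    move=> v; have [vs|vs] := boolP (v \in map snd s); last by exists 0.
    by have [p Dp pE] := dP v vs; exists p.
  exists d; split=> //; exists [seq (q.1, P q.2) | q <- s]; split.
  - by move=> _ /mapP[q qs ->] /=; have [] := PP _ (map_f snd qs).
  - rewrite /polys big_map mulr_suml; apply: eq_big_seq => q qs.
    by rewrite tens_rightM /=; have [_ ->] := PP _ (map_f snd qs).
  - move=> M sM _ /mapP[q qs ->] /=; have [_ <-] := PP _ (map_f snd qs).
    by rewrite vnormM mulrA ltr_pM2r ?vnorm_gt0// sM.
(* Multiplication by an element of L scales the norm exactly, so the denominator of x can be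
   cleared. *)
suff poly_case (ps : seq (A * {poly L})) n : (forall q, q \in ps -> poly_over D q.2) ->
    nrm (polys ps) ^+ n <= nrm (polys ps ^+ n).
  move=> x n Ex; apply/eqP; rewrite eq_le seminormX_le ?T1//=.
  have [s [sE xs]] := Ex; have [d [Dd d0 [ps [Dps xd _]]]] := clear_den s sE.
  have := poly_case ps n Dps; rewrite -xd -xs exprMn -rmorphXn !(tnormM_right Nalg).
  by rewrite vnormX exprMn ler_pM2r// exprn_gt0// vnorm_gt0.
move=> Dps; set x := polys ps; rewrite leNgt; apply/negP => xn.
have n0 : (0 < n)%N by case: n xn => //; rewrite !expr0 T1 ltxx.
have xpos : 0 < nrm x.
  rewrite lt_def (seminorm_ge0 Tsemi) andbT; apply/eqP => x0; move: xn.
  by rewrite x0 expr0n gtn_eqF// ltNge (seminorm_ge0 Tsemi).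
have Ex : tens_span A i fraction_extension (x ^+ n).
  apply: (tens_spanX Esub); apply: tens_span_sum => q /Dps Dq _; apply: tens_span_tens.
  exists q.2, 1; rewrite hornerC oner_neq0 divr1; split=> //.
  by rewrite -polyC1; apply: (poly_overC Dsub); exact: subfield1.
have [s' [xs' s'E s'lt]] := tnorm_rep_in Nalg Esub iE Ex xn.
have [d [Dd d0 [ps' [Dps' xd /(_ _ s'lt) ps'lt]]]] := clear_den s' s'E.
have [f|c [Dc cP]] := @best_center_seq (d :: map snd ps').
  by rewrite inE => /orP[/eqP->//|/mapP[q /Dps' Dq ->]].
have r0 : 0 < vnorm (b - c).
  by rewrite vnorm_gt0 subr_eq0; apply/eqP => bc; apply: Db; rewrite bc.
have bcalg : ~ algebraic_over D (b - c).
  by move=> /Dalg Dbc; apply: Db; rewrite -(subrK c b); exact: subfieldD.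
pose X := lifts c ps; pose Q := lift c d.
have Xh : X.[iota (b - c)] = x by exact: lifts_horner.
(* Both sides agree at b - c, which is transcendental over D, so they agree as polynomials. *)
have XQ : X ^+ n * Q = lifts c ps'.
  apply/eqP; rewrite -subr_eq0; apply/eqP; apply: (transcendental_free bcalg).
    move=> j; rewrite coefB; apply: (tens_spanB Dsub) => //; last exact: lifts_span.
    rewrite coefM; apply: tens_span_sum => h _ _; apply: (tens_spanM Dsub) => //; last exact: lift_span.
    move: (h : nat); elim: n {x xn xpos n0 Ex xs' xd ps'lt s'lt Xh} => [|m IH] h'.
      rewrite expr0 coef1; case: eqP => _; [exact: tens_span1|exact: tens_span0].
    rewrite exprS coefM; apply: tens_span_sum => h'' _ _; apply: (tens_spanM Dsub) => //.
    exact: lifts_span.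
  by rewrite hornerD hornerN hornerM horner_exp Xh lift_horner lifts_horner xs' xd subrr.
have pos_coef (f : {poly T}) be : 0 < nrm f.[iota be] -> exists j, 0 < nrm f`_j.
  move=> fpos; apply: contrapT => /forallNP f0.
  have : nrm f.[iota be] <= 0; last by rewrite leNgt fpos.
  apply: horner_le => // j; rewrite (_ : nrm f`_j = 0) ?mul0r//.
  apply/eqP; rewrite eq_le (seminorm_ge0 Tsemi) andbT leNgt; exact/negP/f0.
have [|jx Xjx] := pos_coef X (b - c); first by rewrite Xh.
have [|jq Qjq] := pos_coef Q (b - c); first by rewrite lift_horner nrm_iota vnorm_gt0.
have [i0 [M [domX MX]]] := exists_dominant Tsemi r0 Xjx.
have [j0 [M' [domQ MQ]]] := exists_dominant Tsemi r0 Qjq.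
have M0 : 0 <= M by rewrite -MX mulr_ge0 ?(seminorm_ge0 Tsemi) ?exprn_ge0 ?ltW.
have M'0 : 0 <= M' by rewrite -MQ mulr_ge0 ?(seminorm_ge0 Tsemi) ?exprn_ge0 ?ltW.
have xM : nrm x <= M by rewrite -Xh; apply: horner_le => //; have [] := domX.
have dM' : vnorm d.[b] <= M'.
  by rewrite -nrm_iota -(lift_horner c); apply: horner_le => //; have [] := domQ.
have domXQ := dominantM Tsemi r0 (dominantX Tsemi r0 n T1 domX) domQ.
(* The n-th power is exact by [Dpow], and Q_j0 comes from L, by which multiplication is exact. *)
have XQcoef : nrm (X`_i0 ^+ n * Q`_j0) * vnorm (b - c) ^+ (n * i0 + j0) = M ^+ n * M'.
  have -> : Q`_j0 = iota (d \Po ('X + c%:P))`_j0 by rewrite coef_map.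
  rewrite (tnormM_right Nalg) Dpow; last exact: lifts_span.
  rewrite exprD mulrACA mulnC exprM -exprMn MX; congr (_ * _).
  by rewrite -MQ coef_map nrm_iota.
have := dominant_coef Tsemi r0 domXQ XQcoef; rewrite XQ => XQE.
have N0 := seminorm_ge0 (alg_seminorm_ring Nalg).
suff : M ^+ n * M' < nrm x ^+ n * vnorm d.[b].
  rewrite ltNge ler_pM ?exprn_ge0 ?vnorm_ge0 ?(ltW xpos)//.
  by rewrite lerXn2r ?nnegrE ?(ltW xpos).
rewrite -XQE /lifts coef_sum -ltr_pdivlMr ?exprn_gt0//; apply: (seminorm_sum_lt Tsemi).
  by rewrite divr_gt0 ?mulr_gt0 ?exprn_gt0// vnorm_gt0.
move=> q qs _; rewrite ltr_pdivlMr ?exprn_gt0// (le_lt_trans _ (ps'lt q qs))//.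
rewrite coefCM coef_map /= tens_rightM mul1r.
rewrite (le_trans (ler_wpM2r _ (tnorm_tens_le Nalg _ _ _))) ?exprn_ge0 ?vnorm_ge0//.
by rewrite -mulrA ler_wpM2l// cP// inE map_f ?orbT.
Qed.

End Transcendental.

Definition vclosure (D : set L) : set L :=
  [set v | forall e : R, 0 < e -> exists d, D d /\ vnorm (v - d) < e].

Lemma tens_span_vclosure (D : set L) x (e : R) : 0 < e ->
  tens_span A i (vclosure D) x ->
  exists y, tens_span A i D y /\ nrm (x - y) < e.
Proof.
have N0 := seminorm_ge0 (alg_seminorm_ring Nalg).
move=> e0 Sx; elim/tens_span_ind: x / Sx => [|x x' [y [Dy xy]] [y' [Dy' xy']]|a v Dv].
- by exists 0; rewrite subrr (seminorm0 Tsemi); split=> //; exact: tens_span0.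
- exists (y + y'); split; first exact: tens_spanD.
  by rewrite opprD addrACA; exact: (seminormD_lt Tsemi).
have Na : 0 < N a + 1 by rewrite ltr_wpDl.
have [d [Dd vd]] := Dv _ (divr_gt0 e0 Na).
exists (tens i a d); split; first exact: tens_span_tens.
have -> : tens i a v - tens i a d = tens i a (v - d).
  by apply/eqP; rewrite subr_eq -tensDr subrK.
rewrite (le_lt_trans (tnorm_tens_le Nalg _ _ _))//.
rewrite (@le_lt_trans _ _ ((N a + 1) * vnorm (v - d)))//.
  by rewrite ler_wpM2r ?vnorm_ge0// lerDl.
by rewrite mulrC -ltr_pdivlMr.
Qed.

Lemma sub_vclosure D : D `<=` vclosure D.
Proof. by move=> v Dv e e0; exists v; rewrite subrr vnorm0. Qed.

Lemma vclosure_subfield D : subfield D -> subfield (vclosure D).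
Proof.
move=> Dsub; split=> [|x y Dx Dy e e0|x y Dx Dy e e0|x Dx e e0].
- exact/sub_vclosure/(subfield1 Dsub).
- have [d [Dd xd]] := Dx e e0; have [d' [Dd' yd']] := Dy e e0.
  exists (d - d'); split; first exact: (subfieldB Dsub).
  have -> : x - y - (d - d') = (x - d) - (y - d') by ring.
  exact: vnormB_lt.
- have M0 : 0 < vnorm x + 1 by rewrite ltr_wpDl ?vnorm_ge0.
  have [d' [Dd' yd']] := Dy _ (divr_gt0 e0 M0).
  have M'0 : 0 < vnorm d' + 1 by rewrite ltr_wpDl ?vnorm_ge0.
  have [d [Dd xd]] := Dx _ (divr_gt0 e0 M'0).
  exists (d * d'); split; first exact: (subfieldM Dsub).
  have -> : x * y - d * d' = x * (y - d') + (x - d) * d' by ring.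
  apply: vnormD_lt; rewrite vnormM.
    apply: le_lt_trans (_ : (vnorm x + 1) * vnorm (y - d') < e).
      by rewrite ler_wpM2r ?vnorm_ge0// lerDl.
    by rewrite mulrC -ltr_pdivlMr.
  apply: le_lt_trans (_ : vnorm (x - d) * (vnorm d' + 1) < e).
    by rewrite ler_wpM2l ?vnorm_ge0// lerDl.
  by rewrite -ltr_pdivlMr.
have [->|x0] := eqVneq x 0.
  by rewrite invr0; apply: sub_vclosure => //; exact: subfield0.
have x0' : 0 < vnorm x by rewrite vnorm_gt0.
have [|d [Dd xd]] := Dx (Num.min (vnorm x) (e * (vnorm x * vnorm x))).
  by rewrite lt_min x0' !mulr_gt0.
move: xd; rewrite lt_min => /andP[xd xd'].
have dx := seminorm_close (vnorm_semi L) xd.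
have d0 : d != 0 by rewrite -vnorm_gt0 dx.
exists d^-1; split; first exact: (subfieldV Dsub).
have -> : x^-1 - d^-1 = - ((x - d) / (x * d)) by field; rewrite ?x0 ?d0.
by rewrite vnormN vnormM vnormV vnormM dx ltr_pdivrMr ?mulr_gt0.
Qed.

(** One approximation of x by y in A ⊗ D closer than nrm x is enough: y has the norm of x, and y ^+
    n that of x ^+ n. *)
Lemma power_mult_vclosure D : power_mult D -> power_mult (vclosure D).
Proof.
move=> Dpow x n Sx; case: n => [|n]; first by rewrite !expr0.
have [x0|x0] := eqVneq (nrm x) 0.
  apply/eqP; rewrite eq_le seminormX_le ?T1//= x0 expr0n /=.
  exact: (seminorm_ge0 Tsemi).
have xpos : 0 < nrm x by rewrite lt_def x0 (seminorm_ge0 Tsemi).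
have [y [Dy xy]] := tens_span_vclosure xpos Sx.
have yx := seminorm_close Tsemi xy.
rewrite -yx -Dpow//; apply: (seminorm_close Tsemi).
rewrite -(seminormN Tsemi) opprB Dpow// yx.
rewrite (le_lt_trans (seminormX_close Tsemi T1 n.+1 xy))//= exprS.
by rewrite ltr_pM2r ?exprn_gt0.
Qed.

Lemma closed_under_limits_of_closed D : vcomplete L -> vclosure D `<=` D ->
  closed_under_limits D.
Proof.
move=> Lcomplete Dcl u uD /Lcomplete[x ux]; exists x; split=> //; apply: Dcl => e e0.
by have [n nP] := ux e e0; exists (u n); rewrite vnorm_distC nP.
Qed.

Lemma power_mult_range : power_mult (range i).
Proof.
move=> x n Sx; suff [a ->] : exists a, x = tens i a 1.
  by rewrite tensX expr1n !(tnorm_tens1 Nalg iso).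
elim/tens_span_ind: x / Sx => [|x y [a ->] [a' ->]|a _ [c _ <-]].
- by exists 0; rewrite tens0l.
- by exists (a + a'); rewrite tensDl.
- by exists (c *: a); rewrite tensZ mulr1.
Qed.

(** Power-multiplicativity at x involves only finitely many coordinates, which lie in one member of
    a chain, and the norm is that of T for every member. *)
Lemma maximal_power_mult_subfield : exists D, [/\ subfield D, range i `<=` D, power_mult D &
  forall E, subfield E -> D `<=` E -> power_mult E -> E `<=` D].
Proof.
(* The image of k is joined for the sake of the empty chain. *)
pose P (U : set L) := subfield (U `|` range i) /\ power_mult (U `|` range i).
have Pr : P (range i).
  by rewrite /P setUid; split; [exact: subfield_range|exact: power_mult_range].
have [F FP Ftot|U [[Usub Upow] Umax]] := @Zorn_bigcup L P.
  set V := \bigcup_(X in F) X.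
  have up (vs : seq L) : (forall v, v \in vs -> (V `|` range i) v) ->
      exists X, [/\ P X, forall v, v \in vs -> (X `|` range i) v &
        X `|` range i `<=` V `|` range i].
    (* The image of k stands in as long as no member of the chain has been met. *)
    move=> vsV; have [Y [PY vsY]] : exists Y, (Y = range i \/ F Y) /\
        forall v, v \in vs -> (Y `|` range i) v.
      elim: vs vsV => [|v vs IH] vsV; first by exists (range i); split; [left|].
      have [w wvs|Y [FY vsY]] := IH; first by apply: vsV; rewrite inE wvs orbT.
      have [[X FX Xv]|vi] := vsV v (mem_head _ _); last first.
        by exists Y; split=> // w; rewrite inE => /orP[/eqP->|/vsY//]; right.
      case: FY => [YE|FY].
        exists X; split=> [|w]; first by right.
        rewrite inE => /orP[/eqP->|/vsY]; first by left.
        by rewrite YE setUid; right.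
      have [XY|YX] := Ftot _ _ FX FY.
        exists Y; split=> [|w]; first by right.
        by rewrite inE => /orP[/eqP->|/vsY//]; left; exact: XY.
      exists X; split=> [|w]; first by right.
      rewrite inE => /orP[/eqP->|/vsY[Yw|iw]]; [by left|by left; exact: YX|by right].
    exists Y; case: PY => [YE|FY]; split=> //.
    - by rewrite YE.
    - by rewrite YE setUid; right.
    - exact: FP.
    - by move=> w [Yw|iw]; [left; exists Y|right].
  split; last first.
    move=> x n [s [sV ->]]; have [v /mapP[q /sV Vq ->]//|X [[_ Xpow] sX _]] := up (map snd s).
    by apply: Xpow; exists s; split=> // q qs; apply: sX; exact: map_f.
  split=> [|x y Vx Vy|x y Vx Vy|x Vx].
  - by right; exact: subfield1 (subfield_range i).
  - have [|X [[Xsub _] sX XV]] := up [:: x; y].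
      by move=> v; rewrite !inE => /orP[/eqP->|/eqP->].
    by apply: XV; apply: (subfieldB Xsub); apply: sX; rewrite !inE eqxx ?orbT.
  - have [|X [[Xsub _] sX XV]] := up [:: x; y].
      by move=> v; rewrite !inE => /orP[/eqP->|/eqP->].
    by apply: XV; apply: (subfieldM Xsub); apply: sX; rewrite !inE eqxx ?orbT.
  - have [|X [[Xsub _] sX XV]] := up [:: x].
      by move=> v; rewrite inE => /eqP->.
    by apply: XV; apply: (subfieldV Xsub); apply: sX; rewrite inE.
exists (U `|` range i); split=> //.
move=> E Esub UE Epow v Ev; apply: contrapT => Uv; apply: (Umax E).
  split; first by move=> w Uw; apply: UE; left.
  by move=> EU; apply: Uv; left; exact: EU.
rewrite /P (_ : E `|` range i = E)//; apply/seteqP; split=> [w [//|iw]|w Ew]; last by left.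
by apply: UE; right.
Qed.

Hypothesis Lcomplete : vcomplete L.
Hypothesis nat1 : forall n, (0 < n)%N -> vnorm (n%:R : L) = 1.

Lemma tnorm_spectral_complete : spectral nrm.
Proof.
have [D [Dsub iD Dpow Dmax]] := maximal_power_mult_subfield.
have Dcl : vclosure D `<=` D.
  apply: Dmax; [exact: vclosure_subfield|exact: sub_vclosure|exact: power_mult_vclosure].
have Dlim := closed_under_limits_of_closed Lcomplete Dcl.
have Dalg c : algebraic_over D c -> D c.
  move=> calg.
  have [Esub Epow] := power_mult_simple_extension Nalg Nspec iso nat1 Dsub iD Dlim Dpow calg.
  apply: (Dmax _ Esub _ Epow).
    by move=> v Dv; exists v%:P; rewrite ?hornerC//; exact: (poly_overC Dsub).
  by exists 'X; rewrite ?hornerX//; exact: (poly_overX Dsub).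
suff Dall b : D b.
  by move=> x n; apply: Dpow; apply: (@tens_spanW _ _ _ _ setT) (tens_span_full x).
apply: contrapT => Db; apply: (Db); have D1 : poly_over D 1.
  by rewrite -polyC1; apply: (poly_overC Dsub); exact: subfield1.
apply: (Dmax (fraction_extension D b)).
- exact: fraction_extension_subfield.
- by move=> v Dv; exists v%:P, 1; rewrite !hornerC oner_neq0 divr1; split=> //; exact: poly_overC.
- exact: power_mult_fraction_extension.
- by exists 'X, 1; rewrite hornerX hornerC oner_neq0 divr1; split=> //; exact: poly_overX.
Qed.

End TranscendentalStep.

(** * Descent from the completion *)

Section Descent.
Variables (R : realType) (k : realValuedFieldType R) (A : comAlgType k).
Variables (N : A -> R) (Nalg : alg_seminorm N).
Variables (l L : realValuedFieldType R) (i : {rmorphism k -> l}) (j : {rmorphism l -> L}).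
Hypotheses (jiso : isometric j).
Let ji : {rmorphism k -> L} := j \o i.

(** Base change along j is a ring morphism J. An l-linear retraction of L onto l gives it an
    additive left inverse H, and J preserves norms because J x can be represented over the image of
    l. *)
Lemma tnorm_spectral_descent :
  spectral (@tensor_seminorm R k A L ji N) -> spectral (@tensor_seminorm R k A l i N).
Proof.
have [|||J JD JE] := @tens_lift _ _ A i (tensor A ji) (fun a b => tens ji a (j b)).
- by move=> a a' b; rewrite tensDl.
- by move=> a b b'; rewrite rmorphD tensDr.
- by move=> c a b; rewrite tensZ rmorphM.
have J0 : J 0 = 0 by apply: (addrI (J 0)); rewrite -JD !addr0.
have Jsum (s : seq (A * l)) : J (\sum_(p <- s) tens i p.1 p.2) = \sum_(p <- s) tens ji p.1 (j p.2).
  by rewrite (big_morph J JD J0); apply: eq_bigr => p _; rewrite JE.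
have J1 : J 1 = 1 by rewrite (_ : J 1 = J (tens i 1 1))// JE rmorph1.
have JM x y : J (x * y) = J x * J y.
  have := tens_span_full x; elim/tens_span_ind: x / => [|x x' IH IH'|a b _].
  - by rewrite J0 !mul0r J0.
  - by rewrite mulrDl !JD mulrDl IH IH'.
  have := tens_span_full y; elim/tens_span_ind: y / => [|y y' IH IH'|a' b' _].
  - by rewrite J0 !mulr0 J0.
  - by rewrite mulrDr !JD mulrDr IH IH'.
  by rewrite tensM !JE tensM rmorphM.
have JX x n : J (x ^+ n) = J x ^+ n.
  by elim: n => [|n IH]; rewrite ?expr0// !exprS JM IH.
have jsub := subfield_range j.
have sub0 : lsubspace (range j) [set 0 : L].
  by split=> [//|_ _ -> ->|d _ _ ->]; rewrite /= ?addr0 ?mulr0.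
have [|g [gfun _ g1]] := separating_functional jsub sub0 (v := 1).
  exact/eqP/oner_neq0.
have [h [hg hD hZ]] := functional_range gfun.
have hj b : h (j b) = b.
  apply: (fmorph_inj j); rewrite hg -[j b]mulr1 (functionalZ gfun); last by exists b.
  by rewrite g1 mulr1.
have [|||H HD HE] := @tens_lift _ _ A ji (tensor A i) (fun a v => tens i a (h v)).
- by move=> a a' b; rewrite tensDl.
- by move=> a b b'; rewrite hD tensDr.
- by move=> c a b; rewrite hZ tensZ.
have H0 : H 0 = 0 by apply: (addrI (H 0)); rewrite -HD !addr0.
have HJ x : H (J x) = x.
  have := tens_span_full x; elim/tens_span_ind: x / => [|x x' IH IH'|a b _].
  - by rewrite J0 H0.
  - by rewrite JD HD IH IH'.
  - by rewrite JE HE hj.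
have Jnorm x : tensor_seminorm N (J x) = tensor_seminorm N x.
  have seml := tnorm_semi Nalg i; have semL := tnorm_semi Nalg ji.
  apply/eqP; rewrite eq_le; apply/andP; split; apply/ler_addgt0Pl => e e0.
    have xe : tensor_seminorm N x < e + tensor_seminorm N x by rewrite ltrDr.
    have [s [xs se]] := tnorm_rep xe.
    rewrite [in J x]xs Jsum -(big_map (fun p => (p.1, j p.2)) predT (fun p => tens ji p.1 p.2)).
    apply: tnorm_le; first by rewrite addr_ge0 ?(ltW e0) ?(seminorm_ge0 seml).
    by move=> _ /mapP[p ps ->] /=; rewrite jiso ltW// se.
  (* The retraction h need not be bounded on L, but on the image of l it is an isometry; so J x is
     represented there. *)
  have xe : tensor_seminorm N (J x) < e + tensor_seminorm N (J x) by rewrite ltrDr.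
  have jiD : range ji `<=` range j by move=> _ [c _ <-]; exists (i c).
  have Jspan : tens_span A ji (range j) (J x).
    have := tens_span_full x; elim/tens_span_ind: x / {xe} => [|x x' IH IH'|a b _].
    - by rewrite J0; exact: tens_span0.
    - by rewrite JD; exact: tens_spanD.
    - by rewrite JE; apply: tens_span_tens; exists b.
  have [s [Jxs sj se]] := tnorm_rep_in Nalg jsub jiD Jspan xe.
  have xE : x = \sum_(p <- [seq (p.1, h p.2) | p <- s]) tens i p.1 p.2.
    rewrite -[LHS]HJ Jxs (big_morph H HD H0) big_map; apply: eq_bigr => p _.
    by rewrite HE.
  rewrite [in leLHS]xE; apply: tnorm_le; first by rewrite addr_ge0 ?(ltW e0) ?(seminorm_ge0 semL).
  move=> _ /mapP[p ps ->] /=; have [b _ jb] := sj p ps.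
  by rewrite -jb hj -jiso jb ltW// se.
by move=> specL x n; rewrite -!Jnorm JX specL.
Qed.

End Descent.

(** * Integers in residue characteristic zero, and conclusion *)

(** A prime of norm below 1 would be the characteristic of the residue field; other positive
    integers are products of primes. *)
Lemma vnorm_nat_residual_char1 (R : realType) (k : realValuedFieldType R) n :
  residual_exp_char k 1 -> (0 < n)%N -> vnorm (n%:R : k) = 1.
Proof.
case=> [/pcharf_prime//|[pchar0 _] n0].
have prime_case q : prime q -> vnorm (q%:R : k) = 1.
  move=> pr; apply/eqP; rewrite eq_le vnorm_nat_le1 leNgt; apply/negP => q1.
  have : q \in [pchar residue_field k]; last by rewrite pchar0.
  rewrite inE pr /= -(rmorph_nat (\pi_({ideal_quot (vmaxideal k)})%qT)).
  rewrite -(rmorph0 (\pi_({ideal_quot (vmaxideal k)})%qT)) -Quotient.idealrBE subr0.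
  by rewrite inE rmorph_nat.
elim/ltn_ind: n n0 => n IH n0; have [n1|n1] := leqP n 1.
  by have -> : n = 1%N by [lia]; rewrite vnorm1.
move: (pdiv n) (pdiv_prime n1) (pdiv_dvd n) => q pr /dvdnP[m nE]; subst n.
have m0 : (0 < m)%N by case: m n0 {IH n1}.
rewrite natrM vnormM (prime_case q)// mulr1; apply: IH => //.
by rewrite ltn_Pmulr// prime_gt1.
Qed.

Theorem corollary5p3p2 (R : realType) (k : realValuedFieldType R) (p : nat)
    (hp : residual_exp_char k p)
    (A : comAlgType k) (N : A -> R)
    (normN : alg_norm N) (specN : spectral N)
    (hk : p = 1%N \/ completion_perfectoid k) :
  geometrically_spectral N.
Proof.
move=> l i iso; have Nalg := alg_norm_seminorm normN.
case: hk => [p1|/completion_perfectoid_frobenius[q [th [pr th1 qth frob]]]]; last first.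
  exact: (tnorm_spectral_frobenius Nalg specN iso pr th1 qth frob).
rewrite p1 in hp; pose j : {rmorphism l -> completion l} := @to_completion R l.
have jiso : isometric j by exact: to_completion_isometric.
apply: (tnorm_spectral_descent Nalg (j := j) jiso).
apply: (tnorm_spectral_complete Nalg specN).
- by move=> c; rewrite [LHS]jiso iso.
- exact: completion_complete.
- move=> n n0; rewrite -(rmorph_nat (j \o i)) [LHS]jiso iso.
  exact: vnorm_nat_residual_char1.
Qed.
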